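(* Let $\Sigma$ be a spherical rotational horo-shrinker about the $z$-axis such that $\Sigma$ does not intersect the rotation axis. Then $\Sigma$ belongs to a two-parameter family of spherical rotational horo-shrinkers $\mathcal{W}(x_0,z_0)$, $x_0,z_0>0$, where $x_0$ is the Euclidean distance of $\mathcal{W}(x_0,z_0)$ to the $z$-axis and $z_0$ is the Euclidean distance to the plane $z=0$ of the points of $\mathcal{W}(x_0,z_0)$ closest to the $z$-axis. Moreover: (1) The surfaces $\mathcal{W}(x_0,z_0)$ are bi-graphs on the $xy$-plane. (2) Each $\mathcal{W}(x_0,z_0)$ is contained in the closure of the non-bounded domain determined by the Euclidean cylinder about the $z$-axis of radius $x_0$, i.e. in $\{(x,y,z)\in\mathbb{R}^3_+: x^2+y^2\ge x_0^2\}$. (3) Each $\mathcal{W}(x_0,z_0)$ has the topology of an annulus, and its ends oscillate around the horosphere $\mathsf{H}_1=\{z=1\}$.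
   Context: $\mathbb{H}^3$ is the upper half-space $\mathbb{R}^3_+=\{z>0\}$ with the metric $\langle\cdot,\cdot\rangle=\frac{1}{z^2}(dx^2+dy^2+dz^2)$. A horo-shrinker is an isometric immersion $\Psi:\Sigma\to\mathbb{H}^3$ of an oriented smooth surface whose mean curvature $H$ satisfies $H=\langle N,\partial_z\rangle$, where $N$ is the unit normal; $H$ is the average of the principal curvatures, with the sign convention that the horosphere $z=c$ with $N=c\,\partial_z$ has $H=1$. A spherical rotational surface about the $z$-axis is one invariant by Euclidean rotations about the $z$-axis; it is parametrized by $(s,t)\mapsto(x(s)\cos t,x(s)\sin t,z(s))$. If the generating curve $(x(s),0,z(s))$ is parametrized by Euclidean arc-length, the horo-shrinker condition is equivalent to $$x'=\cos\theta,\qquad z'=\sin\theta,\qquad \theta'=-\frac{\sin\theta}{x}+2\cos\theta\,\frac{1-z}{z^2}$$ for some smooth function $\theta(s)$. $\mathcal{W}(x_0,z_0)$ is the surface generated by the maximal solution whose curve passes through $(x_0,0,z_0)$ with vertical tangent (i.e. locally a graph $x=x(z)$ with $x(z_0)=x_0$, $x'(z_0)=0$). Surfaces are connected and maximal (not extendable to a larger rotational horo-shrinker). A bi-graph on the $xy$-plane means that the surface is the union of two graphical components $z=z_+(r)$ and $z=z_-(r)$, with $r=\sqrt{x^2+y^2}\ge x_0$, meeting along the circle $r=x_0$, $z=z_0$. ''The ends oscillate around $\mathsf{H}_1$'' means that each of $z_\pm(r)$ has, as $r\to\infty$, an infinite sequence of alternating local maxima with value $>1$ and local minima with value $<1$.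
   Formalization: The classification also assumes that the closure of Σ in R^3 does not meet the plane z=0: for each a>0 a maximal rotational horo-shrinker leaves z=0 orthogonally at radius a, avoids the axis and is no W(x0,z0). Every W(x0,z0) meets this condition. *)

(* Defs.v *)
From HB Require Import structures.
From mathcomp Require Import all_boot all_order all_algebra.
From mathcomp Require Import all_classical all_reals all_analysis.

Set Implicit Arguments.
Unset Strict Implicit.
Unset Printing Implicit Defensive.

Import Order.TTheory GRing.Theory Num.Theory.
Import numFieldNormedType.Exports.

Local Open Scope classical_set_scope.
Local Open Scope ring_scope.

(* Points of the half-space, and vectors tangent to it, are rows of
   coordinates (x, y, z). *)
Definition ix : 'I_3 := @Ordinal 3 0 isT.
Definition iy : 'I_3 := @Ordinal 3 1 isT.
Definition iz : 'I_3 := @Ordinal 3 2 isT.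

Section HyperbolicSpace.
Variable R : realType.

Definition point (a b c : R) : 'rV[R]_3 := \row_k [:: a; b; c]`_k.

Definition basis (k : 'I_3) : 'rV[R]_3 := delta_mx 0 k.

Definition height (q : 'rV[R]_3) : R := q 0 iz.

Definition axis_dist (q : 'rV[R]_3) : R :=
  Num.sqrt (q 0 ix ^+ 2 + q 0 iy ^+ 2).

Definition metric (q : 'rV[R]_3) : 'M[R]_3 := (height q ^- 2)%:M.

Definition hdot (q u v : 'rV[R]_3) : R := (u *m metric q *m v^T) 0 0.

Definition christoffel (k i j : 'I_3) (q : 'rV[R]_3) : R :=
  2^-1 * \sum_l invmx (metric q) k l *
    ('D_(basis i) (fun p => metric p j l) q
     + 'D_(basis j) (fun p => metric p i l) q
     - 'D_(basis l) (fun p => metric p i j) q).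

(* Partial derivatives of a parametrized surface (s, t) |-> X s t;
   index 0 is s and index 1 is t. *)
Definition pder (i : 'I_2) (f : R -> R -> R) (s t : R) : R :=
  if i == 0 then derive1 (fun a => f a t) s else derive1 (fun b => f s b) t.

Definition tangent (i : 'I_2) (X : R -> R -> 'rV[R]_3) (s t : R) : 'rV[R]_3 :=
  \row_k pder i (fun a b => X a b 0 k) s t.

(* Covariant derivative along the i-th coordinate direction of the j-th
   coordinate field of X. *)
Definition covder (i j : 'I_2) (X : R -> R -> 'rV[R]_3) (s t : R) : 'rV[R]_3 :=
  \row_k (tangent i (tangent j X) s t 0 k
          + \sum_a \sum_b christoffel k a b (X s t)
                          * tangent i X s t 0 a * tangent j X s t 0 b).

Definition first_form (X : R -> R -> 'rV[R]_3) (s t : R) : 'M[R]_2 :=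
  \matrix_(i, j) hdot (X s t) (tangent i X s t) (tangent j X s t).

Definition second_form (X : R -> R -> 'rV[R]_3) (s t : R) (n : 'rV[R]_3) :
    'M[R]_2 :=
  \matrix_(i, j) hdot (X s t) (covder i j X s t) n.

(* Half the trace of the shape operator, whose eigenvalues are the principal
   curvatures; on the horosphere z = c with n = c d/dz it equals 1. *)
Definition mean_curvature (X : R -> R -> 'rV[R]_3) (s t : R) (n : 'rV[R]_3) :
    R :=
  \tr (invmx (first_form X s t) *m second_form X s t n) / 2.

Definition unit_normal (X : R -> R -> 'rV[R]_3) (s t : R) (n : 'rV[R]_3) :=
  hdot (X s t) n n = 1 /\ forall i, hdot (X s t) n (tangent i X s t) = 0.

Definition horo_shrinker_at (X : R -> R -> 'rV[R]_3) (s t : R)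
    (n : 'rV[R]_3) :=
  mean_curvature X s t n = hdot (X s t) n (basis iz).

Definition smooth_on (I : set R) (f : R -> R) :=
  forall n s, I s -> derivable (derive1n n f) s 1.

Definition rot (x z : R -> R) (s t : R) : 'rV[R]_3 :=
  point (x s * cos t) (x s * sin t) (z s).

(* Generating curves lie in the whole half-plane {y = 0, z > 0}, so x may change
   sign: a rotational surface through the axis is generated by the full smooth
   section with that plane, which crosses the axis. The parametrization rot is
   an immersion exactly where x != 0; at a crossing the equation holds by
   continuity. It does not depend on the choice of the unit normal, as both of
   its sides are odd in n. *)
Definition horo_shrinker_curve (I : set R) (x z : R -> R) :=
  [/\ [/\ open I, is_interval I & I !=set0],
      smooth_on I x /\ smooth_on I z,
      forall s, I s -> derive1 x s ^+ 2 + derive1 z s ^+ 2 = 1,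
      forall s, I s -> 0 < z s &
      forall s t n, I s -> x s != 0 ->
        unit_normal (rot x z) s t n -> horo_shrinker_at (rot x z) s t n].

(* Extensions across the axis count: for instance x = s, z = 1 on ]0, +oo[
   generates a punctured horosphere and is not maximal. *)
Definition maximal_curve (I : set R) (x z : R -> R) :=
  horo_shrinker_curve I x z /\
  forall (J : set R) (x' z' : R -> R),
    horo_shrinker_curve J x' z' -> I `<=` J ->
    (forall s, I s -> x' s = x s /\ z' s = z s) -> J `<=` I.

(* An oriented surface immersed in the half-space: pos is the immersion and nu
   the unit normal along it. *)
Record surface := Surface {
  carrier :> topologicalType;
  pos : carrier -> 'rV[R]_3;
  nu : carrier -> 'rV[R]_3 }.

(* The surface S is parametrized by rot x z through P : I x R -> S. The last
   condition says that pos is injective near each parallel. Hence P identifies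
   t with t + 2 pi, and is otherwise locally injective off the axis, while
   distant parallels may lie over the same circle of the half-space without
   being identified in S. A closed generating curve is allowed, so S may a
   priori be a torus. *)
Definition generated_through (S : surface) (I : set R) (x z : R -> R)
    (P : R * R -> S) :=
  [/\ forall a, I a.1 -> {for a, continuous P},
      forall U : set (R * R), open U -> (forall a, U a -> I a.1) ->
        open (P @` U),
      forall p : S, exists2 a, I a.1 & P a = p,
      forall s t, I s -> pos (P (s, t)) = rot x z s t &
      forall s0, I s0 -> \forall s \near s0 & s' \near s0, forall t t',
        rot x z s t = rot x z s' t' -> P (s, t) = P (s', t')].

Definition generated_by (S : surface) (I : set R) (x z : R -> R) :=
  exists P : R * R -> S,
    [/\ hausdorff_space S, continuous (@nu S), generated_through I x z P &
        forall s t, I s -> x s != 0 -> unit_normal (rot x z) s t (nu (P (s, t)))].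

Definition rotational_horo_shrinker (S : surface) :=
  exists I x z, maximal_curve I x z /\ generated_by S I x z.

Definition avoids_axis (S : surface) := forall p : S, 0 < axis_dist (pos p).

(* Needed for the classification. For every a > 0 there is a solution
   graph x = x(z) with x(0) = a that leaves the ideal plane z = 0 orthogonally,
   x'(z) ~ z^2 / (2 a). It generates a maximal rotational horo-shrinker
   contained in {axis_dist > a} on which x is strictly increasing: it avoids the
   axis, but has no closest point to it, so it is none of the W(x0, z0). It is
   the limit of the upper halves of W(a, z0) as z0 -> 0. *)
Definition no_finite_ideal_point (S : surface) :=
  forall q, closure (range (@pos S)) q -> height q != 0.

Definition is_W (x0 z0 : R) (S : surface) :=
  exists I x z,
    [/\ maximal_curve I x z, generated_by S I x z &
        exists s0, [/\ I s0, x s0 = x0, z s0 = z0 & derive1 x s0 = 0]].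

Definition same_surface (S S' : surface) :=
  exists (h : S -> S') (k : S' -> S),
    [/\ continuous h, continuous k, cancel h k, cancel k h &
        forall p, pos (h p) = pos p].

Definition graph_component (S : surface) (x0 : R) (f : R -> R) (A : set S) :=
  [/\ connected A, set_inj A (@pos S),
      @pos S @` A = [set q | x0 <= axis_dist q /\ height q = f (axis_dist q)],
      {within `[x0, +oo[, continuous f} & smooth_on `]x0, +oo[ f].

(* The two graphs may cross over r > x0, so the components meet as parts of S
   and not as subsets of the half-space. *)
Definition bigraph (S : surface) (x0 z0 : R) (zp zm : R -> R) :=
  [/\ zp x0 = z0, zm x0 = z0 &
      exists A B : set S,
        [/\ graph_component x0 zp A, graph_component x0 zm B,
            A `|` B = setT &
            A `&` B = @pos S @^-1`
                        [set q | axis_dist q = x0 /\ height q = z0]]].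

Definition annulus : set (R * R) :=
  [set q | 1 < q.1 ^+ 2 + q.2 ^+ 2 /\ q.1 ^+ 2 + q.2 ^+ 2 < 4].

Definition homeo_annulus (T : topologicalType) :=
  exists (f : T -> R * R) (g : R * R -> T),
    [/\ continuous f, {within annulus, continuous g},
        forall p, annulus (f p), cancel f g &
        forall q, annulus q -> f (g q) = q].

Definition oscillates_around_one (x0 : R) (f : R -> R) :=
  exists r : nat -> R,
    [/\ forall n, x0 < r n /\ r n < r n.+1,
        r @ \oo --> +oo,
        forall n, 1 < f (r n.*2) /\
          \forall y \near r n.*2, f y <= f (r n.*2) &
        forall n, f (r n.*2.+1) < 1 /\
          \forall y \near r n.*2.+1, f (r n.*2.+1) <= f y].

End HyperbolicSpace.

(* Main.v *)
Require Import Defs.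
From mathcomp Require Import all_boot all_order all_algebra.
From mathcomp Require Import all_classical all_reals all_analysis.
From mathcomp Require Import ring lra.
Import Order.TTheory GRing.Theory Num.Theory.
Import numFieldNormedType.Exports.
(* Imported again so that rot and point are the ones of the half-space. *)
Import Defs.
Local Open Scope classical_set_scope.
Local Open Scope ring_scope.
Set Implicit Arguments.
Unset Strict Implicit.
Unset Printing Implicit Defensive.

(** Write u = x' and v = z' for the unit tangent of the generating curve. Off
    the axis the horo-shrinker condition says that the Euclidean curvature of
    the curve is k = - v / x + 2 u (1 - z) / z^2 (horo_shrinker_rotP), that is,
    u' = - v k and v' = u k (ode).

    The whole study rests on one monotone quantity. Along a solution with x > 0
    the product u e^(-2/z) / z^2 has derivative v^2 / x times the positive
    factor e^(-2/z) / z^2 (d_energy). If u = 0 at s = 0, this product is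
    positive for s > 0; so u > 0 and x increases, and since the factor is bounded
    and tends to 0 as z goes to 0 or to infinity, z stays in a compact part of
    ]0, +oo[ (energy_bounds). Solutions therefore exist for all s
    (W_profile_exists), with x minimal at s = 0 only, and each of the two halves
    is a graph z = f(x) over x >= x0 (branch_graph). Oscillation comes from
    (x v)' = 2 x u^2 (1 - z) / z^2: if z stayed on one side of 1, x v would be
    monotone and either x v or z would diverge, unless z is constantly 1, which
    uniqueness excludes (crosses_one).

    For the classification, let a maximal curve avoid the axis, say x > 0. If x'
    vanishes somewhere, the curve is the profile of some W(x0, z0) up to a
    translation and a reversal of s. Otherwise x is monotone, say increasing, and
    the hypothesis on the ideal plane bounds z below on a backward half of the
    curve. This half has finite length, because the equation keeps u away from 0
    at -oo (no_monotone_halfline). If x has a positive limit at its backward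
    endpoint then the curve extends as a regular solution. If x tends to 0 then
    v = O(x), and the curve extends across the axis by reflection
    (axis_extension); smoothness of the extension is the regularity of the
    Euler equations s g' + n g = f satisfied by x / s and x v / s^2
    (class_C_average). Both cases contradict maximality (no_monotone_maximal).

    A surface generated by the profile is parametrized by the (s, t) plane
    through a continuous open surjection. Its fibers are those of polar
    coordinates on an annulus (fiberP): the two ends may cross in the half-space,
    but if two sheets were identified along a crossing they would coincide near
    it, the curve would be symmetric, and its velocity would vanish at the
    midpoint (ends_disjoint). Hence the surface is homeomorphic to the annulus,
    and two surfaces with the same data are the same. *)

(** * Calculus on the line *)

Section DerivationRules.
Variable R : realType.
Implicit Types f g : R -> R.

Lemma is_derive_continuous f (s d : R) :
  is_derive s 1 f d -> {for s, continuous f}.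
Proof.
by case=> df _; exact/differentiable_continuous/derivable1_diffP.
Qed.

Lemma closed_itvW (a b s : R) : a < s < b -> a <= s <= b.
Proof. by case/andP => *; rewrite !ltW. Qed.

Lemma within_continuous f (a b : R) :
  (forall s, a <= s <= b -> {for s, continuous f}) ->
  {within `[a, b], continuous f}.
Proof.
move=> cf; apply: continuous_in_subspaceT => s.
by rewrite inE /= in_itv /=; apply: cf.
Qed.

(** Intervals appear as inequalities, which the arithmetic tactics can use. *)
Lemma mvt f (df : R -> R) (a b : R) : a < b ->
  (forall s, a <= s <= b -> {for s, continuous f}) ->
  (forall s, a < s < b -> is_derive s 1 f (df s)) ->
  exists2 c, a < c < b & f b - f a = df c * (b - a).
Proof.
move=> ab cf Df.
have [c cab ->] := @MVT _ f df a b ab Df (within_continuous cf).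
by exists c.
Qed.

Lemma deriv_ge0_le f (df : R -> R) (a b : R) : a <= b ->
  (forall s, a <= s <= b -> is_derive s 1 f (df s)) ->
  (forall s, a <= s <= b -> 0 <= df s) -> f a <= f b.
Proof.
rewrite le_eqVlt => /predU1P[->//|ab] Df df0.
have [c cab E] := mvt ab (fun s h => is_derive_continuous (Df s h))
  (fun s h => Df s (closed_itvW h)).
by rewrite -subr_ge0 E mulr_ge0 ?subr_ge0 ?(ltW ab)// df0// closed_itvW.
Qed.

Lemma deriv_gt0_lt f (df : R -> R) (a b : R) : a < b ->
  (forall s, a <= s <= b -> {for s, continuous f}) ->
  (forall s, a < s < b -> is_derive s 1 f (df s)) ->
  (forall s, a < s < b -> 0 < df s) -> f a < f b.
Proof.
move=> ab cf Df df0; have [c cab E] := mvt ab cf Df.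
by rewrite -subr_gt0 E mulr_gt0 ?subr_gt0 // df0.
Qed.

Lemma deriv_bound f (df : R -> R) (a b C : R) : a <= b ->
  (forall s, a <= s <= b -> is_derive s 1 f (df s)) ->
  (forall s, a <= s <= b -> `|df s| <= C) -> `|f b - f a| <= C * (b - a).
Proof.
rewrite le_eqVlt => /predU1P[->|ab] Df dfC; first by rewrite !subrr normr0 mulr0.
have [c cab ->] := mvt ab (fun s h => is_derive_continuous (Df s h))
  (fun s h => Df s (closed_itvW h)).
rewrite normrM (ger0_norm (_ : 0 <= b - a)) ?subr_ge0 ?(ltW ab)//.
by rewrite ler_wpM2r ?subr_ge0 ?(ltW ab)// dfC// closed_itvW.
Qed.

Lemma d_eq f (s a b : R) : is_derive s 1 f a -> a = b -> is_derive s 1 f b.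
Proof. by move=> h <-. Qed.

Lemma d_cst (c s : R) : is_derive s 1 (fun=> c) 0.
Proof. exact: is_derive_cst. Qed.

Lemma d_id (s : R) : is_derive s 1 (fun t : R => t) 1.
Proof. exact: is_derive_id. Qed.

Lemma d_add f g (s a b : R) : is_derive s 1 f a -> is_derive s 1 g b ->
  is_derive s 1 (fun t => f t + g t) (a + b).
Proof. by move=> ? ?; exact: is_deriveD. Qed.

Lemma d_opp f (s a : R) : is_derive s 1 f a -> is_derive s 1 (fun t => - f t) (- a).
Proof. by move=> ?; exact: is_deriveN. Qed.

Lemma d_mul f g (s a b : R) : is_derive s 1 f a -> is_derive s 1 g b ->
  is_derive s 1 (fun t => f t * g t) (a * g s + f s * b).
Proof.
move=> ? ?; apply: (is_derive_eq (is_deriveM _ _)).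
by rewrite /GRing.scale /= addrC mulrC [X in _ + X]mulrC.
Qed.

Lemma d_inv f (s a : R) : f s != 0 -> is_derive s 1 f a ->
  is_derive s 1 (fun t => (f t)^-1) (- a / f s ^+ 2).
Proof.
move=> h ?; apply: (is_derive_eq (is_deriveV h _)).
by rewrite /GRing.scale /= !mulNr mulrC.
Qed.

Lemma d_exp f (s a : R) n : is_derive s 1 f a ->
  is_derive s 1 (fun t => f t ^+ n) (n%:R * f s ^+ n.-1 * a).
Proof.
move=> h; have := is_deriveX n h.
have -> : f ^+ n = (fun t => f t ^+ n) by apply/funext => t; rewrite fctE.
by move=> {}h; apply: (is_derive_eq h); rewrite /GRing.scale /= mulr_natl.
Qed.

Lemma d_comp f g (s a b : R) : is_derive (g s) 1 f a -> is_derive s 1 g b ->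
  is_derive s 1 (fun t => f (g t)) (a * b).
Proof. exact: is_derive1_comp. Qed.

Lemma d_expR f (s a : R) : is_derive s 1 f a ->
  is_derive s 1 (fun t => expR (f t)) (expR (f s) * a).
Proof. by move=> h; apply: d_comp h. Qed.

End DerivationRules.

(** Differentiates a composite expression, leaving the comparison of the
    derivatives and the nonvanishing of denominators. *)
Ltac deriv_step :=
  first [ eassumption
        | notypeclasses refine (d_cst _ _) | notypeclasses refine (d_id _)
        | notypeclasses refine (d_add _ _) | notypeclasses refine (d_opp _)
        | notypeclasses refine (d_mul _ _) | notypeclasses refine (d_exp _ _)
        | notypeclasses refine (d_expR _) | notypeclasses refine (d_inv _ _) ].
Ltac deriv := notypeclasses refine (d_eq _ _); [ repeat deriv_step .. | rewrite /= ].

Section Calculus.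
Variable R : realType.
Implicit Types f g : R -> R.

Lemma is_derive_exp_scale (k s : R) :
  is_derive s 1 (fun t => expR (k * t)) (k * expR (k * s)).
Proof.
by deriv; ring.
Qed.

(** Integrating a bound on the derivative that grows exponentially away from 0
    gains the factor 1/k: this is what makes Picard iteration a contraction on
    the whole line at once. *)
Lemma exp_bound_fwd f (df : R -> R) (T k c : R) : 0 < k -> 0 <= T ->
  (forall s, 0 <= s <= T -> is_derive s 1 f (df s)) ->
  (forall s, 0 <= s <= T -> `|df s| <= c * expR (k * s)) -> 0 <= c ->
  `|f T - f 0| <= c / k * expR (k * T).
Proof.
move=> k0 T0 Df dfC c0.
have H (e : R) : `|e| = 1 -> e * (f T - f 0) <= c / k * expR (k * T).
  move=> e1.
  pose g t := c / k * expR (k * t) - e * f t.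
  have : g 0 <= g T.
    apply: (@deriv_ge0_le _ g (fun t => c * expR (k * t) - e * df t)) => // s sT.
      have h1 := Df s sT; have h2 := is_derive_exp_scale k s.
      by deriv; field; rewrite gt_eqF.
    rewrite subr_ge0 (le_trans (ler_norm _))// normrM e1 mul1r.
    exact: dfC.
  rewrite /g mulr0 expR0 mulr1.
  have : 0 <= c / k by rewrite divr_ge0 // ltW.
  by rewrite mulrBr; lra.
rewrite ler_norml; apply/andP; split.
  by have := H (-1); rewrite normrN normr1 => /(_ erefl); lra.
by have := H 1; rewrite normr1 => /(_ erefl); lra.
Qed.

Lemma is_derive_reverse f (s d : R) :
  is_derive (- s) 1 f d -> is_derive s 1 (fun t => f (- t)) (- d).
Proof.
move=> h; have := @is_derive1_comp _ f -%R s d (-1) h (is_deriveNid _ _).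
by rewrite mulrN1.
Qed.

Lemma is_derive_affine f (k c s d : R) :
  is_derive (k * s + c) 1 f d -> is_derive s 1 (fun t => f (k * t + c)) (k * d).
Proof.
move=> h.
have h' : is_derive s 1 (fun t : R => k * t + c) k by deriv; ring.
by rewrite mulrC; exact: (@d_comp _ f (fun t : R => k * t + c) s d k h h').
Qed.

Lemma exp_bound f (df : R -> R) (T k c : R) : 0 < k ->
  (forall s : R, `|s| <= `|T| -> is_derive s 1 f (df s)) ->
  (forall s : R, `|s| <= `|T| -> `|df s| <= c * expR (k * `|s|)) -> 0 <= c ->
  `|f T - f 0| <= c / k * expR (k * `|T|).
Proof.
move=> k0 Df dfC c0.
have [T0|/ltW T0] := leP 0 T.
  have nT s : 0 <= s <= T -> `|s| <= `|T| /\ `|s| = s.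
    by move=> /andP[? ?]; rewrite !ger0_norm.
  rewrite (ger0_norm T0); apply: (@exp_bound_fwd f df) => // s /nT[h1 h2].
    exact: Df.
  by have := dfC _ h1; rewrite h2.
have nT s : 0 <= s <= -T -> `|-s| <= `|T| /\ `|-s| = s.
  by move=> /andP[? ?]; rewrite normrN (ler0_norm T0) ger0_norm.
rewrite (ler0_norm T0).
have := @exp_bound_fwd (fun t => f (- t)) (fun t => - df (- t)) (- T) k c.
rewrite opprK oppr0; apply => //; rewrite ?oppr_ge0 //.
  by move=> s /nT[h1 h2]; apply: is_derive_reverse; exact: Df.
by move=> s /nT[h1 h2]; have := dfC _ h1; rewrite h2 normrN.
Qed.

Lemma deriv0_const f (a b : R) : a <= b ->
  (forall s, a <= s <= b -> is_derive s 1 f 0) -> f b = f a.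
Proof.
move=> ab Df; apply/eqP; rewrite -subr_eq0 -normr_le0.
rewrite -[leRHS](mul0r (b - a)); apply: (deriv_bound ab Df) => s _.
by rewrite normr0.
Qed.

Lemma near_dist (s e : R) : 0 < e -> \forall t \near s, `|s - t| < e.
Proof. by move=> e0; exact: (@cvgr_dist_lt _ _ _ _ _ (fun t => t) s (@cvg_id _ _)). Qed.

Let mu := (@lebesgue_measure R).

Lemma local_primitive f (T : R) : 0 < T -> continuous f ->
  exists g, forall s : R, `|s| < T -> is_derive s 1 g (f s).
Proof.
move=> T0 cf.
exists (fun x => \int[mu]_(t in `[- T, x]) (f t))%R => s.
rewrite ltr_norml => /andP[s1 s2].
have If : mu.-integrable `[(- T), T] (EFin \o f).
  apply: continuous_compact_integrable; first exact: segment_compact.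
  exact: continuous_subspaceT.
have [h1 h2] := continuous_FTC1_closed s2 If s1 (cf s).
by apply: DeriveDef => //; rewrite -derive1E.
Qed.

(** Local primitives vanishing at 0 agree wherever two of them are defined, so
    the one on ]- |s| - 1, |s| + 1[ can be used at each s. *)
Lemma primitive f : continuous f ->
  exists2 g, g 0 = 0 & forall s : R, is_derive s 1 g (f s).
Proof.
move=> cf.
have /choice[G HG] : forall T : R, exists g, 0 < T ->
    g 0 = 0 /\ forall s : R, `|s| < T -> is_derive s 1 g (f s).
  move=> T; have [T0|_] := ltP 0 T; last by exists (fun=> 0).
  have [g Hg] := local_primitive T0 cf.
  exists (fun s => g s - g 0) => _; split; first by rewrite subrr.
  move=> s /Hg h; rewrite -[f s]subr0.
  exact: (is_deriveB h (is_derive_cst _ _ _)).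
have agree T T' s : 0 < T -> 0 < T' -> `|s| < T -> `|s| < T' -> G T s = G T' s.
  move=> T0 T'0 sT sT'.
  have [z1 d1] := HG T T0; have [z2 d2] := HG T' T'0.
  pose h t := G T t - G T' t.
  have : `|h s - h 0| <= 0 / 1 * expR (1 * `|s|).
    apply: (@exp_bound h (fun=> 0)) => // t ts.
      rewrite -(subrr (f t)); apply: is_deriveB.
        exact/d1/(le_lt_trans ts).
      exact/d2/(le_lt_trans ts).
    by rewrite normr0 mul0r.
  rewrite !mul0r normr_le0 /h z1 z2 subrr subr0 subr_eq0.
  by move/eqP.
exists (fun s => G (`|s| + 1) s).
  by rewrite normr0 add0r; case: (HG 1 ltr01).
move=> s; have p0 (t : R) : 0 < `|t| + 1 by rewrite ltr_wpDl.
have p1 (t : R) : `|t| < `|t| + 1 by rewrite ltrDl.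
apply: (near_eq_is_derive (f := G (`|s| + 2))).
  near=> t; apply: agree => //.
  have h : `|s - t| < 1.
    by near: t; exact: near_dist.
  have := ler_distD s t 0; rewrite !subr0 distrC => h1.
  by apply: (le_lt_trans h1); rewrite addrC ltrD2l (lt_trans h)// ltr1n.
have [|_ h] := HG (`|s| + 2); first by rewrite ltr_wpDl ?ltr0n.
by apply: h; rewrite ltrDl.
Unshelve. all: by end_near. Qed.

End Calculus.

(** * Global solutions of bounded Lipschitz systems *)

Section Picard.
Variable R : realType.

Lemma half_pow_small (c e : R) : 0 < e -> exists n, c * 2^-1 ^+ n < e.
Proof.
move=> e0; have [c0|c0] := leP c 0.
  by exists 0%N; rewrite expr0 mulr1 (le_lt_trans c0).
have [n _ hn] := near_infty_natSinv_expn_lt (PosNum (divr_gt0 e0 c0)).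
exists n; have := hn n (leqnn _); rewrite /= -exprVn => h.
by move: h; rewrite mul1r ltr_pdivlMr // mulrC.
Qed.

(** Estimates below hold up to an error c 2^-n for every n. *)
Lemma le_half_pow (a b c : R) : (forall n, a <= b + c * 2^-1 ^+ n) -> a <= b.
Proof.
move=> h; apply/ler_addgt0Pr => e /(half_pow_small c)[n hn].
by apply: (le_trans (h n)); rewrite lerD2l ltW.
Qed.

(** The sequences u_n - 2 A 2^-n and u_n + 2 A 2^-n are monotone and enclose the
    limit, which is thus a supremum. *)
Lemma geometric_limit (u : nat -> R) (A : R) :
  (forall n, `|u n.+1 - u n| <= A * 2^-1 ^+ n) ->
  exists l, forall n, `|l - u n| <= 2 * A * 2^-1 ^+ n.
Proof.
move=> hu.
pose v n := u n - 2 * A * 2^-1 ^+ n; pose w n := u n + 2 * A * 2^-1 ^+ n.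
have vw n : (v n <= v n.+1) && (w n.+1 <= w n).
  have := hu n; rewrite ler_norml => /andP[h1 h2].
  by rewrite /v /w exprS; apply/andP; split; lra.
have A0 : 0 <= A by have := hu 0%N; rewrite expr0 mulr1; exact: le_trans.
have vle n m : v n <= v (n + m)%N.
  elim: m => [|m IH]; first by rewrite addn0.
  by rewrite addnS (le_trans IH)//; case/andP: (vw (n + m)%N).
have wle n m : w (n + m)%N <= w n.
  elim: m => [|m IH]; first by rewrite addn0.
  by rewrite addnS (le_trans _ IH)//; case/andP: (vw (n + m)%N).
have vlew n m : v n <= w m.
  apply: (le_trans (vle n m)); rewrite addnC; apply: le_trans (wle m n).
  rewrite /v /w; have : 0 <= 2 * A * 2^-1 ^+ (m + n) by rewrite !mulr_ge0// exprn_ge0.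
  by lra.
exists (sup (range v)) => n.
have ub : ubound (range v) (w n) by move=> _ [m _ <-].
have h1 : sup (range v) <= w n.
  by apply: ge_sup => //; exists (v 0%N); exists 0%N.
have h2 : v n <= sup (range v).
  by apply: ub_le_sup; [exists (w n)|exists n].
by rewrite ler_norml; move: h1 h2; rewrite /v /w; lra.
Qed.

(** The unknown is a family of functions indexed by J, and the sup norm on
    J -> R enters only through its upper bounds d. *)
Variables (J : Type) (F : J -> (J -> R) -> R) (C L : R).
Hypothesis L0 : 0 < L.
Hypothesis bF : forall i y, `|F i y| <= C.
Hypothesis lF : forall i y y' d,
  (forall j, `|y j - y' j| <= d) -> `|F i y - F i y'| <= L * d.

Let C0 (i : J) : 0 <= C.
Proof. by apply: le_trans (bF i (fun=> 0)). Qed.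

Let lip_continuous i (y : J -> R -> R) :
  (forall j s t, `|y j s - y j t| <= C * `|s - t|) ->
  continuous (fun t => F i (y^~ t)).
Proof.
have LC : 0 < L * C + 1 by rewrite ltr_wpDl// mulr_ge0 ?(ltW L0)// C0.
move=> hy s; apply/cvgrPdist_lt => e e0; near=> t.
apply: (@le_lt_trans _ _ (L * (C * `|s - t|))).
  by apply: lF => j; exact: hy.
rewrite mulrA (@le_lt_trans _ _ ((L * C + 1) * `|s - t|))//.
  by rewrite ler_wpM2r// lerDl.
rewrite mulrC -ltr_pdivlMr//; near: t.
by apply: near_dist; exact: divr_gt0.
Unshelve. all: by end_near. Qed.

(** Two solutions of a Lipschitz system differ by at most K 2^-n e^(2 L s) for
    every n: feeding such a bound into the equation and integrating halves it. *)
Lemma lipschitz_unique (y y' : J -> R -> R) (T : R) : 0 <= T ->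
  (forall i, y i 0 = y' i 0) ->
  (forall i s, 0 <= s <= T -> is_derive s 1 (y i) (F i (y^~ s))) ->
  (forall i s, 0 <= s <= T -> is_derive s 1 (y' i) (F i (y'^~ s))) ->
  forall i, y i T = y' i T.
Proof.
move=> T0 y0 Dy Dy'.
have L2 : 0 < 2 * L by rewrite mulr_gt0.
have step (c : R) i s : 0 <= c -> 0 <= s <= T ->
    (forall j r, 0 <= r <= s -> `|F j (y^~ r) - F j (y'^~ r)| <= c * expR (2 * L * r)) ->
    `|y i s - y' i s| <= c / (2 * L) * expR (2 * L * s).
  move=> c0 /andP[s0 sT] h.
  have := @exp_bound_fwd _ (fun r => y i r - y' i r)
    (fun r => F i (y^~ r) - F i (y'^~ r)) s (2 * L) c L2 s0.
  rewrite y0 subrr subr0; apply => //; last by move=> r hr; apply: h.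
  move=> r /andP[r0 rs].
  have rT : 0 <= r <= T by rewrite r0 (le_trans rs).
  by apply: d_add (Dy _ _ rT) (d_opp (Dy' _ _ rT)).
have main n : forall i s, 0 <= s <= T ->
    `|y i s - y' i s| <= C / L * 2^-1 ^+ n * expR (2 * L * s).
  elim: n => [|n IH] i s sT.
    have := step (2 * C) i s; rewrite expr0 mulr1.
    have -> : 2 * C / (2 * L) = C / L by field; rewrite gt_eqF.
    apply => //; first by rewrite mulr_ge0// (C0 i).
    move=> j r /andP[r0 _]; apply: (@le_trans _ _ (2 * C)).
      by apply: (le_trans (ler_normB _ _)); rewrite mulr2n mulrDl mul1r lerD.
    have e1 : 1 <= expR (2 * L * r) by rewrite -[leLHS]expR0 ler_expR mulr_ge0// ltW.
    by rewrite ler_peMr // mulr_ge0// (C0 i).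
  have := step (C * 2^-1 ^+ n) i s.
  have -> : C * 2^-1 ^+ n / (2 * L) = C / L * 2^-1 ^+ n.+1.
    by rewrite exprS; field; rewrite gt_eqF.
  apply => //; first by rewrite mulr_ge0 ?exprn_ge0// (C0 i).
  move=> j r /andP[r0 rs].
  have -> : C * 2^-1 ^+ n * expR (2 * L * r) =
    L * (C / L * 2^-1 ^+ n * expR (2 * L * r)) by field; rewrite gt_eqF.
  apply: lF => k; apply: IH; rewrite r0 (le_trans rs)//.
  by case/andP: sT.
move=> i; apply/eqP; rewrite -subr_eq0 -normr_le0.
apply: (@le_half_pow _ _ (C / L * expR (2 * L * T))) => n.
by rewrite add0r mulrAC; apply: main; rewrite T0 lexx.
Qed.

(** Two successive iterates differ by at most a multiple of 2^-n e^(2 L |s|): they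
    converge at every s, and the solution is global without any continuation
    argument. *)
Lemma picard (y0 : J -> R) : exists y : J -> R -> R,
  forall i, y i 0 = y0 i /\ forall s : R, is_derive s 1 (y i) (F i (y^~ s)).
Proof.
have L2 : 0 < 2 * L by rewrite mulr_gt0.
have /choice[prim Hp] : forall f : R -> R, exists g : R -> R, continuous f ->
    g 0 = 0 /\ forall s : R, is_derive s 1 g (f s).
  move=> f; have [/primitive[g g0 Dg]|ncf] := pselect (continuous f).
    by exists g.
  by exists f.
pose N (y : J -> R -> R) i s := y0 i + prim (fun t => F i (y^~ t)) s.
pose Y n := iter n N (fun i _ => y0 i).
pose lipC (y : J -> R -> R) := forall j s t, `|y j s - y j t| <= C * `|s - t|.
have ND y : lipC y -> forall i,
    N y i 0 = y0 i /\ forall s : R, is_derive s 1 (N y i) (F i (y^~ s)).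
  move=> ly i; have [p0 Dp] := Hp _ (lip_continuous (i := i) ly).
  split; first by rewrite /N p0 addr0.
  move=> s; rewrite -[X in is_derive _ _ _ X]add0r.
  by apply: d_add (d_cst _ _) (Dp s).
have Nlip y : lipC y -> lipC (N y).
  move=> ly j s t; have [_ D] := ND y ly j.
  wlog ts : s t / t <= s.
    move=> w; have [/w//|/ltW/w] := leP t s.
    by rewrite distrC [X in _ <= _ * X]distrC.
  rewrite (ger0_norm (_ : 0 <= s - t)) ?subr_ge0//.
  exact: (deriv_bound ts (fun r _ => D r) (fun r _ => bF _ _)).
have Ylip n : lipC (Y n).
  elim: n => [|n IH]; last exact: Nlip.
  by move=> j s t; rewrite /= subrr normr0 mulr_ge0// (C0 j).
have YD n : forall i, Y n.+1 i 0 = y0 i /\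
    forall s : R, is_derive s 1 (Y n.+1 i) (F i ((Y n)^~ s)) := ND _ (Ylip n).
have Yest n : forall i (s : R), `|Y n.+1 i s - Y n i s| <=
    C / (2 * L) * 2^-1 ^+ n * expR (2 * L * `|s|).
  elim: n => [|n IH] i s.
    have [z0 D] := YD 0%N i.
    have := @exp_bound _ (Y 1%N i) (fun r => F i ((Y 0%N)^~ r)) s (2 * L) C L2.
    rewrite z0 expr0 mulr1; apply => //; last exact: C0.
    move=> r _; apply: (le_trans (bF _ _)); rewrite ler_peMr ?(C0 i)//.
    by rewrite -[leLHS]expR0 ler_expR mulr_ge0// ltW.
  have [z0 D] := YD n i; have [z1 D1] := YD n.+1 i.
  have := @exp_bound _ (fun r => Y n.+2 i r - Y n.+1 i r)
    (fun r => F i ((Y n.+1)^~ r) - F i ((Y n)^~ r)) s (2 * L) (C / 2 * 2^-1 ^+ n) L2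
    (fun r _ => d_add (D1 r) (d_opp (D r))).
  rewrite z0 z1 subrr subr0.
  have -> : C / 2 * 2^-1 ^+ n / (2 * L) = C / (2 * L) * 2^-1 ^+ n.+1.
    by rewrite exprS; field; rewrite gt_eqF.
  apply; last by rewrite !mulr_ge0 ?exprn_ge0// (C0 i).
  move=> r _.
  have -> : C / 2 * 2^-1 ^+ n * expR (2 * L * `|r|) =
    L * (C / (2 * L) * 2^-1 ^+ n * expR (2 * L * `|r|)) by field; rewrite gt_eqF.
  by apply: lF => k; exact: IH.
have lim i s : exists l, forall n, `|l - Y n i s| <=
    C / L * expR (2 * L * `|s|) * 2^-1 ^+ n.
  have [|l Hl] := @geometric_limit (fun n => Y n i s) (C / (2 * L) * expR (2 * L * `|s|)).
    by move=> n; rewrite mulrAC; exact: Yest.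
  exists l => n; apply: (le_trans (Hl n)).
  by rewrite le_eqVlt; apply/orP; left; apply/eqP; field; rewrite gt_eqF.
have /choice[y /= Hy] : forall i, exists f : R -> R, forall s n, `|f s - Y n i s| <=
    C / L * expR (2 * L * `|s|) * 2^-1 ^+ n by move=> i; have /choice[f] := lim i; exists f.
have ylip : lipC y.
  move=> j s t.
  apply: (@le_half_pow _ _ (C / L * expR (2 * L * `|s|) + C / L * expR (2 * L * `|t|))) => n.
  have := Hy j s n; have := Hy j t n; have := Ylip n j s t.
  rewrite mulrDl [`|y j t - _|]distrC.
  have := ler_distD (Y n j s) (y j s) (y j t).
  have := ler_distD (Y n j t) (Y n j s) (y j t).
  by lra.
exists y => i; have [z0 D] := ND _ ylip i.
suff E s : y i s = N y i s by have -> : y i = N y i by apply/funext.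
apply/eqP; rewrite -subr_eq0 -normr_le0.
apply: (@le_half_pow _ _ (C / L * expR (2 * L * `|s|) + C / L * expR (2 * L * `|s|))) => n.
have h1 : `|y i s - Y n.+1 i s| <= C / L * expR (2 * L * `|s|) * 2^-1 ^+ n.
  apply: (le_trans (Hy _ _ _)); rewrite exprS mulrA ler_wpM2r ?exprn_ge0//.
  have : 0 <= C / L * expR (2 * L * `|s|).
    by rewrite mulr_ge0 ?expR_ge0// divr_ge0 ?(C0 i)// ltW.
  by lra.
have h2 : `|Y n.+1 i s - N y i s| <= C / L * expR (2 * L * `|s|) * 2^-1 ^+ n.
  have [z1 D1] := YD n i.
  have := @exp_bound _ (fun r => Y n.+1 i r - N y i r)
    (fun r => F i ((Y n)^~ r) - F i (y^~ r)) s (2 * L) (C * 2^-1 ^+ n) L2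
    (fun r _ => d_add (D1 r) (d_opp (D r))).
  rewrite z0 z1 subrr subr0 => h.
  apply: (@le_trans _ _ (C * 2^-1 ^+ n / (2 * L) * expR (2 * L * `|s|))).
    apply: h; last by rewrite mulr_ge0 ?exprn_ge0// (C0 i).
    move=> r _.
    have -> : C * 2^-1 ^+ n * expR (2 * L * `|r|) =
      L * (C / L * expR (2 * L * `|r|) * 2^-1 ^+ n) by field; rewrite gt_eqF.
    by apply: lF => k; rewrite distrC; exact: Hy.
  rewrite -subr_ge0.
  have -> : C / L * expR (2 * L * `|s|) * 2^-1 ^+ n -
     C * 2^-1 ^+ n / (2 * L) * expR (2 * L * `|s|) =
     C / (2 * L) * expR (2 * L * `|s|) * 2^-1 ^+ n by field; rewrite gt_eqF.
  by rewrite !mulr_ge0 ?expR_ge0 ?exprn_ge0 ?(C0 i)// invr_ge0 ltW.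
have := ler_distD (Y n.+1 i s) (y i s) (N y i s).
by rewrite add0r mulrDl; lra.
Qed.

End Picard.

(** * Functions of class C^n *)

Section Smoothness.
Variable R : realType.
Implicit Types (f g : R -> R) (I : set R).

(** The recursion carries the continuity of the last derivative, so that products
    and inverses are handled by induction on n. *)
Fixpoint class_C (n : nat) I f : Prop :=
  if n is m.+1 then
    (forall s : R, I s -> derivable f s 1) /\ class_C m I (derive1 f)
  else forall s : R, I s -> {for s, continuous f}.

Lemma open_near I (s : R) : open I -> I s -> \forall t \near s, I t.
Proof. by move=> oI Is; exact: open_nbhs_nbhs. Qed.

Lemma derive1_val f (s d : R) : is_derive s 1 f d -> derive1 f s = d.
Proof. by move=> h; rewrite derive1E; exact: derive_val. Qed.

Lemma derive1_is f (s : R) : derivable f s 1 -> is_derive s 1 f (derive1 f s).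
Proof. by move=> h; rewrite derive1E; exact: derivableP. Qed.

Lemma is_derive_eq_on I f g (s d : R) : open I -> I s ->
  (forall t, I t -> f t = g t) -> is_derive s 1 f d -> is_derive s 1 g d.
Proof.
move=> oI Is fg; apply: near_eq_is_derive.
by apply: filterS (open_near oI Is) => t; exact: fg.
Qed.

Lemma class_C_eq n I f g : open I -> (forall s, I s -> f s = g s) ->
  class_C n I f -> class_C n I g.
Proof.
move=> oI; elim: n f g => [|n IH] f g fg /=.
  move=> cf s Is; have E : \near s, f s = g s.
    by apply: filterS (open_near oI Is) => t; exact: fg.
  rewrite /prop_for /continuous_at -(fg s Is).
  exact: cvg_trans (near_eq_cvg E) (cf s Is).
move=> [df cf']; split=> [s Is|].
  by have [] := is_derive_eq_on oI Is fg (derive1_is (df s Is)).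
apply: IH cf' => s Is; apply/esym/derive1_val.
exact: is_derive_eq_on fg (derive1_is (df s Is)).
Qed.

Lemma class_C_le n I f : class_C n.+1 I f -> class_C n I f.
Proof.
elim: n f => [|n IH] f [df cf'].
  by move=> s /df /derive1_is /is_derive_continuous.
by split => //; exact: IH.
Qed.

Lemma class_CS n I f df : open I -> (forall s : R, I s -> is_derive s 1 f (df s)) ->
  class_C n I df -> class_C n.+1 I f.
Proof.
move=> oI Df cdf; split=> [s /Df[]//|].
by apply: class_C_eq cdf => // s /Df /derive1_val.
Qed.

Lemma class_C0 n I f : class_C n I f -> forall s, I s -> {for s, continuous f}.
Proof. by elim: n => [//|n IH] /class_C_le. Qed.

Lemma class_C_derive n I f : class_C n.+1 I f ->
  forall s : R, I s -> is_derive s 1 f (derive1 f s).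
Proof. by move=> [df _] s /df; exact: derive1_is. Qed.

Lemma smooth_onP I f : smooth_on I f <-> forall n, class_C n I f.
Proof.
split=> [sf n|cf n s Is].
  elim: n f sf => [|n IH] f sf.
    by move=> s /(sf 0%N) /derive1_is /is_derive_continuous.
  split; first exact: (sf 0%N).
  by apply: IH => m s Is; rewrite -derive1Sn; exact: sf.
have {cf} := cf n.+1; elim: n f => [|n IH] f [df cf]; first exact: df.
by rewrite derive1Sn; exact: IH.
Qed.

Lemma class_C_cst n I (c : R) : open I -> class_C n I (fun=> c).
Proof.
move=> oI; elim: n c => [|n IH] c; first by move=> s _; exact: cvg_cst.
by apply: (class_CS oI) (IH 0) => s _; exact: d_cst.
Qed.

Lemma class_C_id n I : open I -> class_C n I (fun t : R => t).
Proof.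
move=> oI; case: n => [|n]; first by move=> s _; exact: cvg_id.
by apply: (class_CS oI) (class_C_cst n 1 oI) => s _; exact: d_id.
Qed.

Lemma class_C_add n I f g : open I -> class_C n I f -> class_C n I g ->
  class_C n I (fun t => f t + g t).
Proof.
move=> oI; elim: n f g => [|n IH] f g cf cg.
  by move=> s Is; apply: cvgD; [exact: cf|exact: cg].
apply: (class_CS oI) (IH _ _ cf.2 cg.2) => s Is.
exact: d_add (class_C_derive cf Is) (class_C_derive cg Is).
Qed.

Lemma class_C_opp n I f : open I -> class_C n I f -> class_C n I (fun t => - f t).
Proof.
move=> oI; elim: n f => [|n IH] f cf.
  by move=> s Is; apply: cvgN; exact: cf.
apply: (class_CS oI) (IH _ cf.2) => s Is.
exact: d_opp (class_C_derive cf Is).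
Qed.

Lemma class_C_mul n I f g : open I -> class_C n I f -> class_C n I g ->
  class_C n I (fun t => f t * g t).
Proof.
move=> oI; elim: n f g => [|n IH] f g cf cg.
  by move=> s Is; apply: cvgM; [exact: cf|exact: cg].
apply: (class_CS oI (fun s Is => d_mul (class_C_derive cf Is) (class_C_derive cg Is))).
apply: class_C_add => //; apply: IH.
- exact: cf.2.
- exact: class_C_le.
- exact: class_C_le.
- exact: cg.2.
Qed.

Lemma class_C_inv n I f : open I -> (forall s, I s -> f s != 0) ->
  class_C n I f -> class_C n I (fun t => (f t)^-1).
Proof.
move=> oI f0; elim: n => [|n IH] cf.
  by move=> s Is; apply: cvgV; [exact: f0|exact: cf].
apply: (class_CS oI (fun s Is => d_inv (f0 s Is) (class_C_derive cf Is))).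
have ci := IH (class_C_le cf).
have := class_C_mul oI (class_C_mul oI (class_C_opp oI cf.2) ci) ci.
by apply: class_C_eq => // s _; rewrite expr2 invfM mulrA.
Qed.

Lemma class_C_affine n I f (k c : R) : open I ->
  open [set s | I (k * s + c)] -> class_C n I f ->
  class_C n [set s | I (k * s + c)] (fun s => f (k * s + c)).
Proof.
move=> oI oJ; elim: n f => [|n IH] f cf.
  move=> s Is; apply: (@continuous_comp _ _ _ (fun t => k * t + c) f).
    by apply: (is_derive_continuous (d := k)); deriv; ring.
  exact: cf.
apply: (class_CS oJ (df := fun s => k * derive1 f (k * s + c))).
  by move=> s /= Is; apply: is_derive_affine; exact: class_C_derive cf _ Is.
by apply: class_C_mul => //; [exact: class_C_cst|exact: IH cf.2].
Qed.

End Smoothness.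

Ltac class_C_step oI :=
  first [ eassumption | apply: (class_C_cst _ _ oI) | apply: (class_C_id _ oI)
        | apply: (class_C_add oI) | apply: (class_C_opp oI)
        | apply: (class_C_mul oI) ].

(** * Mean curvature of rotational surfaces *)

Section Geometry.
Variable R : realType.
Implicit Types (x z : R -> R) (q n : 'rV[R]_3).

Lemma row3P (u v : 'rV[R]_3) :
  u 0 ix = v 0 ix -> u 0 iy = v 0 iy -> u 0 iz = v 0 iz -> u = v.
Proof.
move=> hx hy hz; apply/rowP => k; case: k => -[|[|[|//]]] h.
- by have -> : Ordinal h = ix by exact: val_inj.
- by have -> : Ordinal h = iy by exact: val_inj.
- by have -> : Ordinal h = iz by exact: val_inj.
Qed.

Lemma sum3 (F : 'I_3 -> R) : \sum_k F k = F ix + F iy + F iz.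
Proof.
rewrite !big_ord_recl big_ord0 addr0 addrA.
by do 3?congr (_ + _); congr F; exact: val_inj.
Qed.

Lemma sum2 (F : 'I_2 -> R) : \sum_k F k = F 0 + F 1.
Proof.
rewrite !big_ord_recl big_ord0 addr0.
by do 2?congr (_ + _); congr F; exact: val_inj.
Qed.

Lemma pointE (a b c : R) : (point a b c 0 ix = a) * (point a b c 0 iy = b) *
  (point a b c 0 iz = c).
Proof. by rewrite !mxE. Qed.

Lemma scale_coord (l : R) (v : 'rV[R]_3) k : (l *: v) 0 k = l * v 0 k.
Proof. by rewrite mxE. Qed.

Lemma hdotE q u v :
  hdot q u v = (u 0 ix * v 0 ix + u 0 iy * v 0 iy + u 0 iz * v 0 iz) / height q ^+ 2.
Proof.
rewrite /hdot /metric mxE sum3 !mul_mx_scalar !mxE.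
by ring.
Qed.

Lemma hdotC q u v : hdot q u v = hdot q v u.
Proof. by rewrite !hdotE; congr (_ / _); congr (_ + _ + _); exact: mulrC. Qed.

(** A directional derivative only sees the restriction to a line, which reduces
    the Christoffel symbols to derivatives of functions of one variable. *)
Lemma derive_line (f : 'rV[R]_3 -> R) q v :
  'D_v f q = 'D_1 (fun h : R => f (h *: v + q)) 0.
Proof.
rewrite /derive; set u := (X in lim (X @ _)); set w := (X in _ = lim (X @ _)).
suff -> : u = w by [].
by apply/funext => h; rewrite /u /w /= addr0 scale0r add0r /GRing.scale /= mulr1.
Qed.

Lemma metric_derive q (i j l : 'I_3) : height q != 0 ->
  'D_(basis R i) (fun p => metric p j l) q =
  (j == l)%:R * (i == iz)%:R * (-2 / height q ^+ 3).
Proof.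
move=> q0; rewrite derive_line; apply: derive_val.
have -> : (fun h : R => metric (h *: basis R i + q) j l) =
    (fun h => (j == l)%:R * ((h * (i == iz)%:R + height q) ^+ 2)^-1).
  apply/funext => h; rewrite /metric /height !mxE eqxx /=.
  by rewrite [iz == i]eq_sym; case: (j == l); rewrite ?mulr1n ?mulr0n ?mul1r ?mul0r.
have h0 : (0 * (i == iz)%:R + height q) ^+ 2 != 0.
  by rewrite mul0r add0r expf_neq0.
have d1 := d_add (d_mul (d_id 0) (d_cst ((i == iz)%:R) (0 : R))) (d_cst (height q) (0 : R)).
have d2 := @d_inv _ (fun t => (t * (i == iz)%:R + height q) ^+ 2) 0 _ h0 (d_exp 2 d1).
apply: d_eq (d_mul (d_cst ((j == l)%:R) (0 : R)) d2) _; rewrite /= mul0r !add0r; field; exact: q0.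
Qed.

Lemma inv_metric q : height q != 0 -> invmx (metric q) = (height q ^+ 2)%:M.
Proof.
move=> q0; have q2 : height q ^+ 2 != 0 by rewrite expf_neq0.
have E : metric q *m (height q ^+ 2)%:M = 1%:M.
  by rewrite /metric -scalar_mxM mulVf.
have U : metric q \in unitmx by have /mulmx1_unit[] := E.
by rewrite -[RHS](mulKmx U) E mulmx1.
Qed.

Lemma christoffelE q (k i j : 'I_3) : height q != 0 ->
  christoffel k i j q = - ((j == k)%:R * (i == iz)%:R
    + (i == k)%:R * (j == iz)%:R - (i == j)%:R * (k == iz)%:R) / height q.
Proof.
move=> q0; rewrite /christoffel (bigD1 k) //= big1 => [|l lk].
  by rewrite addr0 inv_metric // !metric_derive // mxE eqxx mulr1n; field.
by rewrite inv_metric // mxE eq_sym (negbTE lk) mulr0n mul0r.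
Qed.

(** Against a normal vector, the terms of the Christoffel correction that are
    tangent to the surface vanish; what is left is a multiple of the first form,
    as for any conformal change of metric. *)
Lemma second_formE X (s t : R) n (i j : 'I_2) : height (X s t) != 0 ->
  (forall k, hdot (X s t) n (tangent k X s t) = 0) ->
  second_form X s t n i j =
    hdot (X s t) (tangent i (tangent j X) s t) n
    + hdot (X s t) (tangent i X s t) (tangent j X s t) * n 0 iz / height (X s t).
Proof.
move=> q0 nT; have ixE : ((ix == iy) = false) * ((ix == iz) = false) * ((iy == ix) = false) *
  ((iy == iz) = false) * ((iz == ix) = false) * ((iz == iy) = false) by [].
have Ni := nT i; have Nj := nT j; rewrite !hdotE in Ni Nj.
rewrite mxE !hdotE.
have covE k : covder i j X s t 0 k = tangent i (tangent j X) s t 0 k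
    - (tangent i X s t 0 iz * tangent j X s t 0 k
       + tangent i X s t 0 k * tangent j X s t 0 iz
       - (k == iz)%:R * (tangent i X s t 0 ix * tangent j X s t 0 ix
         + tangent i X s t 0 iy * tangent j X s t 0 iy
         + tangent i X s t 0 iz * tangent j X s t 0 iz)) / height (X s t).
  rewrite [LHS]mxE !sum3 !christoffelE //.
  set a := tangent i X s t; set b := tangent j X s t.
  have [->|->|->] : [\/ k = ix, k = iy | k = iz].
    by case: k => -[|[|[|//]]] h; [apply: Or31|apply: Or32|apply: Or33]; exact: val_inj.
  - rewrite ?(eqxx, ixE) /= ?mulr0n ?mulr1n.
    move: (a 0 ix) (a 0 iy) (a 0 iz) (b 0 ix) (b 0 iy) (b 0 iz) (height (X s t)) q0.
    by move=> a1 a2 a3 b1 b2 b3 h h0; field.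
  - rewrite ?(eqxx, ixE) /= ?mulr0n ?mulr1n.
    move: (a 0 ix) (a 0 iy) (a 0 iz) (b 0 ix) (b 0 iy) (b 0 iz) (height (X s t)) q0.
    by move=> a1 a2 a3 b1 b2 b3 h h0; field.
  - rewrite ?(eqxx, ixE) /= ?mulr0n ?mulr1n.
    move: (a 0 ix) (a 0 iy) (a 0 iz) (b 0 ix) (b 0 iy) (b 0 iz) (height (X s t)) q0.
    by move=> a1 a2 a3 b1 b2 b3 h h0; field.
rewrite !covE ?(eqxx, ixE) /= ?mulr0n ?mulr1n.
set a := tangent i X s t in Ni *; set b := tangent j X s t in Nj *.
have {}Ni : n 0 ix * a 0 ix + n 0 iy * a 0 iy = - (n 0 iz * a 0 iz).
  have q2 : height (X s t) ^+ 2 != 0 by rewrite expf_neq0.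
  by move/eqP: Ni; rewrite mulf_eq0 invr_eq0 (negbTE q2) orbF addr_eq0 => /eqP.
have {}Nj : n 0 ix * b 0 ix + n 0 iy * b 0 iy = - (n 0 iz * b 0 iz).
  have q2 : height (X s t) ^+ 2 != 0 by rewrite expf_neq0.
  by move/eqP: Nj; rewrite mulf_eq0 invr_eq0 (negbTE q2) orbF addr_eq0 => /eqP.
set d := tangent i (tangent j X) s t.
set h := height (X s t) in q0 *.
transitivity ((d 0 ix * n 0 ix + d 0 iy * n 0 iy + d 0 iz * n 0 iz) / h ^+ 2
 - (a 0 iz * (n 0 ix * b 0 ix + n 0 iy * b 0 iy + n 0 iz * b 0 iz)
   + b 0 iz * (n 0 ix * a 0 ix + n 0 iy * a 0 iy + n 0 iz * a 0 iz)
   - n 0 iz * (a 0 ix * b 0 ix + a 0 iy * b 0 iy + a 0 iz * b 0 iz)) / h ^+ 3).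
  move: (d 0 ix) (d 0 iy) (d 0 iz) (n 0 ix) (n 0 iy) (n 0 iz) (a 0 ix) (a 0 iy) (a 0 iz).
  by move: (b 0 ix) (b 0 iy) (b 0 iz) h q0 => *; field.
rewrite Ni Nj.
move: (d 0 ix) (d 0 iy) (d 0 iz) (n 0 ix) (n 0 iy) (n 0 iz) (a 0 ix) (a 0 iy) (a 0 iz).
by move: (b 0 ix) (b 0 iy) (b 0 iz) h q0 => *; field.
Qed.

Lemma average_curvature (E G h a b c : R) : E != 0 -> G != 0 -> h != 0 ->
  (E^-1 * (b + E * c / h) + G^-1 * (a + G * c / h)) / 2 = (b / E + a / G) / 2 + c / h.
Proof. by move=> E0 G0 h0; field; rewrite h0 E0 G0. Qed.

Lemma mean_curvature_orthogonal X (s t : R) n (E G : R) :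
  height (X s t) != 0 -> E != 0 -> G != 0 ->
  (forall k, hdot (X s t) n (tangent k X s t) = 0) ->
  hdot (X s t) (tangent 0 X s t) (tangent 0 X s t) = E ->
  hdot (X s t) (tangent 1 X s t) (tangent 1 X s t) = G ->
  hdot (X s t) (tangent 0 X s t) (tangent 1 X s t) = 0 ->
  mean_curvature X s t n =
    (hdot (X s t) (tangent 0 (tangent 0 X) s t) n / E
     + hdot (X s t) (tangent 1 (tangent 1 X) s t) n / G) / 2
    + n 0 iz / height (X s t).
Proof.
move=> q0 E0 G0 nT hE hG hF; rewrite /mean_curvature.
have hF' : hdot (X s t) (tangent 1 X s t) (tangent 0 X s t) = 0.
  by rewrite hdotC.
pose D : 'M[R]_2 := diag_mx (\row_k [:: E^-1; G^-1]`_k).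
have eD : D *m first_form X s t = 1%:M.
  apply/matrixP => i j; rewrite mul_diag_mx !mxE.
  case: i => -[|[|//]] hi; case: j => -[|[|//]] hj /=.
  - have -> : Ordinal hi = 0 by exact: val_inj.
    have -> : Ordinal hj = 0 by exact: val_inj.
    by rewrite hE mulVf.
  - have -> : Ordinal hi = 0 by exact: val_inj.
    have -> : Ordinal hj = 1 by exact: val_inj.
    by rewrite hF mulr0.
  - have -> : Ordinal hi = 1 by exact: val_inj.
    have -> : Ordinal hj = 0 by exact: val_inj.
    by rewrite hF' mulr0.
  - have -> : Ordinal hi = 1 by exact: val_inj.
    have -> : Ordinal hj = 1 by exact: val_inj.
    by rewrite hG mulVf.
have U : first_form X s t \in unitmx by have /mulmx1_unit[] := eD.
have -> : invmx (first_form X s t) = D.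
  by rewrite -[RHS](mulmxK U) eD mul1mx.
have trE k : (D *m second_form X s t n) k k = [:: E^-1; G^-1]`_k * second_form X s t n k k.
  by rewrite mul_diag_mx mxE [X in X * _]mxE.
rewrite /mxtrace sum2 !trE !second_formE // hE hG /=.
exact: average_curvature.
Qed.

Lemma derive1_mulr (f : R -> R) (k s : R) : derivable f s 1 ->
  derive1 (fun a => f a * k) s = derive1 f s * k.
Proof.
move=> df; apply: derive1_val; apply: d_eq (d_mul (derive1_is df) (d_cst _ _)) _.
by rewrite mulr0 addr0.
Qed.

Lemma pder0 (f : R -> R -> R) s t : pder 0 f s t = derive1 (f^~ t) s.
Proof. by []. Qed.

Lemma pder1 (f : R -> R -> R) s t : pder 1 f s t = derive1 (f s) t.
Proof. by []. Qed.

Section Rot.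
Variables (I : set R) (x z : R -> R) (s : R).
Hypothesis (oI : open I) (Is : I s) (sx : smooth_on I x) (sz : smooth_on I z).

Let xd a : I a -> derivable x a 1. Proof. exact: (sx (n := 0%N)). Qed.
Let xdd : derivable (derive1 x) s 1. Proof. exact: (sx (n := 1%N)). Qed.
Let zdd : derivable (derive1 z) s 1. Proof. exact: (sz (n := 1%N)). Qed.

Lemma rot_tangent0 a t : I a ->
  tangent 0 (rot x z) a t = point (derive1 x a * cos t) (derive1 x a * sin t) (derive1 z a).
Proof.
move=> Ia; apply: row3P; rewrite !pointE !mxE pder0.
- have -> : (fun r => rot x z r t 0 ix) = (fun r => x r * cos t).
    by apply/funext => r; rewrite pointE.
  exact: derive1_mulr (xd Ia).
- have -> : (fun r => rot x z r t 0 iy) = (fun r => x r * sin t).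
    by apply/funext => r; rewrite pointE.
  exact: derive1_mulr (xd Ia).
- by have -> : (fun r => rot x z r t 0 iz) = z by apply/funext => r; rewrite pointE.
Qed.

Lemma rot_tangent1 a t :
  tangent 1 (rot x z) a t = point (- (x a * sin t)) (x a * cos t) 0.
Proof.
apply: row3P; rewrite !pointE !mxE pder1; apply: derive1_val.
- have -> : (fun r => rot x z a r 0 ix) = (fun r => x a * cos r).
    by apply/funext => r; rewrite pointE.
  by apply: d_eq (d_mul (d_cst _ _) (is_derive_cos t)) _; ring.
- have -> : (fun r => rot x z a r 0 iy) = (fun r => x a * sin r).
    by apply/funext => r; rewrite pointE.
  by apply: d_eq (d_mul (d_cst _ _) (is_derive_sin t)) _; ring.
- have -> : (fun r => rot x z a r 0 iz) = (fun=> z a).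
    by apply/funext => r; rewrite pointE.
  exact: d_cst.
Qed.

Lemma rot_tangent00 t : tangent 0 (tangent 0 (rot x z)) s t =
  point (derive1 (derive1 x) s * cos t) (derive1 (derive1 x) s * sin t)
    (derive1 (derive1 z) s).
Proof.
have h k (f : R -> R) d : (forall a, I a -> f a = tangent 0 (rot x z) a t 0 k) ->
    is_derive s 1 f d -> tangent 0 (tangent 0 (rot x z)) s t 0 k = d.
  move=> E D; rewrite mxE pder0; apply: derive1_val.
  exact: (is_derive_eq_on oI Is E D).
apply: row3P; rewrite !pointE.
- apply: h (d_eq (d_mul (derive1_is xdd) (d_cst (cos t) s)) _).
    by move=> a Ia; rewrite rot_tangent0 // pointE.
  by rewrite mulr0 addr0.
- apply: h (d_eq (d_mul (derive1_is xdd) (d_cst (sin t) s)) _).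
    by move=> a Ia; rewrite rot_tangent0 // pointE.
  by rewrite mulr0 addr0.
- apply: h (derive1_is zdd) => a Ia.
  by rewrite rot_tangent0 // pointE.
Qed.

Lemma rot_tangent11 t : tangent 1 (tangent 1 (rot x z)) s t =
  point (- (x s * cos t)) (- (x s * sin t)) 0.
Proof.
apply: row3P; rewrite !pointE mxE pder1; apply: derive1_val.
- have -> : (fun r => tangent 1 (rot x z) s r 0 ix) = (fun r => - (x s * sin r)).
    by apply/funext => r; rewrite rot_tangent1 pointE.
  by apply: d_eq (d_opp (d_mul (d_cst _ _) (is_derive_sin t))) _; ring.
- have -> : (fun r => tangent 1 (rot x z) s r 0 iy) = (fun r => x s * cos r).
    by apply/funext => r; rewrite rot_tangent1 pointE.
  by apply: d_eq (d_mul (d_cst _ _) (is_derive_cos t)) _; ring.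
- have -> : (fun r => tangent 1 (rot x z) s r 0 iz) = (fun=> 0).
    by apply/funext => r; rewrite rot_tangent1 pointE.
  exact: d_cst.
Qed.

Hypothesis unit_speed : derive1 x s ^+ 2 + derive1 z s ^+ 2 = 1.
Hypotheses (zs : 0 < z s) (xs : x s != 0).

Let u := derive1 x s.
Let v := derive1 z s.

Definition rot_normal t : 'rV[R]_3 :=
  point (- (z s * v * cos t)) (- (z s * v * sin t)) (z s * u).

Let hz t : height (rot x z s t) = z s. Proof. by rewrite /height pointE. Qed.
Let z0 : z s != 0. Proof. by rewrite gt_eqF. Qed.

Lemma rot_normal_unit t : unit_normal (rot x z) s t (rot_normal t).
Proof.
have ct := cos2Dsin2 t.
split=> [|k].
  rewrite hdotE hz /rot_normal !pointE.
  have -> : - (z s * v * cos t) * - (z s * v * cos t) +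
     - (z s * v * sin t) * - (z s * v * sin t) + z s * u * (z s * u) =
     z s ^+ 2 * (v ^+ 2 * (cos t ^+ 2 + sin t ^+ 2) + u ^+ 2) by ring.
  by rewrite ct mulr1 addrC unit_speed mulr1 divff// expf_neq0.
have [->|->] : k = 0 \/ k = 1.
  by case: k => -[|[|//]] h; [left|right]; exact: val_inj.
  rewrite rot_tangent0 // hdotE !pointE -/u -/v.
  have -> : - (z s * v * cos t) * (u * cos t) + - (z s * v * sin t) * (u * sin t)
    + z s * u * v = z s * u * v * (1 - (cos t ^+ 2 + sin t ^+ 2)) by ring.
  by rewrite ct subrr mulr0 mul0r.
by rewrite rot_tangent1 hdotE !pointE; apply/eqP; rewrite mulf_eq0; apply/orP; left; apply/eqP; ring.
Qed.

(** Both sides of the horo-shrinker equation are linear in the normal, so it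
    matters only up to a factor. *)
Lemma rot_normal_line t n : unit_normal (rot x z) s t n ->
  exists2 l, l != 0 & n = l *: rot_normal t.
Proof.
have ct := cos2Dsin2 t.
move=> [n1 nT]; have z2 : z s ^+ 2 != 0 by rewrite expf_neq0.
have := nT 1; have := nT 0; rewrite rot_tangent0 // rot_tangent1 !hdotE !pointE hz.
move=> /eqP; rewrite mulf_eq0 invr_eq0 (negbTE z2) orbF -/u -/v => /eqP E0.
move=> /eqP; rewrite mulf_eq0 invr_eq0 (negbTE z2) orbF => /eqP E1.
have {}E1 : n 0 iy * cos t = n 0 ix * sin t.
  apply: (mulfI xs); move/eqP: E1; rewrite mulr0 addr0 mulrN addrC subr_eq0 => /eqP.
  by rewrite ![n 0 _ * (x s * _)]mulrCA.
pose m := n 0 ix * cos t + n 0 iy * sin t.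
have nx : n 0 ix = m * cos t.
  rewrite /m; transitivity (n 0 ix * (cos t ^+ 2 + sin t ^+ 2)); first by rewrite ct mulr1.
  by rewrite mulrDl mulrDr !expr2 !mulrA -E1; ring.
have ny : n 0 iy = m * sin t.
  rewrite /m; transitivity (n 0 iy * (cos t ^+ 2 + sin t ^+ 2)); first by rewrite ct mulr1.
  by rewrite mulrDl mulrDr !expr2 !mulrA E1; ring.
have E : m * u + n 0 iz * v = 0 by rewrite -[RHS]E0 /m; ring.
pose l := (n 0 iz * u - m * v) / z s.
have nE : n = l *: rot_normal t.
  apply: row3P; rewrite mxE !pointE /l.
  - rewrite nx; transitivity (- (n 0 iz * u - m * v) * v * cos t); last by field.
    transitivity (cos t * (m * (u ^+ 2 + v ^+ 2) - u * (m * u + n 0 iz * v))); last by ring.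
    by rewrite E unit_speed; ring.
  - rewrite ny; transitivity (- (n 0 iz * u - m * v) * v * sin t); last by field.
    transitivity (sin t * (m * (u ^+ 2 + v ^+ 2) - u * (m * u + n 0 iz * v))); last by ring.
    by rewrite E unit_speed; ring.
  - transitivity ((n 0 iz * u - m * v) * u); last by field.
    transitivity (n 0 iz * (u ^+ 2 + v ^+ 2) - v * (m * u + n 0 iz * v)); last by ring.
    by rewrite E unit_speed; ring.
exists l => //; apply/eqP => l0; move: n1; rewrite nE l0 scale0r hdotE !mxE.
by rewrite !mul0r !addr0 mul0r => /eqP; rewrite eq_sym oner_eq0.
Qed.

Lemma rot_mean_curvature t (l : R) n : unit_normal (rot x z) s t n ->
  n = l *: rot_normal t ->
  mean_curvature (rot x z) s t n =
    l * z s * ((u * derive1 (derive1 z) s - v * derive1 (derive1 x) s + v / x s) / 2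
      + u / z s).
Proof.
have ct := cos2Dsin2 t.
move=> [_ nT] nE.
have E1 : hdot (rot x z s t) (tangent 0 (rot x z) s t) (tangent 0 (rot x z) s t) = (z s) ^- 2.
  rewrite rot_tangent0 // hdotE !pointE hz -/u -/v.
  have -> : u * cos t * (u * cos t) + u * sin t * (u * sin t) + v * v =
     u ^+ 2 * (cos t ^+ 2 + sin t ^+ 2) + v ^+ 2 by ring.
  by rewrite ct mulr1 unit_speed div1r.
have G1 : hdot (rot x z s t) (tangent 1 (rot x z) s t) (tangent 1 (rot x z) s t)
    = x s ^+ 2 / z s ^+ 2.
  rewrite rot_tangent1 hdotE !pointE hz; congr (_ / _).
  transitivity (x s ^+ 2 * (cos t ^+ 2 + sin t ^+ 2)); first by ring.
  by rewrite ct mulr1.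
have F1 : hdot (rot x z s t) (tangent 0 (rot x z) s t) (tangent 1 (rot x z) s t) = 0.
  rewrite rot_tangent0 // rot_tangent1 hdotE !pointE; apply/eqP.
  by rewrite mulf_eq0; apply/orP; left; apply/eqP; ring.
rewrite (mean_curvature_orthogonal _ _ _ nT E1 G1 F1); first last.
- by rewrite mulf_neq0 ?invr_neq0 ?expf_neq0.
- by rewrite ?invr_neq0 ?expf_neq0.
- by rewrite hz.
rewrite rot_tangent00 rot_tangent11 !hdotE hz nE !scale_coord !pointE.
set x2 := derive1 (derive1 x) s; set z2 := derive1 (derive1 z) s.
transitivity (l * z s * ((u * z2 - v * x2 * (cos t ^+ 2 + sin t ^+ 2)
   + v / x s * (cos t ^+ 2 + sin t ^+ 2)) / 2 + u / z s)); first by field; rewrite z0 xs.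
by rewrite ct !mulr1.
Qed.

(** The left-hand side is the Euclidean curvature of the generating curve. For
    the normal rot_normal, the conformal factor adds u to the mean curvature and
    the inner product with the vertical field is u / z: the difference of the two
    gives the last term on the right. *)
Lemma horo_shrinker_rotP t n : unit_normal (rot x z) s t n ->
  horo_shrinker_at (rot x z) s t n <->
  u * derive1 (derive1 z) s - v * derive1 (derive1 x) s =
    - v / x s + 2 * u * (1 - z s) / z s ^+ 2.
Proof.
move=> nN; have [l l0 nE] := rot_normal_line nN.
rewrite /horo_shrinker_at (rot_mean_curvature nN nE).
rewrite hdotE hz nE !scale_coord !pointE.
have -> : basis R iz 0 ix = 0 by rewrite mxE.
have -> : basis R iz 0 iy = 0 by rewrite mxE.
have -> : basis R iz 0 iz = 1 by rewrite mxE.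
set k := u * _ - _.
split=> [E|->]; last by field; rewrite z0 xs.
have lz : l * z s != 0 by rewrite mulf_neq0.
apply/eqP; rewrite -subr_eq0; apply/eqP.
transitivity (2 / (l * z s) * (l * z s * ((k + v / x s) / 2 + u / z s) -
  (l * - (z s * v * cos t) * 0 + l * - (z s * v * sin t) * 0 + l * (z s * u) * 1) / z s ^+ 2)).
  by field; rewrite l0 z0 xs.
by rewrite E subrr mulr0.
Qed.

End Rot.

End Geometry.

(** * The system of the generating curve *)

Section System.
Variable R : realType.
Implicit Types (x z u v : R -> R) (I : set R).

(** The Euclidean curvature of the generating curve prescribed by the
    horo-shrinker equation. *)
Definition curvature (x z u v : R) : R := - v / x + 2 * u * (1 - z) / z ^+ 2.

(** The unit tangent (u, v) stands for the angle theta of (cos theta, sin theta):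
    this makes the system rational. *)
Definition ode x z u v (s : R) : Prop :=
  [/\ is_derive s 1 x (u s), is_derive s 1 z (v s),
      is_derive s 1 u (- (v s * curvature (x s) (z s) (u s) (v s))) &
      is_derive s 1 v (u s * curvature (x s) (z s) (u s) (v s))].

Definition profile I x z u v : Prop := forall s, I s ->
  [/\ 0 < x s, 0 < z s, u s ^+ 2 + v s ^+ 2 = 1 & ode x z u v s].

Lemma profile_subset I I' x z u v :
  I' `<=` I -> profile I x z u v -> profile I' x z u v.
Proof. by move=> sub H s /sub; exact: H. Qed.

Lemma curvature_reverse (k x z u v : R) : curvature x z (k * u) (k * v) = k * curvature x z u v.
Proof. by rewrite /curvature; ring. Qed.

(** The equation is invariant under translations and under reversal of the
    arc-length parameter. *)
Lemma ode_affine (k c : R) x z u v s : k ^+ 2 = 1 -> ode x z u v (k * s + c) ->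
  ode (fun r => x (k * r + c)) (fun r => z (k * r + c))
      (fun r => k * u (k * r + c)) (fun r => k * v (k * r + c)) s.
Proof.
move=> k1 [Dx Dz Du Dv]; have [k0|/eqP kn] := eqVneq k 0.
  by move: k1; rewrite k0 expr0n /= => /eqP; rewrite eq_sym oner_eq0.
split.
- exact: is_derive_affine.
- exact: is_derive_affine.
- have := d_mul (d_cst k s) (is_derive_affine Du).
  move/d_eq; apply; rewrite curvature_reverse mul0r add0r.
  by set w := curvature _ _ _ _; ring.
- have := d_mul (d_cst k s) (is_derive_affine Dv).
  move/d_eq; apply; rewrite curvature_reverse mul0r add0r.
  by set w := curvature _ _ _ _; ring.
Qed.

Lemma profile_affine (k c : R) I x z u v : k ^+ 2 = 1 -> profile I x z u v ->
  profile [set s | I (k * s + c)] (fun r => x (k * r + c)) (fun r => z (k * r + c))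
      (fun r => k * u (k * r + c)) (fun r => k * v (k * r + c)).
Proof.
move=> k1 H s /= Is; have [x0 z0 uv D] := H _ Is; split => //.
  by rewrite !exprMn k1 !mul1r.
exact: ode_affine.
Qed.

(** The derivative (p, q) of a unit vector (u, v) is a multiple of the normal
    (- v, u), and the factor is the curvature. *)
Lemma unit_frame (u v p q : R) : u ^+ 2 + v ^+ 2 = 1 -> u * p + v * q = 0 ->
  p = - (v * (u * q - v * p)) /\ q = u * (u * q - v * p).
Proof.
move=> uv pq; split.
  transitivity (p * (u ^+ 2 + v ^+ 2) - u * (u * p + v * q)); last by ring.
  by rewrite uv pq mulr0 subr0 mulr1.
transitivity (q * (u ^+ 2 + v ^+ 2) - v * (u * p + v * q)); last by ring.
by rewrite uv pq mulr0 subr0 mulr1.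
Qed.

Lemma horo_curve_ode I x z s : horo_shrinker_curve I x z -> I s -> x s != 0 ->
  ode x z (derive1 x) (derive1 z) s.
Proof.
move=> [[oI _ _] [sx sz] us zs hs] Is xs.
have [n nN] : exists n, unit_normal (rot x z) s 0 n.
  by exists (rot_normal x z s 0); apply: (rot_normal_unit Is) => //; [exact: us|exact: zs].
have E := (horo_shrinker_rotP oI Is sx sz (us s Is) (zs s Is) xs nN).1 (hs s 0 n Is xs nN).
have D1 := derive1_is (sx 0%N s Is); have D2 := derive1_is (sz 0%N s Is).
have D3 := derive1_is (sx 1%N s Is); have D4 := derive1_is (sz 1%N s Is).
rewrite !derive1n1 in D3 D4.
set u := derive1 x in E D3 *; set v := derive1 z in E D4 *.
have E2 : u s * derive1 u s + v s * derive1 v s = 0.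
  have h1 := d_add (d_exp 2 D3) (d_exp 2 D4).
  have h2 : is_derive s 1 (fun t => u t ^+ 2 + v t ^+ 2) 0.
    apply: (is_derive_eq_on oI Is _ (d_cst 1 s)) => t It.
    by rewrite /u /v us.
  have := derive1_val h1; rewrite (derive1_val h2) /= => /eqP.
  rewrite eq_sym !expr1 -!mulrA -mulrDr mulf_eq0 pnatr_eq0 /=.
  by move=> /eqP.
have E1 : u s ^+ 2 + v s ^+ 2 = 1 by exact: us.
have E' : u s * derive1 v s - v s * derive1 u s = curvature (x s) (z s) (u s) (v s) by [].
have [F1 F2] := unit_frame E1 E2.
by split; [exact: D1|exact: D2|apply: (d_eq D3)|apply: (d_eq D4)]; rewrite -E'.
Qed.

Lemma profile_of_curve I x z : horo_shrinker_curve I x z ->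
  (forall s, I s -> 0 < x s) -> profile I x z (derive1 x) (derive1 z).
Proof.
move=> H xp s Is; have [_ _ us zs _] := H.
split; [exact: xp|exact: zs|exact: us|].
exact: (horo_curve_ode H Is (lt0r_neq0 (xp s Is))).
Qed.

(** The equation is required off the axis only, but smoothness of x and z
    everywhere: curves crossing the axis are built with this lemma. *)
Lemma curve_of_ode I x z u v : open I -> is_interval I -> I !=set0 ->
  (forall n, class_C n I x) -> (forall n, class_C n I z) ->
  (forall s, I s -> is_derive s 1 x (u s)) -> (forall s, I s -> is_derive s 1 z (v s)) ->
  (forall s, I s -> u s ^+ 2 + v s ^+ 2 = 1) -> (forall s, I s -> 0 < z s) ->
  (forall s, I s -> x s != 0 -> ode x z u v s) ->
  horo_shrinker_curve I x z.
Proof.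
move=> oI iI I0 cx cz Dx Dz uv zp D.
have sx : smooth_on I x by apply/smooth_onP.
have sz : smooth_on I z by apply/smooth_onP.
have us s : I s -> derive1 x s ^+ 2 + derive1 z s ^+ 2 = 1.
  by move=> Is; rewrite (derive1_val (Dx s Is)) (derive1_val (Dz s Is)); exact: uv.
split => // s t n Is xs nN.
apply/(horo_shrinker_rotP oI Is sx sz (us s Is) (zp s Is) xs nN).
have [_ _ Du Dv] := D s Is xs.
rewrite (derive1_val (Dx s Is)) (derive1_val (Dz s Is)).
have -> : derive1 (derive1 x) s = - (v s * curvature (x s) (z s) (u s) (v s)).
  apply: derive1_val; apply: is_derive_eq_on oI Is _ Du => r Ir.
  by rewrite (derive1_val (Dx r Ir)).
have -> : derive1 (derive1 z) s = u s * curvature (x s) (z s) (u s) (v s).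
  apply: derive1_val; apply: is_derive_eq_on oI Is _ Dv => r Ir.
  by rewrite (derive1_val (Dz r Ir)).
rewrite -/(curvature (x s) (z s) (u s) (v s)); set k := curvature _ _ _ _.
transitivity (k * (u s ^+ 2 + v s ^+ 2)); first by ring.
by rewrite uv // mulr1.
Qed.

Lemma class_C_curvature n I x z u v : open I ->
  (forall s, I s -> x s != 0) -> (forall s, I s -> z s != 0) ->
  class_C n I x -> class_C n I z -> class_C n I u -> class_C n I v ->
  class_C n I (fun s => curvature (x s) (z s) (u s) (v s)).
Proof.
move=> oI x0 z0 cx cz cu cv.
have cix := class_C_inv oI x0 cx; have ciz := class_C_inv oI z0 cz.
apply: (@class_C_eq _ _ _ (fun s => - v s * (x s)^-1 +
   2 * u s * (1 + - z s) * ((z s)^-1 * (z s)^-1))) => //.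
  by move=> s _; rewrite /curvature expr2 invfM.
by repeat class_C_step oI.
Qed.

Lemma profile_smooth I x z u v : open I -> profile I x z u v ->
  forall n, [/\ class_C n I x, class_C n I z, class_C n I u & class_C n I v].
Proof.
move=> oI H; elim=> [|n [cx cz cu cv]].
  by split=> s Is; have [_ _ _ [? ? ? ?]] := H s Is; apply: is_derive_continuous; eassumption.
have x0 s : I s -> x s != 0 by case/H => ? _ _ _; rewrite gt_eqF.
have z0 s : I s -> z s != 0 by case/H => _ ? _ _; rewrite gt_eqF.
have ck := class_C_curvature oI x0 z0 cx cz cu cv.
split.
- by apply: class_CS cu => // s /H[_ _ _ []].
- by apply: class_CS cv => // s /H[_ _ _ []].
- apply: (class_CS oI (df := fun s => - (v s * curvature (x s) (z s) (u s) (v s)))).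
    by move=> s /H[_ _ _ []].
  by repeat class_C_step oI.
- apply: (class_CS oI (df := fun s => u s * curvature (x s) (z s) (u s) (v s))).
    by move=> s /H[_ _ _ []].
  by repeat class_C_step oI.
Qed.

Lemma curve_of_profile I x z u v : open I -> is_interval I -> I !=set0 ->
  profile I x z u v -> horo_shrinker_curve I x z.
Proof.
move=> oI iI I0 H; have sm := profile_smooth oI H.
apply: (@curve_of_ode I x z u v) => //.
- by move=> n; case: (sm n).
- by move=> n; case: (sm n).
- by move=> s /H[_ _ _ []].
- by move=> s /H[_ _ _ []].
- by move=> s /H[].
- by move=> s /H[].
- by move=> s /H[].
Qed.

(** * Truncated systems and uniqueness *)

Definition clamp (t : R) : R := Num.max (-2) (Num.min 2 t).
Definition inv_above (a t : R) : R := (Num.max t a)^-1.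

Definition bounded_lipschitz (f : (nat -> R) -> R) : Prop :=
  exists C L : R, [/\ 0 <= C, 0 <= L, forall y, `|f y| <= C &
    forall y y' d, (forall j, `|y j - y' j| <= d) -> `|f y - f y'| <= L * d].

Lemma bl_cst (c : R) : bounded_lipschitz (fun=> c).
Proof.
exists `|c|, 0; split=> // y y' d _.
by rewrite subrr normr0 mul0r.
Qed.

Lemma bl_opp f : bounded_lipschitz f -> bounded_lipschitz (fun y => - f y).
Proof.
move=> [C [L [C0 L0 bf lf]]]; exists C, L; split=> // [y|y y' d h]; first by rewrite normrN.
by rewrite -opprD normrN; exact: lf.
Qed.

Lemma bl_add f g : bounded_lipschitz f -> bounded_lipschitz g ->
  bounded_lipschitz (fun y => f y + g y).
Proof.
move=> [C [L [C0 L0 bf lf]]] [C' [L' [C0' L0' bg lg]]].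
exists (C + C'), (L + L'); split=> [||y|y y' d h]; try exact: addr_ge0.
  by apply: (le_trans (ler_normD _ _)); exact: lerD.
rewrite opprD addrACA [leRHS]mulrDl; apply: (le_trans (ler_normD _ _)).
by apply: lerD; [exact: lf|exact: lg].
Qed.

Lemma bl_mul f g : bounded_lipschitz f -> bounded_lipschitz g ->
  bounded_lipschitz (fun y => f y * g y).
Proof.
move=> [C [L [C0 L0 bf lf]]] [C' [L' [C0' L0' bg lg]]].
exists (C * C'), (L * C' + C * L'); split=> [||y|y y' d h].
- exact: mulr_ge0.
- by rewrite addr_ge0// mulr_ge0.
- by rewrite normrM ler_pM.
have -> : f y * g y - f y' * g y' = (f y - f y') * g y + f y' * (g y - g y') by ring.
rewrite [leRHS]mulrDl; apply: (le_trans (ler_normD _ _)); rewrite !normrM; apply: lerD.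
  by rewrite [leRHS]mulrAC ler_pM// lf.
by rewrite -[leRHS]mulrA ler_pM// lg.
Qed.

Lemma bl_clamp i : bounded_lipschitz (fun y => clamp (y i)).
Proof.
exists 2, 1; split=> // [y|y y' d /(_ i)].
  by rewrite /clamp ler_norml le_max ge_max ge_min !lexx /=; lra.
rewrite mul1r /clamp /Num.max /Num.min !ler_norml.
by repeat case: ifPn; rewrite -?leNgt; lra.
Qed.

Lemma inv_above_gt0 (a t : R) : 0 < a -> 0 < inv_above a t <= a^-1.
Proof.
move=> a0; have m0 : 0 < Num.max t a by rewrite lt_max a0 orbT.
by rewrite /inv_above invr_gt0 m0 lef_pV2 ?posrE// le_max lexx orbT.
Qed.

Lemma bl_inv_above (a : R) i : 0 < a -> bounded_lipschitz (fun y => inv_above a (y i)).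
Proof.
move=> a0; have ia := inv_above_gt0 _ a0.
have ai0 : 0 <= a^-1 by rewrite invr_ge0 ltW.
exists a^-1, (a^-1 * a^-1); split=> // [|y|y y' d /(_ i) h]; first exact: mulr_ge0.
  by case/andP: (ia (y i)) => h1 h2; rewrite gtr0_norm.
have m0 t : 0 < Num.max t a by rewrite lt_max a0 orbT.
have -> : inv_above a (y i) - inv_above a (y' i) =
  inv_above a (y i) * inv_above a (y' i) * (Num.max (y' i) a - Num.max (y i) a).
  by rewrite /inv_above; field; rewrite !gt_eqF.
rewrite !normrM -mulrA -[X in _ <= X]mulrA.
have hm : `|Num.max (y' i) a - Num.max (y i) a| <= d.
  move: h; rewrite /Num.max !ler_norml.
  by repeat case: ifPn; rewrite -?leNgt; lra.
case/andP: (ia (y i)) => p1 q1; case/andP: (ia (y' i)) => p2 q2.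
by rewrite (gtr0_norm p1) (gtr0_norm p2) ler_pM ?mulr_ge0 ?(ltW p1) ?(ltW p2) ?ler_pM ?(ltW p2).
Qed.

(** Clamping the tangent at 2 and the coordinates from below at a and b makes the
    right-hand side bounded and Lipschitz everywhere, without changing it on the
    box in_box a b. The height enters as (1 - z) / z^2 = 1 / z^2 - 1 / z. *)
Definition trunc_curvature (a b x z u v : R) : R :=
  - clamp v * inv_above a x
  + 2 * clamp u * (inv_above b z * inv_above b z - inv_above b z).

(** Coordinates 0 to 3 of the state are x, z, u, v; the others stay constant. *)
Definition trunc_field (a b : R) (i : nat) (y : nat -> R) : R :=
  match i with
  | 0%N => clamp (y 2%N)
  | 1%N => clamp (y 3%N)
  | 2%N => - (clamp (y 3%N) * trunc_curvature a b (y 0%N) (y 1%N) (y 2%N) (y 3%N))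
  | 3%N => clamp (y 2%N) * trunc_curvature a b (y 0%N) (y 1%N) (y 2%N) (y 3%N)
  | _ => 0
  end.

Lemma trunc_field_lipschitz (a b : R) : 0 < a -> 0 < b -> exists C L : R, [/\ 0 < L,
  forall i y, `|trunc_field a b i y| <= C &
  forall i y y' d, (forall j, `|y j - y' j| <= d) ->
    `|trunc_field a b i y - trunc_field a b i y'| <= L * d].
Proof.
move=> a0 b0.
have blk : bounded_lipschitz (fun y => trunc_curvature a b (y 0%N) (y 1%N) (y 2%N) (y 3%N)).
  have h0 := bl_inv_above 0 a0; have h1 := bl_inv_above 1 b0.
  have h2 := bl_clamp 2; have h3 := bl_clamp 3.
  apply: bl_add; first by apply: bl_mul => //; exact: bl_opp.
  apply: bl_mul; first by apply: bl_mul => //; exact: bl_cst.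
  by apply: bl_add; [exact: bl_mul|exact: bl_opp].
have blF i : bounded_lipschitz (trunc_field a b i).
  case: i => [|[|[|[|i]]]]; [exact: bl_clamp|exact: bl_clamp| | |exact: bl_cst].
    by apply: bl_opp; apply: bl_mul blk; exact: bl_clamp.
  by apply: bl_mul blk; exact: bl_clamp.
have [C0 [L0 [C0p L0p bf0 lf0]]] := blF 0%N; have [C1 [L1 [C1p L1p bf1 lf1]]] := blF 1%N.
have [C2 [L2 [C2p L2p bf2 lf2]]] := blF 2%N; have [C3 [L3 [C3p L3p bf3 lf3]]] := blF 3%N.
exists (C0 + C1 + C2 + C3), (L0 + L1 + L2 + L3 + 1); split; first by lra.
  move=> [|[|[|[|i]]]] y.
  - by apply: (le_trans (bf0 y)); lra.
  - by apply: (le_trans (bf1 y)); lra.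
  - by apply: (le_trans (bf2 y)); lra.
  - by apply: (le_trans (bf3 y)); lra.
  - by rewrite normr0; lra.
move=> i y y' d h; have d0 : 0 <= d by exact: le_trans (h 0%N).
have w L : 0 <= L -> 0 <= L * d by move=> ?; exact: mulr_ge0.
have := w _ L0p; have := w _ L1p; have := w _ L2p; have := w _ L3p.
rewrite !mulrDl mul1r; case: i => [|[|[|[|i]]]].
- by have := lf0 _ _ _ h; lra.
- by have := lf1 _ _ _ h; lra.
- by have := lf2 _ _ _ h; lra.
- by have := lf3 _ _ _ h; lra.
- by rewrite subrr normr0; lra.
Qed.

Definition trunc_ode (a b : R) x z u v (s : R) : Prop :=
  let k := trunc_curvature a b (x s) (z s) (u s) (v s) in
  [/\ is_derive s 1 x (clamp (u s)), is_derive s 1 z (clamp (v s)),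
      is_derive s 1 u (- (clamp (v s) * k)) &
      is_derive s 1 v (clamp (u s) * k)].

Definition pack (x z u v : R -> R) (i : nat) : R -> R :=
  match i with 0%N => x | 1%N => z | 2%N => u | 3%N => v | _ => fun=> 0 end.

Lemma trunc_exists (a b x0 z0 u0 v0 : R) : 0 < a -> 0 < b ->
  exists x z u v, [/\ x 0 = x0, z 0 = z0, u 0 = u0, v 0 = v0 &
    forall s, trunc_ode a b x z u v s].
Proof.
move=> a0 b0; have [C [L [L0 bF lF]]] := trunc_field_lipschitz a0 b0.
have [y Hy] := picard L0 bF lF (fun i => nth 0 [:: x0; z0; u0; v0] i).
exists (y 0%N), (y 1%N), (y 2%N), (y 3%N).
have [y00 D0] := Hy 0%N; have [y10 D1] := Hy 1%N.
have [y20 D2] := Hy 2%N; have [y30 D3] := Hy 3%N.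
by split.
Qed.

Lemma trunc_unique (a b T : R) x z u v x' z' u' v' : 0 < a -> 0 < b -> 0 <= T ->
  [/\ x 0 = x' 0, z 0 = z' 0, u 0 = u' 0 & v 0 = v' 0] ->
  (forall s, 0 <= s <= T -> trunc_ode a b x z u v s) ->
  (forall s, 0 <= s <= T -> trunc_ode a b x' z' u' v' s) ->
  [/\ x T = x' T, z T = z' T, u T = u' T & v T = v' T].
Proof.
move=> a0 b0 T0 [e0 e1 e2 e3] D D'.
have [C [L [L0 bF lF]]] := trunc_field_lipschitz a0 b0.
have := @lipschitz_unique _ _ _ C L L0 bF lF (pack x z u v) (pack x' z' u' v') T T0.
have Hd y1 y2 y3 y4 : (forall s, 0 <= s <= T -> trunc_ode a b y1 y2 y3 y4 s) ->
    forall i s, 0 <= s <= T ->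
    is_derive s 1 (pack y1 y2 y3 y4 i) (trunc_field a b i ((pack y1 y2 y3 y4)^~ s)).
  move=> H i s /H[d0 d1 d2 d3]; case: i => [|[|[|[|i]]]] //=; exact: d_cst.
move=> /(_ _ (Hd _ _ _ _ D) (Hd _ _ _ _ D')) H.
have {}H : forall i, pack x z u v i T = pack x' z' u' v' i T.
  by apply: H; case=> [|[|[|[|i]]]].
by split; [exact: (H 0%N)|exact: (H 1%N)|exact: (H 2%N)|exact: (H 3%N)].
Qed.

Definition in_box (a b x z u v : R) : Prop :=
  [/\ a <= x, b <= z, `|u| <= 2 & `|v| <= 2].

Lemma clamp_id (t : R) : `|t| <= 2 -> clamp t = t.
Proof.
rewrite ler_norml => /andP[h1 h2]; rewrite /clamp /Num.max /Num.min.
by repeat case: ifPn; rewrite -?leNgt; lra.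
Qed.

Lemma inv_above_id (a t : R) : a <= t -> inv_above a t = t^-1.
Proof. by move=> h; rewrite /inv_above max_l. Qed.

Lemma trunc_curvature_id (a b x z u v : R) : 0 < b -> in_box a b x z u v ->
  trunc_curvature a b x z u v = curvature x z u v.
Proof.
move=> b0 [ax bz u2 v2]; rewrite /trunc_curvature !clamp_id // !inv_above_id //.
have z0 : z != 0 by rewrite gt_eqF// (lt_le_trans b0).
by rewrite /curvature; congr (_ + _); field.
Qed.

Lemma trunc_odeE (a b : R) x z u v s : 0 < b -> in_box a b (x s) (z s) (u s) (v s) ->
  trunc_ode a b x z u v s <-> ode x z u v s.
Proof.
move=> b0 B; rewrite /trunc_ode /ode (trunc_curvature_id b0 B).
by case: B => _ _ u2 v2; rewrite !clamp_id.
Qed.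

Lemma unit_le1 (u v : R) : u ^+ 2 + v ^+ 2 = 1 -> `|u| <= 1 /\ `|v| <= 1.
Proof. by move=> h; rewrite !ler_norml; split; apply/andP; split; nra. Qed.

Lemma positive_minimum (f : R -> R) (a b : R) : a <= b ->
  (forall s, a <= s <= b -> {for s, continuous f} /\ 0 < f s) ->
  exists2 m, 0 < m & forall s, a <= s <= b -> m <= f s.
Proof.
move=> ab H.
have [c cab mc] := EVT_min ab (within_continuous (fun s h => (H s h).1)).
by exists (f c); [case: (H c cab)|exact: mc].
Qed.

(** On a compact time interval both solutions stay in one box, where they solve
    the same truncated system. *)
Lemma profile_unique_fwd (T : R) x z u v x' z' u' v' : 0 <= T ->
  [/\ x 0 = x' 0, z 0 = z' 0, u 0 = u' 0 & v 0 = v' 0] ->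
  profile [set s | 0 <= s <= T] x z u v ->
  profile [set s | 0 <= s <= T] x' z' u' v' ->
  [/\ x T = x' T, z T = z' T, u T = u' T & v T = v' T].
Proof.
move=> T0 e0 H H'.
have cont y1 y2 y3 y4 : profile [set s | 0 <= s <= T] y1 y2 y3 y4 ->
    exists2 m, 0 < m & forall s, 0 <= s <= T -> m <= y1 s /\ m <= y2 s.
  move=> P.
  have [|m1 m10 h1] := @positive_minimum y1 0 T T0.
    by move=> s /P[p _ _ [D _ _ _]]; split => //; exact: is_derive_continuous D.
  have [|m2 m20 h2] := @positive_minimum y2 0 T T0.
    by move=> s /P[_ p _ [_ D _ _]]; split => //; exact: is_derive_continuous D.
  exists (Num.min m1 m2); first by rewrite lt_min m10.
  by move=> s sT; rewrite !ge_min h1 // h2 ?orbT.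
have [m m0 hm] := cont _ _ _ _ H; have [m' m'0 hm'] := cont _ _ _ _ H'.
pose a := Num.min m m'; have a0 : 0 < a by rewrite lt_min m0.
have tr y1 y2 y3 y4 : profile [set s | 0 <= s <= T] y1 y2 y3 y4 ->
    (forall s, 0 <= s <= T -> a <= y1 s /\ a <= y2 s) ->
    forall s, 0 <= s <= T -> trunc_ode a a y1 y2 y3 y4 s.
  move=> P h s sT; have [_ _ /unit_le1[u1 v1] D] := P s sT; have [h1 h2] := h s sT.
  by apply/trunc_odeE => //; split => //; [apply: le_trans u1 _|apply: le_trans v1 _]; rewrite ler1n.
apply: (@trunc_unique a a) => //.
  by apply: tr H _ => s /hm[h1 h2]; split; [apply: le_trans h1|apply: le_trans h2]; rewrite ge_min lexx.
by apply: tr H' _ => s /hm'[h1 h2]; split; [apply: le_trans h1|apply: le_trans h2]; rewrite ge_min lexx orbT.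
Qed.

Lemma profile_unique I x z u v x' z' u' v' (s0 s : R) : is_interval I ->
  I s0 -> I s -> [/\ x s0 = x' s0, z s0 = z' s0, u s0 = u' s0 & v s0 = v' s0] ->
  profile I x z u v -> profile I x' z' u' v' ->
  [/\ x s = x' s, z s = z' s, u s = u' s & v s = v' s].
Proof.
move=> iI I0 Is e0 H H'.
have main k : k ^+ 2 = 1 -> 0 <= k * (s - s0) ->
    [/\ x s = x' s, z s = z' s, u s = u' s & v s = v' s].
  move=> k1 T0; have kk : k * (k * (s - s0)) + s0 = s.
    by rewrite mulrA -expr2 k1 mul1r subrK.
  have sub : [set r | 0 <= r <= k * (s - s0)] `<=` [set r | I (k * r + s0)].
    move=> r /= /andP[r0 rT].
    have [/eqP|/eqP] : k == 1 \/ k == -1 by apply/orP; rewrite -eqf_sqr k1 expr1n.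
      by move=> k1'; apply: (iI s0 s) => //; rewrite k1' in rT *; lra.
    by move=> k1'; apply: (iI s s0) => //; rewrite k1' in rT *; lra.
  have P := profile_subset sub (@profile_affine k s0 _ _ _ _ _ k1 H).
  have P' := profile_subset sub (@profile_affine k s0 _ _ _ _ _ k1 H').
  case: e0 => e1 e2 e3 e4.
  have := profile_unique_fwd T0 _ P P'; rewrite /= mulr0 add0r kk e1 e2 e3 e4.
  have kinj a b : k * a = k * b -> a = b.
    by move=> /(congr1 ( *%R k)); rewrite !mulrA -!expr2 k1 !mul1r.
  by case=> // -> -> /kinj-> /kinj->.
have [h|h] := leP s0 s.
  by apply: (main 1); rewrite ?expr1n // mul1r subr_ge0.
by apply: (main (-1)); rewrite ?sqrrN ?expr1n // mulN1r opprB subr_ge0 ltW.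
Qed.

(** The continuity method: an open condition that passes to the limit at the
    end of any interval [0, T[ on which it holds propagates to all of [0, +oo[. *)
Lemma continuity_method (A : set R) : open A ->
  (forall T, 0 <= T -> (forall s, 0 <= s < T -> A s) -> A T) ->
  forall s, 0 <= s -> A s.
Proof.
move=> oA step s s0; apply: contrapT => nAs.
pose E := [set T : R | 0 <= T /\ forall r, 0 <= r < T -> A r].
have E0 : E 0 by split => // r /andP[r0 /(le_lt_trans r0)]; rewrite ltxx.
have ubE : ubound E s.
  move=> T [T0 hT]; rewrite leNgt; apply/negP => sT.
  by apply: nAs; apply: hT; rewrite s0.
have hs : has_sup E by split; [exists 0|exists s].
pose T := sup E.
have T0 : 0 <= T by apply: ub_le_sup; [exists s|].
have AT r : 0 <= r < T -> A r.
  move=> /andP[r0 rT]; have [T' [_ h] rT'] := sup_gt (ex_intro _ 0 E0) rT.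
  by apply: h; rewrite r0.
have /(open_near oA) /nbhs_ballP[e /= e0 he] := step T T0 AT.
have : E (T + e / 2).
  split; first by rewrite addr_ge0// divr_ge0// ltW.
  move=> r /andP[r0 rT]; have [rT'|Tr] := ltP r T; first by apply: AT; rewrite r0.
  apply: he; rewrite /ball /= ltr_norml; apply/andP; split; lra.
move=> /(ub_le_sup (ex_intro _ s ubE)); rewrite -/T.
have e2 : 0 < e / 2 by rewrite divr_gt0.
by lra.
Qed.

Lemma limit_ge (f : R -> R) (T c : R) : 0 < T -> {for T, continuous f} ->
  (forall s, 0 <= s < T -> c <= f s) -> c <= f T.
Proof.
move=> T0 cf h; rewrite leNgt; apply/negP => fc.
have /nbhs_ballP[e /= e0 he] : \forall t \near T, f t < c.
  by apply: (cvgr_lt (f T) cf).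
pose t := T - Num.min (e / 2) (T / 2).
have e2 : 0 < e / 2 by rewrite divr_gt0.
have T2 : 0 < T / 2 by rewrite divr_gt0.
have [m1 m2 m3] : [/\ 0 < Num.min (e / 2) (T / 2), Num.min (e / 2) (T / 2) <= e / 2
  & Num.min (e / 2) (T / 2) <= T / 2] by rewrite lt_min e2 T2 !ge_min !lexx orbT.
have : f t < c by apply: he; rewrite /ball /= /t ltr_norml; apply/andP; split; lra.
by apply/negP; rewrite -leNgt; apply: h; rewrite /t; apply/andP; split; lra.
Qed.

(** * The energy *)

(** Defined so that (log weight)' = 2 (1 - z) / z^2: along a solution this cancels
    the second term of the curvature in the derivative of u * weight z. *)
Definition weight (z : R) : R := expR (- (2 / z)) / z ^+ 2.

Lemma weight_gt0 (z : R) : 0 < z -> 0 < weight z.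
Proof. by move=> z0; rewrite divr_gt0 ?expR_gt0 ?exprn_gt0. Qed.

Lemma weight_upper (z : R) : 0 < z -> weight z <= 27 / 8 * z /\ weight z * z ^+ 2 <= 1.
Proof.
move=> z0; have z0' : z != 0 by rewrite gt_eqF.
have y0 : 0 < 2 / z by rewrite divr_gt0.
split; last first.
  rewrite /weight divfK ?expf_neq0 //.
  by rewrite -[leRHS]expR0 ler_expR oppr_le0 ltW.
have h3 : (2 / z / 3) ^+ 3 <= expR (2 / z).
  (* e^y = (e^(y/3))^3 >= (y/3)^3, with y = 2/z. *)
  have -> : 2 / z = 3%:R * (2 / z / 3) by field.
  have -> : 3%:R * (2 / z / 3) / 3 = 2 / z / 3 by field.
  rewrite expRM_natl; apply: lerXn2r; rewrite ?nnegrE ?expR_ge0//.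
    by rewrite ltW // divr_gt0.
  by apply: le_trans (expR_ge1Dx _); rewrite lerDr.
have e0 := expR_gt0 (2 / z).
have y3 : 0 < (2 / z / 3) ^+ 3 by rewrite exprn_gt0 // divr_gt0.
have -> : 27 / 8 * z = ((2 / z / 3) ^+ 3)^-1 / z ^+ 2 by field.
rewrite /weight expRN ler_wpM2r ?invr_ge0 ?sqr_ge0 //.
by rewrite lef_pV2 ?posrE.
Qed.

(** The quantity is the exponential of minus the energy - log u + 2/z + 2 log z,
    a kinetic and a potential term for the motion of the graph z = f(x), which
    friction dissipates at the rate v^2 / (x u). *)
Lemma d_energy x z u v s : 0 < x s -> 0 < z s -> ode x z u v s ->
  is_derive s 1 (fun r => u r * weight (z r)) (v s ^+ 2 / x s * weight (z s)).
Proof.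
move=> x0 z0 [Dx Dz Du Dv]; have z0' : z s != 0 by rewrite gt_eqF.
have x0' : x s != 0 by rewrite gt_eqF.
have D1 : is_derive s 1 (fun r => 2 / z r) (- (2 * v s / z s ^+ 2)).
  by apply: d_eq (d_mul (d_cst 2 s) (d_inv z0' Dz)) _; field.
have z2 : z s ^+ 2 != 0 by rewrite expf_neq0.
have D2 := @d_inv _ (fun r => z r ^+ 2) s _ z2 (d_exp 2 Dz).
apply: d_eq (d_mul Du (d_mul (d_expR (d_opp D1)) D2)) _.
rewrite /weight /curvature /= expr1; set e := expR _.
by field; rewrite z0' x0'.
Qed.

Lemma energy_mono I x z u v (s s' : R) : is_interval I -> profile I x z u v ->
  I s -> I s' -> s <= s' -> u s * weight (z s) <= u s' * weight (z s').
Proof.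
move=> iI H Is Is' ss'.
have sub r : s <= r <= s' -> I r by move=> h; exact: (iI s s' Is Is').
apply: (@deriv_ge0_le _ (fun r => u r * weight (z r))
  (fun r => v r ^+ 2 / x r * weight (z r)) _ _ ss') => r /sub/H[x0 z0 _ D].
  exact: d_energy.
by rewrite mulr_ge0 ?divr_ge0 ?sqr_ge0 ?(ltW x0) ?(ltW (weight_gt0 z0)).
Qed.

Section Forward.
Variables (I : set R) (x z u v : R -> R).
Hypotheses (iI : is_interval I) (I0 : I 0) (H : profile I x z u v) (u0 : u 0 = 0).

Let z_gt0 s : I s -> 0 < z s. Proof. by case/H. Qed.
Let weight_z s : I s -> 0 < weight (z s). Proof. by move/z_gt0/weight_gt0. Qed.

(** If u were nonpositive at s, monotonicity of the energy would make it vanish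
    on all of [0, s]; but where u = 0 the equation gives u' = 1 / x. *)
Lemma u_gt0 s : I s -> 0 < s -> 0 < u s.
Proof.
move=> Is s0; rewrite ltNge; apply/negP => us.
have sub r : 0 <= r <= s -> I r by move=> h; exact: (iI I0 Is).
have uz r : 0 <= r <= s -> u r = 0.
  move=> rs; have Ir := sub r rs; case/andP: rs => r0 rs.
  have h1 := energy_mono iI H I0 Ir r0; have h2 := energy_mono iI H Ir Is rs.
  have w0 := weight_z Ir; have w1 := weight_z Is.
  move: h1; rewrite u0 mul0r pmulr_lge0 // => ur0.
  apply/eqP; rewrite eq_le ur0 andbT -(pmulr_lle0 _ w0) (le_trans h2) //.
  by rewrite pmulr_lle0.
pose r := s / 2; have [r0 rs] : 0 < r /\ r < s by rewrite /r; lra.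
have Ir : I r by apply: sub; rewrite !ltW.
have [x0 _ uv [_ _ Du _]] := H Ir; have ur : u r = 0 by apply: uz; rewrite !ltW.
have D0 : is_derive r 1 u 0.
  apply: (@is_derive_eq_on _ `]0, s[ (fun=> 0) u r 0 _ _ _ (d_cst 0 r)) => //.
    by rewrite /= in_itv /= r0.
  by move=> t; rewrite /= in_itv /= => /closed_itvW /uz.
have := derive1_val Du; rewrite (derive1_val D0) => /eqP.
move: uv; rewrite /curvature ur expr0n /= add0r mulr0 !mul0r addr0 => v1.
by rewrite mulNr mulrN opprK mulrA -expr2 v1 div1r eq_sym invr_eq0 gt_eqF.
Qed.

Lemma x_ge s : I s -> 0 <= s -> x 0 <= x s.
Proof.
move=> Is s0; apply: (@deriv_ge0_le _ x u _ _ s0) => r rs.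
  by have /H[_ _ _ []] : I r by exact: (iI I0 Is).
have Ir : I r by exact: (iI I0 Is).
have [/andP[r0 _]] := (rs, tt); move: r0; rewrite le_eqVlt => /predU1P[<-|r0].
  by rewrite u0.
by rewrite ltW // u_gt0.
Qed.

Lemma x_lt s s' : I s -> I s' -> 0 <= s -> s < s' -> x s < x s'.
Proof.
move=> Is Is' s0 ss'.
have sub r : s <= r <= s' -> I r by exact: (iI Is Is').
apply: (@deriv_gt0_lt _ x u _ _ ss') => r.
- by move=> /sub/H[_ _ _ [D _ _ _]]; exact: is_derive_continuous D.
- by move=> /closed_itvW/sub/H[_ _ _ []].
- by move=> h; apply: u_gt0; [exact/sub/closed_itvW|case/andP: h => h _; exact: le_lt_trans h].
Qed.

(** Since u <= 1 and the weight is small for small and for large z, the value q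
    reached at time d cannot be maintained unless z stays between two bounds. *)
Lemma energy_bounds d s : I d -> 0 < d -> I s -> d <= s ->
  let q := u d * weight (z d) in
  [/\ 0 < q, 8 / 27 * q <= z s, q * z s ^+ 2 <= 1 & q * z s ^+ 2 <= u s].
Proof.
move=> Id d0 Is ds q.
have q0 : 0 < q by rewrite mulr_gt0 ?u_gt0 ?weight_z.
have qs : q <= u s * weight (z s) by exact: energy_mono iI H Id Is ds.
have z0 := z_gt0 Is; have [w1 w2] := weight_upper z0.
have us : 0 < u s by apply: u_gt0 => //; exact: lt_le_trans ds.
have us1 : u s <= 1.
  by have [_ _ /unit_le1[h _] _] := H Is; exact: le_trans (ler_norm _) h.
have w0 := weight_z Is.
have qw : q <= weight (z s) by apply: (le_trans qs); rewrite ger_pMl.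
have quz : q * z s ^+ 2 <= u s.
  apply: (@le_trans _ _ (u s * (weight (z s) * z s ^+ 2))).
    by rewrite mulrA ler_wpM2r // sqr_ge0.
  by rewrite ger_pMr.
split=> //; last exact: le_trans quz us1.
by lra.
Qed.

End Forward.

(** * Profiles defined for all times *)

Lemma trunc_profile (a b T : R) x z u v : 0 < a -> 0 < b ->
  u 0 ^+ 2 + v 0 ^+ 2 = 1 ->
  (forall s, 0 <= s < T -> trunc_ode a b x z u v s) ->
  (forall s, 0 <= s < T -> in_box a b (x s) (z s) (u s) (v s)) ->
  profile [set s | 0 <= s < T] x z u v.
Proof.
move=> a0 b0 uv0 D B s sT.
have Do r : 0 <= r < T -> ode x z u v r by move=> rT; apply/(trunc_odeE b0 (B r rT))/D.
have [ax bz _ _] := B s sT; split; [exact: lt_le_trans ax|exact: lt_le_trans bz| |exact: Do].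
rewrite -[RHS]uv0; case/andP: sT => s0 sT.
apply: (@deriv0_const _ (fun r => u r ^+ 2 + v r ^+ 2) 0 s s0) => r /andP[r0 rs].
have [_ _ Du Dv] : ode x z u v r by apply: Do; rewrite r0 (le_lt_trans rs).
by apply: d_eq (d_add (d_exp 2 Du) (d_exp 2 Dv)) _; rewrite /=; ring.
Qed.

Lemma open_box (a b : R) x z u v : (forall s, trunc_ode a b x z u v s) ->
  open [set s | [/\ a < x s, b < z s, `|u s| < 2 & `|v s| < 2]].
Proof.
move=> D.
have cx : continuous x by move=> s; have [h _ _ _] := D s; exact: is_derive_continuous h.
have cz : continuous z by move=> s; have [_ h _ _] := D s; exact: is_derive_continuous h.
have cu : continuous u by move=> s; have [_ _ h _] := D s; exact: is_derive_continuous h.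
have cv : continuous v by move=> s; have [_ _ _ h] := D s; exact: is_derive_continuous h.
rewrite openE => s [h1 h2 h3 h4]; rewrite /interior /=.
near=> t; split.
- by near: t; exact: (cvgr_gt (x s) (cx s)).
- by near: t; exact: (cvgr_gt (z s) (cz s)).
- by near: t; apply: (cvgr_lt `|u s|) => //; apply: cvg_norm; exact: cu.
- by near: t; apply: (cvgr_lt `|v s|) => //; apply: cvg_norm; exact: cv.
Unshelve. all: by end_near. Qed.

(** A truncation that the solution starting at (x0, z0) with vertical tangent
    never meets: the height bound is read off from the energy that the solution
    of a first truncated system has gained after a short time. *)
Lemma untouched_truncation (x0 z0 v0 : R) : 0 < x0 -> 0 < z0 -> v0 ^+ 2 = 1 ->
  exists2 b0, 0 < b0 & forall b x z u v, 0 < b -> b < b0 ->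
    [/\ x 0 = x0, z 0 = z0, u 0 = 0 & v 0 = v0] ->
    (forall s, trunc_ode (x0 / 2) b x z u v s) ->
    forall s, 0 <= s -> [/\ x0 / 2 < x s, b < z s, `|u s| < 2 & `|v s| < 2].
Proof.
move=> x00 z00 v01; have a0 : 0 < x0 / 2 by rewrite divr_gt0.
have b10 : 0 < z0 / 2 by rewrite divr_gt0.
have v0n : `|v0| = 1.
  by apply/eqP; rewrite -(@eqrXn2 _ 2) // ?expr1n -?normrX ?v01 ?normr1.
have [y1 [y2 [y3 [y4 [e1 e2 e3 e4 Dy]]]]] := @trunc_exists (x0 / 2) (z0 / 2) x0 z0 0 v0 a0 b10.
have oA := open_box Dy.
have /(open_near oA) /nbhs_ballP[e /= he0 he] :
    [set s | [/\ x0 / 2 < y1 s, z0 / 2 < y2 s, `|y3 s| < 2 & `|y4 s| < 2]] 0.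
  rewrite /= e1 e2 e3 e4 normr0 v0n; split; lra.
pose d := e / 2; have d0 : 0 < d by rewrite divr_gt0.
have de : d < e by rewrite /d; lra.
have By s : 0 <= s < e -> in_box (x0 / 2) (z0 / 2) (y1 s) (y2 s) (y3 s) (y4 s).
  move=> /andP[s0 se]; have [] : [/\ x0 / 2 < y1 s, z0 / 2 < y2 s, `|y3 s| < 2 & `|y4 s| < 2].
    by apply: he; rewrite /ball /= sub0r normrN ger0_norm.
  by move=> *; split; exact: ltW.
have uv0 : y3 0 ^+ 2 + y4 0 ^+ 2 = 1 by rewrite e3 e4 v01 expr0n add0r.
have Py := trunc_profile a0 b10 uv0 (fun s _ => Dy s) By.
have iI (T : R) : is_interval [set s | 0 <= s < T].
  by move=> r1 r2 /= /andP[h1 h2] /andP[h3 h4] r /andP[h5 h6]; lra.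
have Ie : [set s | 0 <= s < e] 0 by rewrite /= lexx.
have Id : [set s | 0 <= s < e] d by rewrite /= (ltW d0).
have [q0 _ _ _] := energy_bounds (iI e) Ie Py e3 Id d0 Id (lexx d).
set q := y3 d * weight (y2 d) in q0.
exists (Num.min (z0 / 2) (8 / 27 * q)).
  by rewrite lt_min b10 mulr_gt0.
move=> b x z u v b0; rewrite lt_min => /andP[bz bq] [f1 f2 f3 f4] D.
have oB := open_box D; apply: (continuity_method oB) => T T0 hT.
have cont : [/\ {for T, continuous x}, {for T, continuous z},
    {for T, continuous u} & {for T, continuous v}].
  by have [h1 h2 h3 h4] := D T; split; apply: is_derive_continuous; eassumption.
move: T0; rewrite le_eqVlt => /predU1P[<-|T0] /=.
  by rewrite f1 f2 f3 f4 normr0 v0n; split; lra.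
have Bx s : 0 <= s < T -> in_box (x0 / 2) b (x s) (z s) (u s) (v s).
  by move=> /hT[*]; split; exact: ltW.
have uv1 : u 0 ^+ 2 + v 0 ^+ 2 = 1 by rewrite f3 f4 v01 expr0n add0r.
have Px := trunc_profile a0 b0 uv1 (fun s _ => D s) Bx.
have IT : [set s | 0 <= s < T] 0 by rewrite /= lexx.
have Dyb s : 0 <= s <= d -> trunc_ode (x0 / 2) b y1 y2 y3 y4 s.
  move=> /andP[s0 sd]; have se : 0 <= s < e by rewrite s0 (le_lt_trans sd).
  have [B1 B2 B3 B4] := By s se.
  have B : in_box (x0 / 2) b (y1 s) (y2 s) (y3 s) (y4 s).
    by split => //; apply: le_trans B2; exact: ltW.
  by apply/(trunc_odeE b0 B)/(trunc_odeE b10 (By s se)).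
have agree s : 0 <= s <= d -> [/\ x s = y1 s, z s = y2 s, u s = y3 s & v s = y4 s].
  move=> /andP[s0 sd]; apply: (trunc_unique a0 b0 s0) => [|//|r /andP[r0 rs]].
    by rewrite f1 f2 f3 f4 e1 e2 e3 e4.
  by apply: Dyb; rewrite r0 (le_trans rs).
have zb s : 0 <= s < T -> Num.min (z0 / 2) (8 / 27 * q) <= z s.
  move=> sT; have [sd|ds] := leP s d.
    case/andP: (sT) => s0 _; have sd' : 0 <= s <= d by rewrite s0.
    have [_ -> _ _] := agree s sd'; rewrite ge_min; apply/orP; left.
    by have [|] := By s; first by rewrite s0 (le_lt_trans sd).
  have dT : [set s | 0 <= s < T] d by case/andP: sT => _ sT; rewrite /= (ltW d0) (lt_trans ds).
  have [_ h _ _] := energy_bounds (iI T) IT Px f3 dT d0 sT (ltW ds).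
  rewrite ge_min; apply/orP; right; apply: le_trans h.
  by have [|_ -> -> _] := agree d; first by rewrite lexx ltW.
have bm : b < Num.min (z0 / 2) (8 / 27 * q) by rewrite lt_min bz.
have [cx cz cu cv] := cont; split.
- apply: (@lt_le_trans _ _ x0); first by lra.
  apply: (limit_ge T0 cx) => s sT; rewrite -f1.
  by apply: (x_ge (iI T) IT Px f3) => //; case/andP: sT.
- by apply: (lt_le_trans bm); exact: (limit_ge T0 cz).
- have : -1 <= - `|u T|.
    apply: (@limit_ge (fun s => - `|u s|) T) => //; first by apply: cvgN; apply: cvg_norm; exact: cu.
    by move=> s /Px[_ _ /unit_le1[h _] _]; lra.
  by lra.
- have : -1 <= - `|v T|.
    apply: (@limit_ge (fun s => - `|v s|) T) => //; first by apply: cvgN; apply: cvg_norm; exact: cv.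
    by move=> s /Px[_ _ /unit_le1[_ h] _]; lra.
  by lra.
Qed.

Lemma clampN (t : R) : clamp (- t) = - clamp t.
Proof.
by rewrite /clamp /Num.max /Num.min; repeat case: ifPn; rewrite -?leNgt; lra.
Qed.

Lemma trunc_reverse (a b : R) x z u v s : trunc_ode a b x z u v (- s) ->
  trunc_ode a b (fun r => x (- r)) (fun r => z (- r)) (fun r => - u (- r)) (fun r => - v (- r)) s.
Proof.
move=> [D1 D2 D3 D4].
have E : trunc_curvature a b (x (- s)) (z (- s)) (- u (- s)) (- v (- s)) =
  - trunc_curvature a b (x (- s)) (z (- s)) (u (- s)) (v (- s)).
  by rewrite /trunc_curvature !clampN; ring.
rewrite /trunc_ode E !clampN; split.
- exact: is_derive_reverse.
- exact: is_derive_reverse.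
- by apply: d_eq (d_opp (is_derive_reverse D3)) _; ring.
- by apply: d_eq (d_opp (is_derive_reverse D4)) _; ring.
Qed.

(** The solution of a truncated system is a profile for s >= 0; the reversed
    solution solves the same truncated system, with v 0 = -1, which gives s <= 0. *)
Theorem W_profile_exists (x0 z0 : R) : 0 < x0 -> 0 < z0 ->
  exists x z u v, [/\ profile setT x z u v, x 0 = x0, z 0 = z0, u 0 = 0 & v 0 = 1].
Proof.
move=> x00 z00; have a0 : 0 < x0 / 2 by rewrite divr_gt0.
have [|b1 b10 h1] := @untouched_truncation x0 z0 1 x00 z00; first by rewrite expr1n.
have [|b2 b20 h2] := @untouched_truncation x0 z0 (-1) x00 z00.
  by rewrite sqrrN expr1n.
pose b := Num.min b1 b2 / 2.
have m0 : 0 < Num.min b1 b2 by rewrite lt_min b10.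
have b0 : 0 < b by rewrite divr_gt0.
have bm : b < Num.min b1 b2 by rewrite /b; lra.
move: bm; rewrite lt_min => /andP[bb1 bb2].
have [x [z [u [v [e1 e2 e3 e4 D]]]]] := @trunc_exists (x0 / 2) b x0 z0 0 1 a0 b0.
exists x, z, u, v; split => // s _.
have fwd r : 0 <= r -> in_box (x0 / 2) b (x r) (z r) (u r) (v r).
  by move=> r0; have [] := h1 b x z u v b0 bb1 (And4 e1 e2 e3 e4) D r r0; split; exact: ltW.
have bwd r : 0 <= r -> in_box (x0 / 2) b (x (- r)) (z (- r)) (- u (- r)) (- v (- r)).
  move=> r0; have [||] := h2 b (fun r => x (- r)) (fun r => z (- r)) (fun r => - u (- r)) (fun r => - v (- r)) b0 bb2 _ _ r r0.
  - by rewrite oppr0 e1 e2 e3 e4 oppr0.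
  - by move=> t; apply: trunc_reverse; exact: D.
  by split; exact: ltW.
have uv0 : u 0 ^+ 2 + v 0 ^+ 2 = 1 by rewrite e3 e4 expr1n expr0n add0r.
have [s0|/ltW s0] := leP 0 s.
  have H := @trunc_profile (x0 / 2) b (s + 1) x z u v a0 b0 uv0 (fun s _ => D s) (fun s h => fwd s (proj1 (andP h))).
  by apply: (H s); rewrite /= s0 ltrDl ltr01.
have H := @trunc_profile (x0 / 2) b (- s + 1) (fun r => x (- r)) (fun r => z (- r)) (fun r => - u (- r)) (fun r => - v (- r)) a0 b0.
rewrite oppr0 !sqrrN in H.
have {H} := H uv0 (fun r _ => trunc_reverse (D (- r))) (fun r h => bwd r (proj1 (andP h))).
move=> /(@profile_affine (-1) 0) H.
have k1 : (-1 : R) ^+ 2 = 1 by rewrite sqrrN expr1n.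
have Is : 0 <= -1 * s + 0 < - s + 1.
  by rewrite mulN1r addr0 oppr_ge0 s0 ltrDl ltr01.
have := H k1 s Is.
have E1 (f : R -> R) : (fun r => f (- (-1 * r + 0))) = f.
  by apply/funext => r; rewrite mulN1r addr0 opprK.
have E2 (f : R -> R) : (fun r => -1 * - f (- (-1 * r + 0))) = f.
  by apply/funext => r; rewrite !mulN1r addr0 !opprK.
by rewrite !E1 !E2 !mulN1r !addr0 !opprK.
Qed.

End System.

(** * Regularity at a singular point *)

Section Averaging.
Variable R : realType.
Implicit Types (f g : R -> R) (J : set R).

Lemma continuous_atP f (a : R) : {for a, continuous f} <->
  forall e, 0 < e -> exists2 d, 0 < d & forall s, `|s - a| < d -> `|f s - f a| < e.
Proof.
split=> [cf e e0|H].
  have /cvgrPdist_lt/(_ e e0)/nbhs_ballP[d /= d0 hd] := cf.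
  exists d => // s sd; rewrite distrC; apply: hd.
  by rewrite /ball /= distrC.
apply/cvgrPdist_lt => e /H[d d0 hd]; apply/nbhs_ballP; exists d => // s /=.
by rewrite /ball /= => sd; rewrite distrC; apply: hd; rewrite distrC.
Qed.

Lemma is_derive0P f (d : R) : is_derive (0 : R) 1 f d <->
  forall e, 0 < e -> exists2 r, 0 < r & forall s, `|s| < r -> `|f s - f 0 - d * s| <= e * `|s|.
Proof.
split=> [[df <-] e e0|H].
  have /cvgrPdist_lt/(_ e e0)/nbhs_ballP[r /= r0 hr] := df.
  exists r => // s sr; have [->|s0] := eqVneq s 0.
    by rewrite subrr mulr0 subr0 normr0 mulr0.
  have /hr : ball 0 r s by rewrite /ball /= sub0r normrN.
  move=> /(_ s0) /=; rewrite addr0 /GRing.scale /= mulr1 => h.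
  have -> : f s - f 0 - 'D_1 f 0 * s = - ('D_1 f 0 - s^-1 * (f s - f 0)) * s.
    by field.
  by rewrite normrM normrN ler_wpM2r // ltW.
have cv : h^-1 *: (f (h *: (1 : R) + 0) - f 0) @[h --> 0^'] --> d.
  apply/cvgrPdist_le => e e0; have [r r0 hr] := H e e0.
  apply/nbhs_ballP; exists r => // s /=.
  rewrite /ball /= sub0r normrN => sr s0; rewrite addr0 /GRing.scale /= mulr1.
  have := hr s sr.
  have -> : f s - f 0 - d * s = - (d - s^-1 * (f s - f 0)) * s by field.
  by rewrite normrM normrN ler_pM2r // normr_gt0.
apply: DeriveDef; first by apply/cvg_ex; exists d.
exact/cvg_lim.
Qed.

(** The mean value theorem from 0 to s, whatever the sign of s. *)
Lemma mvt0 f (df : R -> R) (s : R) : s != 0 ->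
  (forall r : R, `|r| <= `|s| -> {for r, continuous f}) ->
  (forall r : R, `|r| <= `|s| -> r != 0 -> is_derive r 1 f (df r)) ->
  exists2 c, c != 0 /\ `|c| < `|s| & f s - f 0 = df c * s.
Proof.
move=> s0 cf Df; have [sp|sn] : 0 < s \/ s < 0 by apply/orP; rewrite -neq_lt eq_sym.
  have [|r h|c /andP[c0 cs] E] := @mvt _ f df 0 s sp.
  - by move=> r /andP[r0 rs]; apply: cf; rewrite !ger0_norm// ltW.
  - by case/andP: h => r0 rs; apply: Df; rewrite ?gt_eqF// !gtr0_norm// ltW.
  by exists c; rewrite ?E ?subr0// gt_eqF// !gtr0_norm.
have [|r h|c /andP[cs c0] E] := @mvt _ f df s 0 sn.
- by move=> r /andP[r0 rs]; apply: cf; rewrite !ler0_norm ?lerN2// ltW.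
- by case/andP: h => r0 rs; apply: Df; rewrite ?lt_eqF// !ltr0_norm ?lerN2// ltW.
exists c; first by rewrite lt_eqF// !ltr0_norm ?ltrN2.
by rewrite -opprB E sub0r mulrN opprK.
Qed.

(** The components of a solution continued across the axis are differentiated
    at the crossing by passing to the limit in the equation. *)
Lemma deriv_extend f (df : R -> R) (d : R) : 0 < d ->
  (forall r : R, `|r| < d -> {for r, continuous f}) ->
  (forall r : R, `|r| < d -> r != 0 -> is_derive r 1 f (df r)) ->
  {for 0, continuous df} -> is_derive (0 : R) 1 f (df 0).
Proof.
move=> d0 cf Df /continuous_atP cdf; apply/is_derive0P => e e0.
have [r r0 hr] := cdf e e0; exists (Num.min r d); first by rewrite lt_min r0.
move=> s; rewrite lt_min => /andP[sr sd]; have [->|s0] := eqVneq s 0.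
  by rewrite subrr mulr0 subr0 normr0 mulr0.
have [t ts|t ts t0|c [c0 cs] ->] := @mvt0 f df s s0.
- by apply: cf; exact: le_lt_trans sd.
- by apply: Df => //; exact: le_lt_trans sd.
rewrite -mulrBl normrM ler_wpM2r // ltW //; apply: hr.
by rewrite subr0 (lt_trans cs).
Qed.

Lemma open_ball0 J : open J -> J 0 -> exists2 d : R, 0 < d & forall s, `|s| < d -> J s.
Proof.
move=> oJ J0; have /nbhs_ballP[d /= d0 hd] := open_near oJ J0.
by exists d => // s sd; apply: hd; rewrite /ball /= sub0r normrN.
Qed.

(** With N = n.+1, a solution g of s g' + N g = f that is continuous at the
    singular point 0 is an average of f, s^-N times the integral of r^(N-1) f r
    from 0 to s, and averages are as smooth as what they average: g' solves the
    same equation with f' and N + 1 in place of f and N. *)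
Lemma class_C_average k (n : nat) J f g : open J -> J 0 -> is_interval J ->
  class_C k J f -> (forall s, J s -> {for s, continuous g}) ->
  n.+1%:R * g 0 = f 0 ->
  (forall s, J s -> s != 0 -> is_derive s 1 g ((f s - n.+1%:R * g s) / s)) ->
  class_C k J g.
Proof.
move=> oJ J0 iJ; elim: k n f g => [//|k IH] n f g cf cg g0 Dg.
have Jn s r : J s -> `|r| <= `|s| -> 0 <= r * s -> J r.
  move=> Js rs p; have [s0|s0] := leP 0 s.
    have [r0|r0] := leP 0 r; first by apply: (iJ 0 s) => //; rewrite r0 -(ger0_norm s0) -(ger0_norm r0).
    have : s = 0 by nra.
    by move=> E; move: rs; rewrite E normr0 normr_le0 => /eqP ->.
  have [r0|r0] := leP r 0.
    by apply: (iJ s 0) => //; move: rs; rewrite (ler0_norm r0) (ltr0_norm s0) lerN2 => ->.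
  by have : False by nra.
have [d d0 dJ] := open_ball0 oJ J0.
pose c := derive1 f 0 / n.+2%:R.
have n1 : n.+1%:R != 0 :> R by rewrite pnatr_eq0.
have n2 : n.+2%:R != 0 :> R by rewrite pnatr_eq0.
have nS : n.+2%:R = n.+1%:R + 1 :> R by rewrite -natr1.
have n3 : 1 + n%:R + 1 != 0 :> R by rewrite [1 + _]addrC !natr1.
have D0 : is_derive (0 : R) 1 g c.
  apply/is_derive0P => e e0.
  have [r r0 hr] := (is_derive0P f _).1 (class_C_derive cf J0) e e0.
  exists (Num.min r d); first by rewrite lt_min r0.
  move=> s; rewrite lt_min => /andP[sr sd]; have [->|s0] := eqVneq s 0.
    by rewrite subrr mulr0 subr0 normr0 mulr0.
  pose phi t := t ^+ n.+1 * (g t - g 0 - c * t).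
  pose dphi t := t ^+ n * (f t - f 0 - derive1 f 0 * t).
  have [t ts|t ts t0|p [p0 ps] E] := @mvt0 phi dphi s s0.
  - have Jt : J t by apply: dJ; exact: le_lt_trans sd.
    apply: cvgM; first by apply: (is_derive_continuous (d_exp n.+1 (d_id t))).
    apply: cvgB; first by apply: cvgB; [exact: cg|exact: cvg_cst].
    by apply: cvgM; [exact: cvg_cst|exact: cvg_id].
  - have Jt : J t by apply: dJ; exact: le_lt_trans sd.
    have D1 := d_add (d_add (Dg t Jt t0) (d_opp (d_cst (g 0) t))) (d_opp (d_mul (d_cst c t) (d_id t))).
    apply: d_eq (d_mul (d_exp n.+1 (d_id t)) D1) _.
    rewrite /dphi /= mul0r add0r !mulr1 oppr0 addr0 exprS -g0 /c nS; field.
    by rewrite n3 t0.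
  have sn : 0 < `|s| ^+ n.+1 by rewrite exprn_gt0// normr_gt0.
  rewrite -(ler_pM2l sn) -normrX -normrM.
  have p00 : phi 0 = 0 by rewrite /phi expr0n /= mul0r.
  rewrite -[X in `|X| <= _]/(phi s) -[phi s]subr0 -p00 E normrX.
  have ple : `|p| <= `|s| by exact: ltW.
  have h : `|f p - f 0 - derive1 f 0 * p| <= e * `|s|.
    by apply: (le_trans (hr p (lt_trans ps sr))); rewrite ler_pM2l.
  have -> : `|s| ^+ n.+1 * (e * `|s|) = `|s| ^+ n * (e * `|s|) * `|s| by rewrite exprS; ring.
  rewrite normrM /dphi normrM normrX ler_wpM2r // ler_pM ?exprn_ge0 //.
  by rewrite lerXn2r ?nnegrE.
pose dg s := if s == 0 then c else (f s - n.+1%:R * g s) / s.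
have Dg' s : J s -> is_derive s 1 g (dg s).
  by move=> Js; rewrite /dg; case: eqVneq => [->//|s0]; exact: Dg.
have near_dg s : J s -> s != 0 -> \forall t \near s, (f t - n.+1%:R * g t) / t = dg t.
  move=> Js s0; have : \forall t \near s, t != 0 by exact: open_near (@open_neq _ 0) s0.
  by apply: filterS => t t0; rewrite /dg (negbTE t0).
apply: (class_CS oJ Dg'); apply: (IH n.+1 (derive1 f) dg cf.2) => [s Js||s Js s0].
- have [->|s0] := eqVneq s 0; last first.
    rewrite /prop_for /continuous_at -(nbhs_singleton (near_dg s Js s0)).
    apply: cvg_trans (near_eq_cvg (near_dg s Js s0)) _.
    apply: cvgM; last by apply: cvgV => //; exact: cvg_id.
    apply: cvgB; first exact: (class_C0 cf).
    by apply: cvgM; [exact: cvg_cst|exact: cg].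
  apply/continuous_atP => e e0; have e2 : 0 < e / 4 by rewrite divr_gt0.
  have e3 : 0 < e / 4 / n.+1%:R by rewrite divr_gt0 // ltr0n.
  have [r1 r10 h1] := (is_derive0P f _).1 (class_C_derive cf J0) _ e2.
  have [r2 r20 h2] := (is_derive0P g _).1 D0 _ e3.
  exists (Num.min r1 r2); first by rewrite lt_min r10.
  move=> {Js}s; rewrite subr0 lt_min => /andP[sr1 sr2].
  rewrite [dg 0]/dg eqxx /dg; have [_|s0] := eqVneq s 0; first by rewrite subrr normr0.
  have -> : (f s - n.+1%:R * g s) / s - c =
    ((f s - f 0 - derive1 f 0 * s) - n.+1%:R * (g s - g 0 - c * s)) / s.
    by rewrite -g0 /c nS; field; rewrite n3 s0.
  rewrite normrM normfV ltr_pdivrMr ?normr_gt0 //.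
  apply: (@le_lt_trans _ _ (e / 2 * `|s|)); last first.
    by rewrite ltr_pM2r ?normr_gt0 //; lra.
  apply: (le_trans (ler_normB _ _)); rewrite normrM (ger0_norm (ler0n _ _)).
  have := h1 s sr1; have : n.+1%:R * `|g s - g 0 - c * s| <= e / 4 * `|s|.
    rewrite -ler_pdivlMl ?ltr0n // mulrA; apply: (le_trans (h2 s sr2)).
    by rewrite [n.+1%:R^-1 * _]mulrC.
  by lra.
- by rewrite /dg eqxx /c mulrC divfK.
- apply: (near_eq_is_derive (near_dg s Js s0)).
  have D1 := d_add (class_C_derive cf Js) (d_opp (d_mul (d_cst n.+1%:R s) (Dg s Js s0))).
  apply: d_eq (d_mul D1 (d_inv s0 (d_id s))) _.
  by rewrite /dg (negbTE s0) nS /=; field.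
Qed.

(** A curve that crosses the axis orthogonally at s = 0 is symmetric: x and v are
    odd functions of s, while z and u are even. *)
Definition even_ext (c : R) f (s : R) : R := if s == 0 then c else f `|s|.
Definition odd_ext f (s : R) : R := Num.sg s * f `|s|.

Definition right_limit f (c : R) : Prop :=
  forall e, 0 < e -> exists2 d, 0 < d & forall r, 0 < r < d -> `|f r - c| < e.

Lemma right_limitP f (c : R) : right_limit f c <-> f r @[r --> 0^'+] --> c.
Proof.
split=> [H|cf e e0].
  apply/cvgrPdist_lt => e e0; have [d d0 hd] := H e e0.
  apply/nbhs_ballP; exists d => // r; rewrite /ball /= sub0r normrN => rd r0.
  by rewrite distrC; apply: hd; rewrite r0 -(gtr0_norm r0).
have /cvgrPdist_lt/(_ e e0)/nbhs_ballP[d /= d0 hd] := cf.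
exists d => // r /andP[r0 rd]; rewrite distrC; apply: hd => //.
by rewrite /ball /= sub0r normrN gtr0_norm.
Qed.

Lemma even_ext_continuous0 c f : right_limit f c -> {for 0, continuous (even_ext c f)}.
Proof.
move=> H; apply/continuous_atP => e e0; have [d d0 hd] := H e e0; exists d => // s.
rewrite subr0 => sd; rewrite /even_ext eqxx; case: eqVneq => [_|s0].
  by rewrite subrr normr0.
by apply: hd; rewrite normr_gt0 s0.
Qed.

Lemma odd_ext_continuous0 f : right_limit f 0 -> {for 0, continuous (odd_ext f)}.
Proof.
move=> H; apply/continuous_atP => e e0; have [d d0 hd] := H e e0; exists d => // s.
rewrite subr0 => sd; rewrite /odd_ext sgr0 mul0r subr0; have [->|s0] := eqVneq s 0.
  by rewrite sgr0 mul0r normr0.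
have := hd `|s|; rewrite normr_gt0 s0 sd subr0 => /(_ isT).
by rewrite normrM normr_sg s0 mul1r.
Qed.

Lemma even_ext_near c f (s : R) : s != 0 ->
  \forall t \near s, f (Num.sg s * t + 0) = even_ext c f t.
Proof.
move=> s0; have [sp|sn] : 0 < s \/ s < 0 by apply/orP; rewrite -neq_lt eq_sym.
  have : \forall t \near s, 0 < t by exact: open_near (@open_gt _ 0) sp.
  by apply: filterS => t t0; rewrite /even_ext gt_eqF // gtr0_sg // mul1r addr0 gtr0_norm.
have : \forall t \near s, t < 0 by exact: open_near (@open_lt _ 0) sn.
by apply: filterS => t t0; rewrite /even_ext lt_eqF // ltr0_sg // mulN1r addr0 ltr0_norm.
Qed.

Lemma odd_ext_near f (s : R) : s != 0 ->
  \forall t \near s, Num.sg s * f (Num.sg s * t + 0) = odd_ext f t.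
Proof.
move=> s0; have [sp|sn] : 0 < s \/ s < 0 by apply/orP; rewrite -neq_lt eq_sym.
  have : \forall t \near s, 0 < t by exact: open_near (@open_gt _ 0) sp.
  by apply: filterS => t t0; rewrite /odd_ext !gtr0_sg // !mul1r addr0 gtr0_norm.
have : \forall t \near s, t < 0 by exact: open_near (@open_lt _ 0) sn.
by apply: filterS => t t0; rewrite /odd_ext !ltr0_sg // !mulN1r addr0 ltr0_norm.
Qed.

Lemma d_even_ext c f (s d : R) : s != 0 -> is_derive `|s| 1 f d ->
  is_derive s 1 (even_ext c f) (Num.sg s * d).
Proof.
move=> s0 D; apply: (near_eq_is_derive (even_ext_near c f s0)).
by apply: is_derive_affine; rewrite addr0 -normrEsg.
Qed.

Lemma d_odd_ext f (s d : R) : s != 0 -> is_derive `|s| 1 f d ->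
  is_derive s 1 (odd_ext f) d.
Proof.
move=> s0 D; apply: (near_eq_is_derive (odd_ext_near f s0)).
have D1 : is_derive (Num.sg s * s + 0) 1 f d by rewrite addr0 -normrEsg.
apply: d_eq (d_mul (d_cst (Num.sg s) s) (is_derive_affine D1)) _.
by rewrite mul0r add0r mulrA -expr2 sqr_sg s0 mul1r.
Qed.

End Averaging.

(** * Symmetries and gluing of curves *)

Section Curves.
Variable R : realType.
Implicit Types (x z u v : R -> R) (I J : set R).

Lemma ode_flip x z u v s : x s != 0 -> ode x z u v s ->
  ode (fun r => - x r) z (fun r => - u r) v s.
Proof.
move=> x0 [Dx Dz Du Dv].
have E : curvature (- x s) (z s) (- u s) (v s) = - curvature (x s) (z s) (u s) (v s).
  by rewrite /curvature invrN; ring.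
split => //.
- exact: d_opp.
- by rewrite E; apply: d_eq (d_opp Du) _; ring.
- by rewrite E; apply: d_eq Dv _; ring.
Qed.

Lemma sqr1_cases (k : R) : k ^+ 2 = 1 -> k = 1 \/ k = -1.
Proof.
move=> /eqP; rewrite -[X in _ == X](expr1n R 2) eqf_sqr => /orP[/eqP|/eqP]; first by left.
by right.
Qed.

Lemma affine_open (k c : R) I : open I -> open [set s | I (k * s + c)].
Proof.
move=> oI; apply: (@open_comp _ _ (fun s => k * s + c)) oI => s _.
by apply: (is_derive_continuous (d := k)); deriv; ring.
Qed.

Lemma affine_interval (k c : R) I : k ^+ 2 = 1 -> is_interval I ->
  is_interval [set s | I (k * s + c)].
Proof.
move=> /sqr1_cases[->|->] iI a b /= Ia Ib r /andP[ar rb].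
  by apply: (iI _ _ Ia Ib); rewrite !mul1r; lra.
by apply: (iI _ _ Ib Ia); rewrite !mulN1r; lra.
Qed.

Lemma curve_derive I x z : horo_shrinker_curve I x z ->
  (forall s : R, I s -> is_derive s 1 x (derive1 x s)) /\
  (forall s : R, I s -> is_derive s 1 z (derive1 z s)).
Proof.
by move=> [_ [sx sz] _ _ _]; split=> s Is; apply: derive1_is; [exact: (sx 0%N)|exact: (sz 0%N)].
Qed.

Lemma curve_class_C I x z : horo_shrinker_curve I x z ->
  forall n, class_C n I x /\ class_C n I z.
Proof.
by move=> [_ [/smooth_onP sx /smooth_onP sz] _ _ _] n.
Qed.

Lemma horo_curve_affine (k c : R) I x z : k ^+ 2 = 1 -> horo_shrinker_curve I x z ->
  horo_shrinker_curve [set s | I (k * s + c)] (fun s => x (k * s + c))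
    (fun s => z (k * s + c)).
Proof.
move=> k1 H; have [[oI iI [t It]] [sx sz] us zs _] := H.
have [Dx Dz] := curve_derive H; have cxz := curve_class_C H.
have oJ := affine_open (k := k) (c := c) oI.
apply: (@curve_of_ode _ _ _ _ (fun s => k * derive1 x (k * s + c))
  (fun s => k * derive1 z (k * s + c))) => //.
- exact: affine_interval.
- by exists (k * (t - c)); rewrite /= mulrA -expr2 k1 mul1r subrK.
- by move=> n; have [? _] := cxz n; exact: class_C_affine.
- by move=> n; have [_ ?] := cxz n; exact: class_C_affine.
- by move=> s /= Is; apply: is_derive_affine; exact: Dx.
- by move=> s /= Is; apply: is_derive_affine; exact: Dz.
- by move=> s /= Is; rewrite !exprMn k1 !mul1r; exact: us.
- by move=> s /= Is; exact: zs.
- by move=> s /= Is xs; apply: ode_affine k1 _; exact: horo_curve_ode H Is xs.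
Qed.

Lemma horo_curve_flip I x z : horo_shrinker_curve I x z ->
  horo_shrinker_curve I (fun s => - x s) z.
Proof.
move=> H; have [[oI iI I0] [sx sz] us zs _] := H.
have [Dx Dz] := curve_derive H; have cxz := curve_class_C H.
apply: (@curve_of_ode _ _ _ _ (fun s => - derive1 x s) (derive1 z)) => //.
- by move=> n; have [? _] := cxz n; exact: class_C_opp.
- by move=> n; have [_ ?] := cxz n.
- by move=> s Is; apply: d_opp; exact: Dx.
- by move=> s Is; rewrite sqrrN; exact: us.
- move=> s Is; rewrite oppr_eq0 => xs; apply: ode_flip => //.
  exact: horo_curve_ode H Is xs.
Qed.

Lemma maximal_affine (k c : R) I x z : k ^+ 2 = 1 -> maximal_curve I x z ->
  maximal_curve [set s | I (k * s + c)] (fun s => x (k * s + c))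
    (fun s => z (k * s + c)).
Proof.
move=> k1 [H M]; split; first exact: horo_curve_affine.
move=> J x' z' HJ sub ext s Js.
have kk t : k * (k * t + - (k * c)) + c = t.
  by rewrite mulrDr mulrN !mulrA -expr2 k1 !mul1r subrK.
have kk' t : k * (k * t + c) + - (k * c) = t.
  by rewrite mulrDr !mulrA -expr2 k1 !mul1r addrK.
apply: (M _ _ _ (horo_curve_affine (- (k * c)) k1 HJ)).
- by move=> t It; apply: sub; rewrite /= kk.
- move=> t It; have [|-> ->] := ext (k * t + - (k * c)); first by rewrite /= kk.
  by rewrite kk.
- by rewrite /= kk'.
Qed.

Lemma maximal_flip I x z : maximal_curve I x z -> maximal_curve I (fun s => - x s) z.
Proof.
move=> [H M]; split; first exact: horo_curve_flip.
move=> J x' z' HJ sub ext; apply: (M _ _ _ (horo_curve_flip HJ) sub) => s Is.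
by have [-> ->] := ext s Is; rewrite opprK.
Qed.

Definition glue I (f g : R -> R) (s : R) : R := if `[< I s >] then f s else g s.

Lemma glueE I f g s : I s -> glue I f g s = f s.
Proof. by move=> Is; rewrite /glue asboolT. Qed.

Lemma glueE' I J f g s : J s -> (forall r, I r -> J r -> f r = g r) -> glue I f g s = g s.
Proof. by move=> Js fg; rewrite /glue; case: asboolP => // Is; exact: fg. Qed.

Lemma ode_eq_on I x z u v x' z' u' v' s : open I -> I s ->
  (forall r, I r -> [/\ x r = x' r, z r = z' r, u r = u' r & v r = v' r]) ->
  ode x z u v s -> ode x' z' u' v' s.
Proof.
move=> oI Is E [Dx Dz Du Dv]; rewrite /ode; have [<- <- <- <-] := E s Is.
by split; [apply: is_derive_eq_on oI Is _ Dx|apply: is_derive_eq_on oI Is _ Dz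
  |apply: is_derive_eq_on oI Is _ Du|apply: is_derive_eq_on oI Is _ Dv] => r /E[].
Qed.

(** The common point p makes the union of the two domains an interval. *)
Lemma glue_curve I J x z x' z' (p : R) : horo_shrinker_curve I x z ->
  horo_shrinker_curve J x' z' -> I p -> J p ->
  (forall s, I s -> J s -> x s = x' s /\ z s = z' s) ->
  horo_shrinker_curve (I `|` J) (glue I x x') (glue I z z').
Proof.
move=> HI HJ Ip Jp ag.
have [[oI iI _] _ us zs _] := HI; have [[oJ iJ _] _ us' zs' _] := HJ.
have [Dx Dz] := curve_derive HI; have cI := curve_class_C HI.
have [Dx' Dz'] := curve_derive HJ; have cJ := curve_class_C HJ.
have agx r : I r -> J r -> x r = x' r by move=> a b; case: (ag r a b).
have agz r : I r -> J r -> z r = z' r by move=> a b; case: (ag r a b).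
have agd (f f' : R -> R) (s : R) : (forall r, I r -> J r -> f r = f' r) -> is_derive s 1 f (derive1 f s) ->
    I s -> J s -> derive1 f s = derive1 f' s.
  move=> E D Is Js; apply/esym/derive1_val.
  by apply: (is_derive_eq_on (openI oI oJ) _ _ D) => // r [/E].
have agu r : I r -> J r -> derive1 x r = derive1 x' r.
  by move=> a b; exact: agd agx (Dx r a) a b.
have agv r : I r -> J r -> derive1 z r = derive1 z' r.
  by move=> a b; exact: agd agz (Dz r a) a b.
have class f g n : class_C n I f -> class_C n J g -> (forall r, I r -> J r -> f r = g r) ->
    class_C n (I `|` J) (glue I f g).
  move=> cf cg fg.
  have c1 : class_C n I (glue I f g) by apply: class_C_eq cf => // s Is; rewrite glueE.
  have c2 : class_C n J (glue I f g) by apply: class_C_eq cg => // s Js; rewrite (@glueE' I J).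
  elim: n {cf cg} (glue I f g) c1 c2 => [|n IH] h /=.
    by move=> c1 c2 s [/c1|/c2].
  by move=> [d1 c1] [d2 c2]; split; [move=> s [/d1|/d2]|exact: IH].
have onI f g s : I s -> glue I f g s = f s by exact: glueE.
have onJ f g s : (forall r, I r -> J r -> f r = g r) -> J s -> glue I f g s = g s.
  by move=> E Js; exact: (@glueE' I J).
have der (f g f1 g1 : R -> R) (s : R) : (forall r, I r -> J r -> f r = g r) ->
    (forall r, I r -> J r -> f1 r = g1 r) ->
    (forall s : R, I s -> is_derive s 1 f (f1 s)) ->
    (forall s : R, J s -> is_derive s 1 g (g1 s)) -> (I `|` J) s ->
    is_derive s 1 (glue I f g) (glue I f1 g1 s).
  move=> E E1 D D' [Is|Js].
    by rewrite onI //; apply: is_derive_eq_on oI Is _ (D s Is) => r Ir; rewrite onI.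
  by rewrite onJ //; apply: is_derive_eq_on oJ Js _ (D' s Js) => r Jr; rewrite onJ.
apply: (@curve_of_ode _ _ _ _ (glue I (derive1 x) (derive1 x')) (glue I (derive1 z) (derive1 z'))).
- exact: openU.
- move=> a b ha hb r /andP[ar rb]; have [rp|pr] := leP r p.
    by case: ha => h; [left; apply: (iI a p)|right; apply: (iJ a p)] => //; rewrite ar.
  by case: hb => h; [left; apply: (iI p b)|right; apply: (iJ p b)] => //; rewrite ?(ltW pr).
- by exists p; left.
- by move=> n; apply: class => //; [case: (cI n)|case: (cJ n)].
- by move=> n; apply: class => //; [case: (cI n)|case: (cJ n)].
- by move=> s; exact: der.
- by move=> s; exact: der.
- by move=> s [Is|Js]; rewrite ?(onI _ _ _ Is) ?(onJ _ _ _ _ Js) //; [exact: us|exact: us'].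
- by move=> s [Is|Js]; rewrite ?(onI _ _ _ Is) ?(onJ _ _ _ _ Js) //; [exact: zs|exact: zs'].
- move=> s [Is|Js].
    rewrite onI // => xs; apply: ode_eq_on oI Is _ (horo_curve_ode HI Is xs) => r Ir.
    by rewrite !onI.
  rewrite onJ // => xs; apply: ode_eq_on oJ Js _ (horo_curve_ode HJ Js xs) => r Jr.
  by rewrite !onJ.
Qed.

(** * Extension across the axis *)

(** Half the curvature of the profile where its tangent is horizontal. *)
Definition slope_rate (z : R) : R := (1 - z) / z ^+ 2.

Lemma curvatureE (x z u v : R) : curvature x z u v = - v / x + 2 * u * slope_rate z.
Proof. by rewrite /curvature /slope_rate mulrA. Qed.

Lemma slope_rate_bound (m z : R) : 0 < m -> m <= z ->
  `|slope_rate z| <= 1 / m ^+ 2 + 1 / m.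
Proof.
move=> m0 mz; have z0 : 0 < z by exact: lt_le_trans mz.
have z0' : z != 0 by rewrite gt_eqF.
have -> : slope_rate z = z^-1 ^+ 2 - z^-1 by rewrite /slope_rate; field.
have iz : z^-1 <= m^-1 by rewrite lef_pV2 ?posrE.
have iz0 : 0 < z^-1 by rewrite invr_gt0.
rewrite !div1r -exprVn; apply: (le_trans (ler_normB _ _)).
rewrite (ger0_norm (exprn_ge0 2 (ltW iz0))) (ger0_norm (ltW iz0)) lerD //.
by rewrite expr2 [leRHS]expr2 ler_pM // ltW.
Qed.

Section AxisExtension.
(** A curve that ends at the axis at time 0. The term v / x is singular there. A
    comparison of x v with multiples of x^2 gives v = O(x), then the limit of
    v / x. Regularity of the extended curve is gained one derivative at a time:
    xi = x / s and g = x v / s^2 satisfy Euler equations whose right-hand sides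
    are as smooth as u, z and xi, and v / x = g / xi^2. *)
Variables (d m : R) (X Z U V : R -> R).
Hypotheses (d0 : 0 < d) (m0 : 0 < m).
Hypothesis H : profile [set s | 0 < s < d] X Z U V.
Hypothesis U0 : forall s, 0 < s < d -> 0 < U s.
Hypothesis Zm : forall s, 0 < s < d -> m <= Z s.
Hypothesis X0 : forall e, 0 < e -> exists2 s, 0 < s < d & X s < e.

Let K := 1 / m ^+ 2 + 1 / m.
Let K0 : 0 < K. Proof. by rewrite addr_gt0 // divr_gt0 ?exprn_gt0. Qed.

Let Xp s : 0 < s < d -> 0 < X s. Proof. by move=> /H[]. Qed.

Let U1 s : 0 < s < d -> U s <= 1.
Proof. by move=> /H[_ _ /unit_le1[h _] _]; exact: le_trans (ler_norm _) h. Qed.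

Let V1 s : 0 < s < d -> `|V s| <= 1.
Proof. by move=> /H[_ _ /unit_le1[_ h] _]. Qed.

Let X_lt r s : 0 < r -> r < s -> s < d -> X r < X s.
Proof.
move=> r0 rs sd; have sub t : r <= t <= s -> 0 < t < d.
  by move=> /andP[rt ts]; rewrite (lt_le_trans r0 rt) (le_lt_trans ts).
apply: (@deriv_gt0_lt _ X U r s rs).
- by move=> t /sub/H[_ _ _ [D _ _ _]]; exact: is_derive_continuous D.
- by move=> t /closed_itvW/sub/H[_ _ _ []].
- by move=> t /closed_itvW/sub; exact: U0.
Qed.

Lemma axis_x_limit : right_limit X 0.
Proof.
move=> e /X0[s /andP[s0 sd] Xs]; exists s => // r /andP[r0 rs].
rewrite subr0 gtr0_norm ?Xp ?r0 ?(lt_trans rs)//.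
by apply: lt_trans Xs; exact: X_lt.
Qed.

(** The derivative of X V is 2 X U (U slope_rate Z), that of c X^2 is 2 c X U, and
    both functions tend to 0 at the axis. The sign e gives the two inequalities
    at once. *)
Lemma axis_comparison (e c d' : R) : `|e| = 1 -> d' <= d ->
  (forall s, 0 < s < d' -> e * (U s * slope_rate (Z s)) <= c) ->
  forall s, 0 < s < d' -> e * (X s * V s) <= c * X s ^+ 2.
Proof.
move=> e1 d'd hc s /andP[s0 sd'].
have sub r : 0 < r -> r <= s -> 0 < r < d by move=> r0 rs; rewrite r0 (le_lt_trans rs)// (lt_le_trans sd').
rewrite -subr_le0; apply/ler_addgt0Pr => eta eta0; rewrite add0r.
have c1 : 0 < 1 + `|c| by rewrite ltr_pwDl.
have mu0 : 0 < Num.min 1 (eta / (1 + `|c|)) by rewrite lt_min ltr01 divr_gt0.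
have [r0 /andP[r00 r0d] Xr0] := X0 mu0.
pose r := Num.min r0 s.
have r_gt0 : 0 < r by rewrite lt_min r00.
have rs : r <= s by rewrite ge_min lexx orbT.
have Xr : X r < Num.min 1 (eta / (1 + `|c|)).
  apply: le_lt_trans Xr0; have : r <= r0 by rewrite ge_min lexx.
  by rewrite le_eqVlt => /predU1P[->//|h]; apply/ltW/X_lt.
have rd := sub r r_gt0 rs; have Xr_gt0 := Xp rd.
have h : e * (X s * V s) - c * X s ^+ 2 <= e * (X r * V r) - c * X r ^+ 2.
  rewrite -lerN2.
  apply: (@deriv_ge0_le _ (fun t => - (e * (X t * V t) - c * X t ^+ 2))
    (fun t => 2 * X t * U t * (c - e * (U t * slope_rate (Z t)))) _ _ rs) => t /andP[rt ts].
    have td := sub t (lt_le_trans r_gt0 rt) ts.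
    have [Xt Zt _ [DX DZ DU DV]] := H td; have Xt' : X t != 0 by rewrite gt_eqF.
    have D1 := d_mul (d_cst e t) (d_mul DX DV).
    have D2 := d_mul (d_cst c t) (d_exp 2 DX).
    apply: d_eq (d_opp (d_add D1 (d_opp D2))) _.
    by rewrite curvatureE /=; move: (slope_rate (Z t)) => w; field.
  have td := sub t (lt_le_trans r_gt0 rt) ts.
  rewrite !mulr_ge0 ?(ltW (Xp td)) ?(ltW (U0 td)) // subr_ge0 hc //.
  by rewrite (lt_le_trans r_gt0 rt) (le_lt_trans ts).
apply: (le_trans h).
have h1 : e * (X r * V r) <= X r.
  apply: (le_trans (ler_norm _)); rewrite normrM e1 mul1r normrM (gtr0_norm Xr_gt0).
  by rewrite ger_pMr // V1.
have h2 : - (c * X r ^+ 2) <= `|c| * X r.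
  rewrite -mulNr; apply: (@le_trans _ _ (`|c| * X r ^+ 2)).
    by rewrite ler_wpM2r ?sqr_ge0 // -normrN ler_norm.
  rewrite ler_wpM2l // expr2 ger_pMr // ltW //; apply: (lt_le_trans Xr).
  by rewrite ge_min lexx.
have h3 : (1 + `|c|) * X r <= eta.
  rewrite -ler_pdivlMl // ltW // (lt_le_trans Xr) // ge_min mulrC lexx orbT //.
by move: h3; rewrite mulrDl mul1r; lra.
Qed.

Lemma axis_v_bound s : 0 < s < d -> `|V s| <= K * X s.
Proof.
move=> sd; have Xs := Xp sd.
have hb (e : R) : `|e| = 1 -> forall r, 0 < r < d -> e * (U r * slope_rate (Z r)) <= K.
  move=> e1 r rd; apply: (le_trans (ler_norm _)); rewrite normrM e1 mul1r normrM.
  rewrite (gtr0_norm (U0 rd)); have := slope_rate_bound m0 (Zm rd); rewrite -/K => h.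
  by apply: le_trans h; rewrite ler_piMl // U1.
have h1 := @axis_comparison 1 K d (normr1 _) (lexx d) (hb 1 (normr1 _)) s sd.
have n1 : `|-1 : R| = 1 by rewrite normrN normr1.
have h2 := @axis_comparison (-1) K d n1 (lexx d) (hb (-1) n1) s sd.
rewrite ler_norml -(ler_pM2l Xs) -[X in _ && X](ler_pM2l Xs); move: h1 h2.
by rewrite mul1r mulN1r expr2; set p := X s * V s; nra.
Qed.

Lemma axis_v_limit : right_limit V 0.
Proof.
move=> e e0; have [r r0 hr] := axis_x_limit (divr_gt0 e0 K0).
exists (Num.min r d); first by rewrite lt_min r0.
move=> s /andP[s0]; rewrite lt_min => /andP[sr sd]; rewrite subr0.
have sd' : 0 < s < d by rewrite s0.
apply: (le_lt_trans (axis_v_bound sd')); rewrite mulrC -ltr_pdivlMr //.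
by have := hr s; rewrite s0 sr subr0 gtr0_norm ?Xp // => ->.
Qed.

Lemma axis_u_limit : right_limit U 1.
Proof.
move=> e e0; have [r r0 hr] := axis_v_limit e0.
exists (Num.min r d); first by rewrite lt_min r0.
move=> s /andP[s0]; rewrite lt_min => /andP[sr sd].
have sd' : 0 < s < d by rewrite s0.
have := hr s; rewrite s0 sr subr0 => /(_ isT) h.
rewrite distrC ger0_norm ?subr_ge0 ?U1 //; apply: le_lt_trans h.
have [_ _ uv _] := H sd'; have := V1 sd'; have := U0 sd'; have := U1 sd'.
have := normr_ge0 (V s); have : `|V s| ^+ 2 = V s ^+ 2 by rewrite real_normK // num_real.
by nra.
Qed.

(** As |V| <= 1, the function Z s + s is nondecreasing and bounded below. *)
Lemma axis_z_limit : exists2 c, m <= c & right_limit Z c.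
Proof.
pose E := [set y : R | exists2 r, 0 < r < d & y = Z r + r].
have mid : 0 < d / 2 < d by rewrite divr_gt0 //= ltr_pdivrMr // ltr_pMr // ltr1n.
have E0 : E !=set0 by exists (Z (d / 2) + d / 2); exists (d / 2).
have lbE : lbound E m.
  by move=> _ [r rd ->]; have := Zm rd; case/andP: rd => r0 _; lra.
have hi : has_inf E by split => //; exists m.
exists (inf E); first exact: lb_le_inf.
move=> e e0; have e2 : 0 < e / 2 by rewrite divr_gt0.
have [_ [r /andP[r0 rd] ->] hr] := inf_adherent e2 hi.
exists (Num.min r (e / 2)); first by rewrite lt_min r0.
move=> s /andP[s0]; rewrite lt_min => /andP[sr se].
have sd' : 0 < s < d by rewrite s0 (lt_trans sr).
have h1 : inf E <= Z s + s by apply: ge_inf; [exists m|exists s].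
have h2 : Z s + s <= Z r + r.
  apply: (@deriv_ge0_le _ (fun t => Z t + t) (fun t => V t + 1) _ _ (ltW sr)) => t /andP[st tr].
    have /H[_ _ _ [_ D _ _]] : 0 < t < d by rewrite (lt_le_trans s0 st) (le_lt_trans tr).
    exact: d_add D (d_id t).
  have /V1 : 0 < t < d by rewrite (lt_le_trans s0 st) (le_lt_trans tr).
  by rewrite ler_norml; lra.
by rewrite ltr_norml; lra.
Qed.

(** The comparison is made with the constants slope_rate c + e / 2 and
    slope_rate c - e / 2 on a short interval. *)
Lemma axis_w_limit c : m <= c -> right_limit Z c ->
  right_limit (fun s => V s / X s) (slope_rate c).
Proof.
move=> mc /right_limitP Zc.
have c0 : c != 0 by rewrite gt_eqF // (lt_le_trans m0).
have : right_limit (fun s => U s * slope_rate (Z s)) (slope_rate c).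
  apply/right_limitP; rewrite -[slope_rate c]mul1r; apply: cvgM.
    exact/right_limitP/axis_u_limit.
  apply: cvgM; first by apply: cvgB => //; exact: cvg_cst.
  apply: cvgV; first by rewrite expf_neq0.
  by rewrite expr2; under eq_fun do rewrite expr2; exact: cvgM.
move=> lim e e0; have e2 : 0 < e / 2 by rewrite divr_gt0.
have [r r0 hr] := lim (e / 2) e2.
exists (Num.min r d); first by rewrite lt_min r0.
have rd : Num.min r d <= d by rewrite ge_min lexx orbT.
have hs s : 0 < s < Num.min r d -> `|U s * slope_rate (Z s) - slope_rate c| < e / 2.
  by rewrite lt_min => /andP[s0 /andP[sr sd]]; apply: hr; rewrite s0.
move=> s sr; have sd : 0 < s < d by case/andP: sr => -> /lt_le_trans ->.
have Xs := Xp sd.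
have n1 : `|-1 : R| = 1 by rewrite normrN normr1.
have h1 := @axis_comparison 1 (slope_rate c + e / 2) _ (normr1 _) rd _ s sr.
have h2 := @axis_comparison (-1) (- slope_rate c + e / 2) _ n1 rd _ s sr.
have {}h1 : V s / X s <= slope_rate c + e / 2.
  rewrite ler_pdivrMr // -(ler_pM2l Xs); have -> : X s * ((slope_rate c + e / 2) * X s) = (slope_rate c + e / 2) * X s ^+ 2 by ring.
  rewrite -[leLHS]mul1r; apply: h1 => t /hs; rewrite ltr_norml; lra.
have {}h2 : slope_rate c - e / 2 <= V s / X s.
  rewrite ler_pdivlMr // -(ler_pM2l Xs) -lerN2.
  have -> : - (X s * ((slope_rate c - e / 2) * X s)) = (- slope_rate c + e / 2) * X s ^+ 2 by ring.
  rewrite -mulN1r; apply: h2 => t /hs; rewrite ltr_norml; lra.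
by rewrite ltr_norml; lra.
Qed.

Lemma axis_extension : exists x z, horo_shrinker_curve [set s | `|s| < d] x z /\
  forall s, 0 < s < d -> x s = X s /\ z s = Z s.
Proof.
have [c mc Zc] := axis_z_limit.
have Wc := axis_w_limit mc Zc.
have c0 : 0 < c by exact: lt_le_trans mc.
pose x := odd_ext X; pose z := even_ext c Z; pose u := even_ext 1 U; pose v := odd_ext V.
pose w := even_ext (slope_rate c) (fun r => V r / X r).
pose k s := - w s + 2 * u s * slope_rate (z s).
pose xi s := if s == 0 then 1 else x s / s.
pose g s := xi s * xi s * w s.
pose J : set R := [set s | `|s| < d].
have oJ : open J by apply: open_comp (@open_lt _ d) => s _; exact: norm_continuous.
have J0 : J 0 by rewrite /J /= normr0.
have iJ : is_interval J.
  move=> a b; rewrite /J /= !ltr_norml => /andP[a1 a2] /andP[b1 b2] r /andP[r1 r2].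
  by rewrite ltr_norml; apply/andP; split; [exact: lt_le_trans r1|exact: le_lt_trans b2].
have Jp s : J s -> s != 0 -> 0 < `|s| < d by move=> Js s0; rewrite normr_gt0 s0.
have xE s : x s = Num.sg s * X `|s| by [].
have vE s : v s = Num.sg s * V `|s| by [].
have zE s : s != 0 -> z s = Z `|s| by move=> s0; rewrite /z /even_ext (negbTE s0).
have uE s : s != 0 -> u s = U `|s| by move=> s0; rewrite /u /even_ext (negbTE s0).
have wE s : s != 0 -> w s = V `|s| / X `|s| by move=> s0; rewrite /w /even_ext (negbTE s0).
have x_neq0 s : J s -> s != 0 -> x s != 0.
  by move=> Js s0; rewrite xE mulf_neq0 ?sgr_eq0 ?(gt_eqF (Xp (Jp s Js s0))).
have vxE s : J s -> s != 0 -> v s / x s = w s.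
  move=> Js s0; rewrite vE xE wE //; have X0' := gt_eqF (Xp (Jp s Js s0)).
  have g0 : Num.sg s != 0 by rewrite sgr_eq0.
  by field; rewrite g0 X0'.
have kE s : J s -> s != 0 -> curvature (x s) (z s) (u s) (v s) = k s.
  by move=> Js s0; rewrite curvatureE mulNr vxE.
have kE' s : J s -> s != 0 -> curvature (X `|s|) (Z `|s|) (U `|s|) (V `|s|) = k s.
  by move=> Js s0; rewrite curvatureE mulNr -wE // -zE // -uE.
have D s : J s -> s != 0 -> [/\ is_derive s 1 x (u s), is_derive s 1 z (v s),
    is_derive s 1 u (- (v s * k s)) & is_derive s 1 v (u s * k s)].
  move=> Js s0; have [_ _ _ [DX DZ DU DV]] := H (Jp s Js s0).
  split.
  - by rewrite uE //; exact: d_odd_ext.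
  - exact: d_even_ext.
  - apply: d_eq (d_even_ext 1 s0 DU) _; rewrite kE' // vE; ring.
  - by apply: d_eq (d_odd_ext s0 DV) _; rewrite kE' // uE.
have cont0 f : {for 0, continuous f} -> (forall s, J s -> s != 0 -> exists e : R, is_derive s 1 f e) ->
    forall s, J s -> {for s, continuous f}.
  move=> cf df s Js; have [->//|s0] := eqVneq s 0.
  by have [e De] := df s Js s0; exact: is_derive_continuous De.
have cx : forall s, J s -> {for s, continuous x}.
  apply: cont0; first by apply: odd_ext_continuous0; exact: axis_x_limit.
  by move=> s Js s0; exists (u s); case: (D s Js s0).
have cz : forall s, J s -> {for s, continuous z}.
  apply: cont0; first exact: even_ext_continuous0.
  by move=> s Js s0; exists (v s); case: (D s Js s0).
have cu : forall s, J s -> {for s, continuous u}.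
  apply: cont0; first by apply: even_ext_continuous0; exact: axis_u_limit.
  by move=> s Js s0; exists (- (v s * k s)); case: (D s Js s0).
have cv : forall s, J s -> {for s, continuous v}.
  apply: cont0; first by apply: odd_ext_continuous0; exact: axis_v_limit.
  by move=> s Js s0; exists (u s * k s); case: (D s Js s0).
have cw : forall s, J s -> {for s, continuous w}.
  apply: cont0; first exact: even_ext_continuous0.
  move=> s Js s0; have [X1 _ _ [DX _ _ DV]] := H (Jp s Js s0).
  have X1' : X `|s| != 0 by rewrite gt_eqF.
  by eexists; exact: d_even_ext s0 (d_mul DV (d_inv X1' DX)).
have z_gt0 s : J s -> 0 < z s.
  move=> Js; have [->|s0] := eqVneq s 0; first by rewrite /z /even_ext eqxx.
  by rewrite zE //; case: (H (Jp s Js s0)).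
have z_neq0 s : J s -> z s != 0 by move=> Js; rewrite gt_eqF // z_gt0.
have srE : (fun s => slope_rate (z s)) = (fun s => (1 + - z s) * ((z s)^-1 * (z s)^-1)).
  by apply/funext => s; rewrite /slope_rate expr2 invfM.
have csr n : class_C n J z -> class_C n J (fun s => slope_rate (z s)).
  move=> h; have hi := class_C_inv oJ z_neq0 h.
  by rewrite srE; repeat class_C_step oJ.
have ck n : class_C n J z -> class_C n J u -> class_C n J w -> class_C n J k.
  move=> h1 h2 h3; have h4 := csr n h1.
  by rewrite /k; repeat class_C_step oJ.
have ckc : forall s, J s -> {for s, continuous k} by exact: (ck 0%N).
have w0 : w 0 = slope_rate c by rewrite /w /even_ext eqxx.
have z0 : z 0 = c by rewrite /z /even_ext eqxx.
have u0 : u 0 = 1 by rewrite /u /even_ext eqxx.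
have x0 : x 0 = 0 by rewrite /x /odd_ext sgr0 mul0r.
have v0 : v 0 = 0 by rewrite /v /odd_ext sgr0 mul0r.
have ext0 f (df : R -> R) : (forall s, J s -> {for s, continuous f}) ->
    (forall s, J s -> {for s, continuous df}) ->
    (forall s, J s -> s != 0 -> is_derive s 1 f (df s)) ->
    forall s, J s -> is_derive s 1 f (df s).
  move=> cf cdf Df s Js; have [->|s0] := eqVneq s 0; last exact: Df.
  exact: (deriv_extend d0 cf Df (cdf 0 J0)).
have Dx : forall s, J s -> is_derive s 1 x (u s).
  by apply: ext0 => // s Js s0; case: (D s Js s0).
have Dz : forall s, J s -> is_derive s 1 z (v s).
  by apply: ext0 => // s Js s0; case: (D s Js s0).
have Du : forall s, J s -> is_derive s 1 u (- (v s * k s)).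
  apply: (@ext0 _ (fun s => - (v s * k s))) => // [s Js|s Js s0]; last by case: (D s Js s0).
  by apply: cvgN; apply: cvgM; [exact: cv|exact: ckc].
have Dv : forall s, J s -> is_derive s 1 v (u s * k s).
  apply: (@ext0 _ (fun s => u s * k s)) => // [s Js|s Js s0]; last by case: (D s Js s0).
  by apply: cvgM; [exact: cu|exact: ckc].
have near_neq (s : R) : s != 0 -> \forall t \near s, t != 0.
  by move=> s0; exact: open_near (@open_neq _ 0) s0.
have xi0 : xi 0 = 1 by rewrite /xi eqxx.
have Dxi s : J s -> s != 0 -> is_derive s 1 xi ((u s - 1%:R * xi s) / s).
  move=> Js s0; apply: (near_eq_is_derive (f := fun t => x t * t^-1)).
    by apply: filterS (near_neq s s0) => t t0; rewrite /xi (negbTE t0).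
  apply: d_eq (d_mul (Dx s Js) (d_inv s0 (d_id s))) _.
  by rewrite /xi (negbTE s0) mul1r; field.
have cxi : forall s, J s -> {for s, continuous xi}.
  apply: cont0; last by move=> s Js s0; eexists; exact: Dxi.
  apply/continuous_atP => e e0; have e2 : 0 < e / 2 by rewrite divr_gt0.
  have [r r0 hr] := (is_derive0P _ _).1 (Dx 0 J0) _ e2; exists r => // s.
  rewrite subr0 xi0 => sr; rewrite /xi; have [_|s0] := eqVneq s 0; first by rewrite subrr normr0.
  have -> : x s / s - 1 = (x s - x 0 - u 0 * s) / s by rewrite x0 u0; field.
  rewrite normrM normfV ltr_pdivrMr ?normr_gt0 //; apply: (le_lt_trans (hr s sr)).
  by rewrite ltr_pM2r ?normr_gt0 //; lra.
have xi_neq0 s : J s -> xi s != 0.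
  move=> Js; rewrite /xi; have [_|s0] := eqVneq s 0; first exact: oner_neq0.
  by rewrite mulf_neq0 ?invr_eq0 // x_neq0.
have cg : forall s, J s -> {for s, continuous g}.
  move=> s Js.
  by apply: cvgM; [apply: cvgM; exact: cxi|exact: cw].
pose f s := xi s * (2 * (u s * u s) * slope_rate (z s)).
have g0 : 2%:R * g 0 = f 0 by rewrite /g /f xi0 w0 u0 z0; ring.
have Dg s : J s -> s != 0 -> is_derive s 1 g ((f s - 2%:R * g s) / s).
  move=> Js s0.
  have JJ : \forall t \near s, t != 0 /\ J t.
    by apply: filterS2 (near_neq s s0) (open_near oJ Js).
  apply: (near_eq_is_derive (f := fun t => x t * v t * (t^-1 * t^-1))).
    apply: filterS JJ => t [t0 Jt]; rewrite /g /xi (negbTE t0) -vxE //.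
    by have xt := x_neq0 t Jt t0; field; rewrite t0 xt.
  have xs := x_neq0 s Js s0; have di := d_inv s0 (d_id s).
  apply: d_eq (d_mul (d_mul (Dx s Js) (Dv s Js)) (d_mul di di)) _.
  rewrite /f /g /xi (negbTE s0) /k -vxE //; set h := slope_rate (z s).
  by field; rewrite s0 xs.
have class n : [/\ class_C n J x, class_C n J z, class_C n J u & class_C n J v].
  elim: n => [|n [hx hz hu hv]]; first by [].
  have hs := csr n hz.
  have hxi : class_C n J xi by apply: (@class_C_average _ n 0 J u xi) => //; rewrite xi0 mul1r.
  have hf : class_C n J f by rewrite /f; repeat class_C_step oJ.
  have hg : class_C n J g by exact: (@class_C_average _ n 1 J f g).
  have hw : class_C n J w.
    have hi := class_C_inv oJ xi_neq0 hxi.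
    apply: (@class_C_eq _ _ _ (fun s => g s * ((xi s)^-1 * (xi s)^-1))) => //.
      by move=> s Js; have := xi_neq0 s Js; rewrite /g => ?; field.
    by repeat class_C_step oJ.
  have hk := ck n hz hu hw.
  split.
  - exact: class_CS Dx hu.
  - exact: class_CS Dz hv.
  - by apply: (class_CS oJ Du); repeat class_C_step oJ.
  - by apply: (class_CS oJ Dv); repeat class_C_step oJ.
exists x, z; split; last first.
  move=> s /andP[s0 sd]; rewrite xE zE ?gt_eqF // gtr0_sg // mul1r gtr0_norm //.
apply: (@curve_of_ode _ J x z u v) => //.
- by exists 0.
- by move=> n; case: (class n).
- by move=> n; case: (class n).
- move=> s Js; have [->|s0] := eqVneq s 0; first by rewrite u0 v0 expr1n expr0n addr0.
  by rewrite uE // vE exprMn sqr_sg s0 mul1r; case: (H (Jp s Js s0)).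
- move=> s Js xs; have s0 : s != 0 by apply: contraNneq xs => ->; rewrite x0.
  by rewrite /ode kE //; exact: D.
Qed.

End AxisExtension.

(** With x1 = x s1, an upper bound of x, the equation gives u' >= 1 / x1 - L u for
    a constant L. So (u - c) e^(L s) increases for c = 1 / (L x1), and as it tends
    to 0 at -oo this means u >= c: x would become negative in finite time. *)
Lemma no_monotone_halfline (s1 m : R) x z u v : 0 < m ->
  profile [set s | s <= s1] x z u v -> (forall s, s <= s1 -> 0 < u s) ->
  (forall s, s <= s1 -> m <= z s) -> False.
Proof.
move=> m0 H u0 zm.
pose K := 1 / m ^+ 2 + 1 / m.
have K0 : 0 < K by rewrite addr_gt0 // divr_gt0 ?exprn_gt0.
have X0 : 0 < x s1 by case: (H s1 (lexx s1)).
pose L := 2 * K + 1 / x s1.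
have L0 : 0 < L by apply: addr_gt0; [exact: mulr_gt0|exact: divr_gt0].
pose c := 1 / (L * x s1).
have c0 : 0 < c by rewrite divr_gt0 ?mulr_gt0.
have Dx s : s <= s1 -> is_derive s 1 x (u s) by move=> /H[_ _ _ []].
have u1 s : s <= s1 -> u s <= 1.
  by move=> /H[_ _ /unit_le1[h _] _]; exact: le_trans (ler_norm _) h.
have xle s : s <= s1 -> x s <= x s1.
  move=> ss; apply: (@deriv_ge0_le _ x u _ _ ss) => r /andP[_ r1]; first exact: Dx.
  exact/ltW/u0.
have mono s s' : s <= s' -> s' <= s1 ->
    (u s - c) * expR (L * s) <= (u s' - c) * expR (L * s').
  move=> ss' s1'.
  apply: (@deriv_ge0_le _ (fun t => (u t - c) * expR (L * t))
    (fun t => (- (v t * curvature (x t) (z t) (u t) (v t)) + L * u t - L * c) * expR (L * t)) _ _ ss') => r /andP[_ rs].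
    have [_ _ _ [_ _ Du _]] := H r (le_trans rs s1').
    have D := d_mul (d_add Du (d_opp (d_cst c r))) (is_derive_exp_scale L r).
    by apply: d_eq D _; move: (expR _) (curvature _ _ _ _) => e k; ring.
  have r1 : r <= s1 := le_trans rs s1'.
  have [x0 z0 uv _] := H r r1; have ur := u0 r r1; have ur1 := u1 r r1.
  rewrite mulr_ge0 ?expR_ge0 //.
  have := slope_rate_bound m0 (zm r r1); rewrite -/K curvatureE.
  set w := slope_rate (z r); rewrite ler_norml => /andP[w1 w2].
  have [_ v1] := unit_le1 uv; move: v1; rewrite ler_norml => /andP[v1 v2].
  have -> : - (v r * (- v r / x r + 2 * u r * w)) = v r ^+ 2 / x r - 2 * u r * (v r * w).
    by field; rewrite gt_eqF.
  have h1 : v r ^+ 2 / x s1 <= v r ^+ 2 / x r.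
    by rewrite ler_wpM2l ?sqr_ge0 // lef_pV2 ?posrE // xle.
  have h2 : v r * w <= K by nra.
  have h3 : u r * (v r * w) <= u r * K by rewrite ler_wpM2l // ltW.
  have h4 : L * c = 1 / x s1 by rewrite /c; field; rewrite !gt_eqF.
  have h5 : v r ^+ 2 / x s1 = 1 / x s1 - u r ^+ 2 / x s1 by rewrite -uv; ring.
  have h6 : u r ^+ 2 / x s1 <= u r / x s1.
    rewrite ler_wpM2r ?invr_ge0 ?(ltW X0) //; by rewrite expr2 ler_piMl // ltW.
  have h7 : (2 * K + 1 / x s1) * u r = 2 * (u r * K) + u r / x s1 by ring.
  by rewrite h4 /L h7; lra.
have ulow s : s <= s1 -> c <= u s.
  move=> ss; rewrite leNgt; apply/negP => uc.
  pose e := (c - u s) * expR (L * s).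
  have e0 : 0 < e by rewrite mulr_gt0 ?expR_gt0 // subr_gt0.
  pose s' := Num.min s (- (c / e) / L).
  have hs' : s' <= s by rewrite ge_min lexx.
  have := mono s' s hs' ss; have -> : (u s - c) * expR (L * s) = - e by rewrite /e; ring.
  have us' := u0 s' (le_trans hs' ss).
  have ee := expR_gt0 (L * s').
  have h1 : expR (L * s') <= expR (- (c / e)).
    rewrite ler_expR -ler_pdivlMl //; rewrite /s' ge_min; apply/orP; right.
    by rewrite mulrC.
  have h2 : c / e < expR (c / e) by apply: lt_le_trans (expR_ge1Dx _); rewrite ltrDr.
  have ce : 0 < c / e by rewrite divr_gt0.
  have h3 : expR (- (c / e)) < e / c.
    by rewrite expRN -[e / c]invrK invf_div ltf_pV2 ?posrE ?expR_gt0.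
  have h4 : c * expR (L * s') < e.
    by rewrite mulrC -ltr_pdivlMr //; exact: le_lt_trans h1 h3.
  by nra.
pose s := s1 - x s1 / c.
have ss : s <= s1 by rewrite /s gerBl divr_ge0 ?(ltW X0) ?(ltW c0).
have : x s - c * s <= x s1 - c * s1.
  apply: (@deriv_ge0_le _ (fun t => x t - c * t) (fun t => u t - c) _ _ ss) => r /andP[_ r1].
    by apply: d_eq (d_add (Dx r r1) (d_opp (d_mul (d_cst c r) (d_id r)))) _; ring.
  by rewrite subr_ge0 ulow.
have -> : c * s = c * s1 - x s1 by rewrite /s; field; rewrite gt_eqF.
by have [xs _ _ _] := H s ss; lra.
Qed.

Lemma open_inf_notin I : open I -> has_lbound I -> ~ I (inf I).
Proof.
move=> oI lI Ia; have /nbhs_ballP[e /= e0 he] := open_near oI Ia.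
have : I (inf I - e / 2).
  by apply: he; rewrite /ball /= opprB addrC subrK gtr0_norm ?divr_gt0 //; lra.
move=> /(ge_inf lI); have : 0 < e / 2 by rewrite divr_gt0.
by lra.
Qed.

(** The backward end al of the domain is finite. If x stays away from 0 there, a
    truncated solution started backwards at s1 continues past al; if not, x
    tends to 0 and the curve continues across the axis. *)
Theorem no_monotone_maximal (s1 m : R) I x z : maximal_curve I x z ->
  (forall s, I s -> 0 < x s) -> (forall s, I s -> 0 < derive1 x s) ->
  0 < m -> I s1 -> (forall s, I s -> s <= s1 -> m <= z s) -> False.
Proof.
move=> [HI M] xp up m0 I1 zm.
have P := profile_of_curve HI xp; have [[oI iI _] _ _ _ _] := HI.
set u := derive1 x in P up *; set v := derive1 z in P.
have [lI|nlI] := pselect (has_lbound I); last first.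
  have sub s : s <= s1 -> I s.
    move=> ss; apply: contrapT => nIs; apply: nlI; exists s => t It.
    by rewrite leNgt; apply/negP => ts; apply: nIs; apply: (iI t s1) => //; rewrite (ltW ts).
  apply: (@no_monotone_halfline s1 m x z u v m0) => [s /sub|s /sub/up|s ss] //.
    exact: P.
  exact: zm (sub s ss) ss.
have hI : has_inf I by split => //; exists s1.
set al := inf I; have nal : ~ I al by exact: open_inf_notin.
have al_lt s : I s -> al < s.
  by move=> Is; rewrite lt_neqAle ge_inf // andbT; apply/eqP => E; apply: nal; rewrite E.
have sub s : al < s -> s <= s1 -> I s.
  move=> als ss; have [t It ts] := inf_lt (ex_intro _ s1 I1) als.
  by apply: (iI t s1) => //; rewrite (ltW ts).
pose T := s1 - al; have T0 : 0 < T by rewrite subr_gt0 al_lt.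
pose p := (al + s1) / 2; have [ap ps] : al < p /\ p < s1.
  by have := al_lt s1 I1; rewrite /p; split; lra.
have Ip : I p by apply: sub => //; exact: ltW.
have fin J x' z' : horo_shrinker_curve J x' z' -> J p -> J al ->
    (forall s, I s -> J s -> x s = x' s /\ z s = z' s) -> False.
  move=> HJ Jp Ja ag; apply: nal.
  apply: (M _ _ _ (glue_curve HI HJ Ip Jp ag)).
  - by move=> s Is; left.
  - by move=> s Is; rewrite !glueE.
  - by right.
have [[a a0 xa]|na] := pselect (exists2 a, 0 < a & forall s, al < s -> s <= s1 -> a <= x s).
  (* x is bounded below: the box (a / 2, m / 2) is not left at al. *)
  have a2 : 0 < a / 2 by rewrite divr_gt0.
  have m2 : 0 < m / 2 by rewrite divr_gt0.
  have [Y1 [Y2 [Y3 [Y4 [e1 e2 e3 e4 DY]]]]] := @trunc_exists _ (a / 2) (m / 2) (x s1) (z s1) (-1 * u s1) (-1 * v s1) a2 m2.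
  have k1 : (-1 : R) ^+ 2 = 1 by rewrite sqrrN expr1n.
  have mI r : 0 <= r < T -> al < -1 * r + s1 <= s1.
    by rewrite /T => /andP[r0 rT]; rewrite mulN1r; apply/andP; split; lra.
  have Py : profile [set r | 0 <= r < T] (fun r => x (-1 * r + s1)) (fun r => z (-1 * r + s1))
      (fun r => -1 * u (-1 * r + s1)) (fun r => -1 * v (-1 * r + s1)).
    apply: profile_subset (profile_affine k1 P) => r /mI/andP[h1 h2]; exact: sub.
  have ybox r : 0 <= r < T -> [/\ a <= x (-1 * r + s1), m <= z (-1 * r + s1),
      `|-1 * u (-1 * r + s1)| <= 1 & `|-1 * v (-1 * r + s1)| <= 1].
    move=> rT; have [_ _ /unit_le1[h1 h2] _] := Py r rT; have /andP[h3 h4] := mI r rT.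
    by split => //; [exact: xa|apply: zm => //; exact: sub].
  have ag r : 0 <= r < T -> [/\ Y1 r = x (-1 * r + s1), Y2 r = z (-1 * r + s1),
      Y3 r = -1 * u (-1 * r + s1) & Y4 r = -1 * v (-1 * r + s1)].
    move=> /andP[r0 rT]; apply: (@trunc_unique _ (a / 2) (m / 2) r Y1 Y2 Y3 Y4 (fun r => x (-1 * r + s1))
      (fun r => z (-1 * r + s1)) (fun r => -1 * u (-1 * r + s1)) (fun r => -1 * v (-1 * r + s1))
      a2 m2 r0) => [|//|t /andP[t0 tr]].
      by rewrite e1 e2 e3 e4 mulr0 add0r.
    have tT : 0 <= t < T by rewrite t0 (le_lt_trans tr).
    have [b1 b2 b3 b4] := ybox t tT; have [_ _ _ D] := Py t tT.
    have n2 : (1 : R) <= 2 by rewrite ler1n.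
    by apply/trunc_odeE => //; split; [lra|lra|exact: le_trans n2|exact: le_trans n2].
  have oB := open_box DY.
  have [D1 D2 D3 D4] := DY T.
  have /(open_near oB) /nbhs_ballP[e /= e0 he] :
      [set s | [/\ a / 2 < Y1 s, m / 2 < Y2 s, `|Y3 s| < 2 & `|Y4 s| < 2]] T.
    split.
    - apply: (@lt_le_trans _ _ a); first by lra.
      apply: (limit_ge T0 (is_derive_continuous D1)) => r rT.
      by have [-> _ _ _] := ag r rT; case: (ybox r rT).
    - apply: (@lt_le_trans _ _ m); first by lra.
      apply: (limit_ge T0 (is_derive_continuous D2)) => r rT.
      by have [_ -> _ _] := ag r rT; case: (ybox r rT).
    - have : -1 <= - `|Y3 T|.
        apply: (@limit_ge _ (fun s => - `|Y3 s|) T) => //.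
          by apply: cvgN; apply: cvg_norm; exact: is_derive_continuous D3.
        by move=> r rT; have [_ _ -> _] := ag r rT; case: (ybox r rT) => _ _; lra.
      by lra.
    - have : -1 <= - `|Y4 T|.
        apply: (@limit_ge _ (fun s => - `|Y4 s|) T) => //.
          by apply: cvgN; apply: cvg_norm; exact: is_derive_continuous D4.
        by move=> r rT; have [_ _ _ ->] := ag r rT; case: (ybox r rT) => _ _ _; lra.
      by lra.
  have YB r : 0 <= r < T + e -> in_box (a / 2) (m / 2) (Y1 r) (Y2 r) (Y3 r) (Y4 r).
    move=> /andP[r0 rT]; have [h|h] := ltP r T.
      have rT' : 0 <= r < T by rewrite r0.
      have [-> -> -> ->] := ag r rT'; have [b1 b2 b3 b4] := ybox r rT'.
      have n2 : (1 : R) <= 2 by rewrite ler1n.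
      by split; [lra|lra|exact: le_trans n2|exact: le_trans n2].
    have [|h1 h2 h3 h4] := he r.
      by rewrite /ball /= ler0_norm ?subr_le0 // opprB; lra.
    by split; exact: ltW.
  have uv0 : Y3 0 ^+ 2 + Y4 0 ^+ 2 = 1.
    by rewrite e3 e4 !exprMn k1 !mul1r; case: (P s1 I1).
  have PY := trunc_profile a2 m2 uv0 (fun s _ => DY s) YB.
  pose J : set R := [set` `]al - e, s1[].
  have PJ : profile J (fun r => Y1 (-1 * r + s1)) (fun r => Y2 (-1 * r + s1))
      (fun r => -1 * Y3 (-1 * r + s1)) (fun r => -1 * Y4 (-1 * r + s1)).
    apply: profile_subset (profile_affine k1 PY) => r; rewrite /J /= in_itv /= => /andP[h1 h2].
    by rewrite mulN1r /T; apply/andP; split; lra.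
  have Jp : J p by rewrite /J /= in_itv /= ps andbT; lra.
  have HJ : horo_shrinker_curve J (fun r => Y1 (-1 * r + s1)) (fun r => Y2 (-1 * r + s1)).
    apply: curve_of_profile PJ; [exact: interval_open|exact: interval_is_interval|by exists p].
  apply: (fin _ _ _ HJ Jp).
    by rewrite /J /= in_itv /=; apply/andP; split; [lra|exact: al_lt].
  move=> s Is; rewrite /J /= in_itv /= => /andP[_ ss].
  have rT : 0 <= -1 * s + s1 < T.
    by have := al_lt s Is; rewrite mulN1r /T => ?; apply/andP; split; lra.
  have [-> -> _ _] := ag _ rT.
  by have -> : -1 * (-1 * s + s1) + s1 = s by ring.
(* x is not bounded below: after a translation the curve ends at the axis at 0. *)
have small e : 0 < e -> exists2 s, 0 < s < T & x (1 * s + al) < e.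
  move=> e0; apply: contrapT => ns; apply: na; exists (Num.min e (x s1)).
    by rewrite lt_min e0 xp.
  move=> s als; rewrite le_eqVlt => /predU1P[->|ss]; first by rewrite ge_min lexx orbT.
  rewrite ge_min leNgt; apply/orP; left; apply/negP => xe; apply: ns; exists (s - al).
    by rewrite /T; apply/andP; split; lra.
  by rewrite mul1r subrK.
have k1 : (1 : R) ^+ 2 = 1 by rewrite expr1n.
have mI r : 0 < r < T -> al < 1 * r + al <= s1.
  by rewrite /T mul1r => /andP[r0 rT]; apply/andP; split; lra.
have PX : profile [set r | 0 < r < T] (fun r => x (1 * r + al)) (fun r => z (1 * r + al))
    (fun r => 1 * u (1 * r + al)) (fun r => 1 * v (1 * r + al)).
  by apply: profile_subset (profile_affine k1 P) => r /mI/andP[h1 h2]; exact: sub.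
have [||x' [z' [HJ ag]]] := axis_extension T0 m0 PX _ _ small.
- by move=> s /mI/andP[h1 h2]; rewrite mul1r; apply: up; exact: sub.
- by move=> s /mI/andP[h1 h2]; apply: zm => //; exact: sub.
apply: (fin _ _ _ (horo_curve_affine (- al) k1 HJ)) => /=.
- by rewrite mul1r gtr0_norm ?subr_gt0 // /T ltrD2r.
- by rewrite mul1r subrr normr0.
- move=> s Is; rewrite mul1r => sT.
  have als := al_lt s Is; have [|-> ->] := ag (s - al).
    by rewrite subr_gt0 als -[ltLHS](gtr0_norm (_ : 0 < s - al)) ?subr_gt0.
  by rewrite mul1r subrK.
Qed.

End Curves.

(** * The two ends of a profile *)

Section Branch.
Variable R : realType.
Variables (x z u v : R -> R).
Hypotheses (H : profile setT x z u v) (u0 : u 0 = 0).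

Lemma setT_interval : is_interval [set: R].
Proof. by []. Qed.

Let iT := setT_interval.

Lemma branch_ode s : ode x z u v s. Proof. by case: (H (s := s) I). Qed.
Lemma branch_x0 s : 0 < x s. Proof. by case: (H (s := s) I). Qed.
Lemma branch_z0 s : 0 < z s. Proof. by case: (H (s := s) I). Qed.
Lemma branch_unit s : u s ^+ 2 + v s ^+ 2 = 1. Proof. by case: (H (s := s) I). Qed.

Let Dx (s : R) : is_derive s 1 x (u s). Proof. by case: (branch_ode s). Qed.
Let Dz (s : R) : is_derive s 1 z (v s). Proof. by case: (branch_ode s). Qed.
Let cx (s : R) : {for s, continuous x}. Proof. exact: is_derive_continuous (Dx s). Qed.
Let cz (s : R) : {for s, continuous z}. Proof. exact: is_derive_continuous (Dz s). Qed.

Lemma branch_u_gt0 s : 0 < s -> 0 < u s.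
Proof. by move=> s0; exact: (u_gt0 iT I H u0). Qed.

Lemma branch_u_le1 s : u s <= 1.
Proof. by have [h _] := unit_le1 (branch_unit s); exact: le_trans (ler_norm _) h. Qed.

Lemma branch_x_lt s s' : 0 <= s -> s < s' -> x s < x s'.
Proof. exact: (x_lt iT I H u0). Qed.

Lemma branch_x_ltE s s' : 0 <= s -> 0 <= s' -> (x s < x s') = (s < s').
Proof.
move=> s0 s'0; apply/idP/idP; last exact: branch_x_lt.
rewrite ltNge => h; rewrite ltNge; apply: contra h.
by rewrite le_eqVlt => /predU1P[->//|/(branch_x_lt s'0)/ltW].
Qed.

Lemma branch_x_inj s s' : 0 <= s -> 0 <= s' -> x s = x s' -> s = s'.
Proof.
move=> s0 s'0 E; have [ss'|s's|//] := ltgtP s s'.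
  by have := branch_x_lt s0 ss'; rewrite E ltxx.
by have := branch_x_lt s'0 s's; rewrite E ltxx.
Qed.

Lemma branch_bounds : exists c q : R, [/\ 0 < c, 0 < q &
  forall s, 1 <= s -> c <= u s /\ q * z s ^+ 2 <= 1].
Proof.
pose q := u 1 * weight (z 1).
have bnd s : 1 <= s -> [/\ 0 < q, 8 / 27 * q <= z s, q * z s ^+ 2 <= 1 & q * z s ^+ 2 <= u s].
  by move=> s1; exact: (energy_bounds iT I H u0 I ltr01 I s1).
have [q0 _ _ _] := bnd 1 (lexx 1).
exists (q * (8 / 27 * q) ^+ 2), q; split => // [|s /bnd[_ h1 h2 h3]].
  by rewrite mulr_gt0 // exprn_gt0 // mulr_gt0.
split => //; apply: le_trans h3; rewrite ler_pM2l //.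
by rewrite lerXn2r // nnegrE ?(ltW (branch_z0 s)) // mulr_ge0 ?(ltW q0).
Qed.

Lemma branch_x_unbounded (A : R) : exists2 s0, 0 <= s0 & forall s, s0 <= s -> A <= x s.
Proof.
have [c [q [c0 _ hc]]] := branch_bounds.
exists (Num.max 1 (1 + A / c)); first by rewrite le_max ler01.
move=> s; rewrite ge_max => /andP[s1 sA].
have : x 1 - c * 1 <= x s - c * s.
  apply: (@deriv_ge0_le _ (fun t => x t - c * t) (fun t => u t - c) _ _ s1) => r /andP[r1 _].
    by apply: d_eq (d_add (Dx r) (d_opp (d_mul (d_cst c r) (d_id r)))) _; ring.
  by rewrite subr_ge0; case: (hc r r1).
have h : A <= c * (s - 1) by rewrite mulrC -ler_pdivrMr //; lra.
by have := branch_x0 1; lra.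
Qed.

Lemma branch_inverse : exists sg : R -> R, forall r, x 0 <= r -> 0 <= sg r /\ x (sg r) = r.
Proof.
suff /choice[sg Hsg] : forall r, exists s, x 0 <= r -> 0 <= s /\ x s = r by exists sg.
move=> r; have [rx|_] := leP (x 0) r; last by exists 0.
have [s s0 hs] := branch_x_unbounded r.
have xs : r <= x s by exact: hs.
have cxs : {within `[0, s], continuous x} by apply: within_continuous => t _; exact: cx.
have [|t] := @IVT _ x 0 s r s0 cxs.
  by rewrite ge_min rx le_max xs orbT.
by rewrite in_itv /= => /andP[t0 _] xt; exists t.
Qed.

(** * Oscillation *)

(** A curve tangent to z = 1 at time t is that horosphere by uniqueness. The
    comparison line x t + (s - t) leaves x > 0 at some point, so one can only go
    back a fixed amount x 0 / 2 of time, hence the induction: at s = 0 the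
    tangent would be horizontal. *)
Lemma not_horosphere : v 0 != 0 -> forall n (t : R), 0 <= t -> t <= n%:R * (x 0 / 2) ->
  v t = 0 -> z t = 1 -> False.
Proof.
move=> v0; have x0 := branch_x0 0; elim=> [|n IH] t t0.
  rewrite mul0r => t0' vt _; have E : t = 0 by apply/eqP; rewrite eq_le t0'.
  by rewrite E in vt; move: v0; rewrite vt eqxx.
move=> tn vt zt.
move: t0; rewrite le_eqVlt => /predU1P[t00|t0].
  by rewrite -t00 in vt; move: v0; rewrite vt eqxx.
have ut : u t = 1.
  have := branch_unit t; rewrite vt expr0n addr0 => /eqP; rewrite sqrf_eq1.
  by move=> /orP[/eqP//|/eqP E]; have := branch_u_gt0 t0; rewrite E ltr0N1.
pose J : set R := [set s | t - x 0 < s].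
have iJ : is_interval J.
  by move=> a b /= Ja _ r /andP[ar _]; exact: lt_le_trans ar.
have xt : x 0 <= x t by apply/ltW/branch_x_lt.
have PJ : profile J (fun s => x t + (s - t)) (fun=> 1) (fun=> 1) (fun=> 0).
  move=> s; rewrite /J /= => Js; split; rewrite ?expr1n ?expr0n ?addr0 //; first by lra.
  have k0 : curvature (x t + (s - t)) 1 1 0 = 0 by rewrite /curvature; ring.
  rewrite /ode k0 !mulr0 oppr0; split; [|exact: d_cst|exact: d_cst|exact: d_cst].
  by apply: d_eq (d_add (d_cst (x t) s) (d_add (d_id s) (d_cst (- t) s))) _; ring.
have PJ' : profile J x z u v by apply: profile_subset H.
pose t' := Num.max 0 (t - x 0 / 2).
have t't : t' <= t by rewrite ge_max (ltW t0) gerBl divr_ge0 // ltW.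
have Jt : J t by rewrite /J /= gtrBl.
have Jt' : J t' by rewrite /J /= lt_max; apply/orP; right; lra.
have [|_ zt' _ vt'] := profile_unique iJ Jt Jt' _ PJ' PJ.
  by rewrite subrr addr0.
apply: (IH t') => //; first by rewrite le_max lexx.
rewrite ge_max mulr_ge0 ?divr_ge0 ?(ltW x0) //=.
by move: tn; rewrite -natr1 mulrDl mul1r; lra.
Qed.

(** Assume that z stays on the side of 1 given by - e after time S. Then e x v is
    nondecreasing. If it becomes positive, e z grows at least like log x, which
    contradicts e z <= e. Otherwise e z is nonincreasing; then either it is below
    e from some time on, and the derivative of e x v is bounded below by a
    positive constant, or z = 1. *)
Lemma crosses_one (e : R) : e ^+ 2 = 1 -> v 0 != 0 ->
  forall S, exists2 s, S < s & 0 < e * (z s - 1).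
Proof.
move=> e1 v0 S0; apply: contrapT => nex.
pose S := Num.max S0 1.
have S1 : 1 <= S by rewrite le_max lexx orbT.
have zle s : S < s -> e * (z s - 1) <= 0.
  move=> Ss; rewrite leNgt; apply/negP => h; apply: nex; exists s => //.
  by apply: le_lt_trans Ss; rewrite le_max lexx.
have [c [q [c0 q0 hcq]]] := branch_bounds.
pose p s := e * (x s * v s).
have Dp (s : R) : is_derive s 1 p (2 * x s * u s ^+ 2 * (- (e * (z s - 1)) / z s ^+ 2)).
  have [_ _ _ Dv] := branch_ode s.
  apply: d_eq (d_mul (d_cst e s) (d_mul (Dx s) Dv)) _.
  rewrite /curvature; have := branch_x0 s; have := branch_z0 s => zs xs.
  by field; rewrite !gt_eqF.
have dp_ge0 s : S < s -> 0 <= 2 * x s * u s ^+ 2 * (- (e * (z s - 1)) / z s ^+ 2).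
  move=> Ss; apply: mulr_ge0; last by rewrite divr_ge0 ?sqr_ge0 // oppr_ge0 zle.
  by apply: mulr_ge0 (sqr_ge0 _); rewrite mulr_ge0 // ltW // branch_x0.
have pmono s s' : S < s -> s <= s' -> p s <= p s'.
  move=> Ss ss'; apply: (@deriv_ge0_le _ p _ _ _ ss' (fun r _ => Dp r)) => r /andP[sr _].
  by apply: dp_ge0; exact: lt_le_trans sr.
have Dez (s : R) : is_derive s 1 (fun t => e * z t) (e * v s).
  by apply: d_eq (d_mul (d_cst e s) (Dz s)) _; ring.
have [[s1 Ss1 ps1]|nps] := pselect (exists2 s1, S < s1 & 0 < p s1).
  pose k := p s1.
  have [s0 s00 hs] := branch_x_unbounded (expR ((e - e * z s1) / k + ln (x s1) + 1)).
  pose s := Num.max s0 s1.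
  have s1s : s1 <= s by rewrite le_max lexx orbT.
  have := @deriv_ge0_le _ (fun t => e * z t - k * ln (x t))
    (fun t => e * v t - k * (u t / x t)) s1 s s1s.
  have D r : s1 <= r <= s -> is_derive r 1 (fun t => e * z t - k * ln (x t)) (e * v r - k * (u r / x r)).
    move=> _; have xr := branch_x0 r.
    have Dl : is_derive r 1 (fun t => ln (x t)) (u r / x r).
      by rewrite mulrC; apply: d_comp (Dx r); exact: is_derive1_ln.
    have Dk : is_derive r 1 (fun t => k * ln (x t)) (k * (u r / x r)).
      by apply: d_eq (d_mul (d_cst k r) Dl) _; ring.
    exact: d_add (Dez r) (d_opp Dk).
  move=> /(_ D) h.
  have {}h : e * z s1 - k * ln (x s1) <= e * z s - k * ln (x s).
    apply: h => r /andP[sr _]; have xr := branch_x0 r.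
    have pk : k <= p r by exact: pmono.
    have := branch_u_le1 r => u1.
    have -> : e * v r = p r / x r by rewrite /p; field; rewrite gt_eqF.
    rewrite mulrA -mulrBl mulr_ge0 ?invr_ge0 ?(ltW xr) // subr_ge0.
    by apply: le_trans pk; rewrite ler_piMr // ltW.
  have hl : (e - e * z s1) / k + ln (x s1) + 1 <= ln (x s).
    have := hs s; rewrite le_max lexx => /(_ isT).
    by rewrite -ler_ln ?posrE ?expR_gt0 ?branch_x0 // expRK.
  have h2 : e * z s <= e.
    have := zle s (lt_le_trans Ss1 s1s); rewrite mulrBr mulr1 subr_le0 //.
  have k0 : 0 < k by [].
  have h3 : k * ((e - e * z s1) / k + ln (x s1) + 1) <= k * ln (x s) by rewrite ler_pM2l.
  have h4 : k * ((e - e * z s1) / k + ln (x s1) + 1) = e - e * z s1 + k * ln (x s1) + k.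
    by field; rewrite gt_eqF.
  by rewrite h4 in h3; lra.
have pneg s : S < s -> p s <= 0.
  by move=> Ss; rewrite leNgt; apply/negP => h; apply: nps; exists s.
have evneg s : S < s -> e * v s <= 0.
  move=> /pneg; rewrite /p mulrCA pmulr_rle0 //; exact: branch_x0.
have zmono s s' : S < s -> s <= s' -> e * z s' <= e * z s.
  move=> Ss ss'; rewrite -lerN2.
  apply: (@deriv_ge0_le _ (fun t => - (e * z t)) (fun t => - (e * v t)) _ _ ss' (fun r _ => d_opp (Dez r))) => r /andP[sr _].
  by rewrite oppr_ge0 evneg // (lt_le_trans Ss).
have [[s1 Ss1 zs1]|nz] := pselect (exists2 s1, S < s1 & e * (z s1 - 1) < 0).
  pose eta := - (e * (z s1 - 1)); have eta0 : 0 < eta by rewrite oppr_gt0.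
  pose k := 2 * x 0 * c ^+ 2 * (eta * q).
  have k0 : 0 < k by rewrite !mulr_gt0 ?exprn_gt0 ?branch_x0.
  pose s := s1 + (1 - p s1) / k.
  have p1 := pneg s1 Ss1.
  have s1s : s1 <= s by rewrite /s lerDl divr_ge0 ?(ltW k0) //; lra.
  have : p s1 - k * s1 <= p s - k * s.
    apply: (@deriv_ge0_le _ (fun t => p t - k * t)
      (fun t => 2 * x t * u t ^+ 2 * (- (e * (z t - 1)) / z t ^+ 2) - k) _ _ s1s) => r /andP[sr _].
      by apply: d_eq (d_add (Dp r) (d_opp (d_mul (d_cst k r) (d_id r)))) _; ring.
    have Sr := lt_le_trans Ss1 sr; have r1 : 1 <= r by apply/ltW; exact: le_lt_trans Sr.
    have [ur qz] := hcq r r1; have zr := branch_z0 r.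
    have x0r : x 0 <= x r by apply/ltW/branch_x_lt => //; exact: lt_le_trans r1.
    have er : eta <= - (e * (z r - 1)).
      by have := zmono s1 r Ss1 sr; rewrite /eta !mulrBr mulr1; lra.
    rewrite subr_ge0 /k; apply: ler_pM.
    - by apply: mulr_ge0 (sqr_ge0 _); rewrite mulr_ge0 // ltW // branch_x0.
    - by apply: mulr_ge0; exact: ltW.
    - apply: ler_pM; [|exact: sqr_ge0|by rewrite ler_pM2l|].
        by rewrite mulr_ge0 // ltW // branch_x0.
      by rewrite lerXn2r ?nnegrE ?(ltW c0) // (le_trans _ ur) // ltW.
    - apply: ler_pM; [exact: ltW|exact: ltW|exact: er|].
      by rewrite -[leRHS]mul1r ler_pdivlMr ?exprn_gt0.
  have -> : k * s = k * s1 + (1 - p s1) by rewrite /s; field; rewrite gt_eqF.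
  by have := pneg s (lt_le_trans Ss1 s1s); lra.
have z1 s : S < s -> z s = 1.
  move=> Ss; apply/eqP; rewrite -subr_eq0; have e0 : e != 0.
    by apply/eqP => E; move: e1; rewrite E expr0n /= => /eqP; rewrite eq_sym oner_eq0.
  apply/eqP; apply: (mulfI e0); rewrite mulr0; apply/eqP; rewrite eq_le zle //= leNgt.
  by apply/negP => h; apply: nz; exists s.
pose t := S + 1.
have St : S < t by rewrite ltrDl.
have vt : v t = 0.
  rewrite -(derive1_val (Dz t)).
  apply: derive1_val; apply: (is_derive_eq_on (@open_gt _ S) St _ (d_cst 1 t)) => r /= Sr.
  by rewrite z1.
have x0 := branch_x0 0.
have t0 : 0 <= t by lra.
have [n tn] : exists n : nat, t <= n%:R * (x 0 / 2).
  exists (Num.trunc (t / (x 0 / 2))).+1.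
  by rewrite -ler_pdivrMr ?divr_gt0 // ltW // truncnS_gt.
exact: (@not_horosphere v0 n t t0 tn vt (z1 t St)).
Qed.

(** A maximum of e z between two times at which it is below e, with a time in
    between at which it is above. *)
Lemma local_extremum (e : R) : e ^+ 2 = 1 -> v 0 != 0 -> forall S, 0 <= S ->
  exists2 t, S < t & 0 < e * (z t - 1) /\ exists a b, [/\ S < a, a < t, t < b &
    forall r, a <= r <= b -> e * z r <= e * z t].
Proof.
move=> e1 v0 S S0; have e1' : (- e) ^+ 2 = 1 by rewrite sqrrN.
have [a Sa za] := crosses_one e1' v0 S; have [b ab zb] := crosses_one e1 v0 a.
have [c bc zc] := crosses_one e1' v0 b.
have ac : a <= c by rewrite ltW // (lt_trans ab).
have cez : {within `[a, c], continuous (fun r => e * z r)}.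
  apply: within_continuous => s _; apply: cvgM; first exact: cvg_cst.
  exact: cz.
have [t] := EVT_max ac cez; rewrite in_itv /= => /andP[at_ tc] mt.
have hb : e * z b <= e * z t by apply: mt; rewrite in_itv /= (ltW ab) (ltW bc).
move: za zc; rewrite !mulNr !oppr_gt0 => za zc.
have at' : a < t.
  by rewrite lt_neqAle at_ andbT; apply/eqP => E; rewrite -E in hb; lra.
have tc' : t < c.
  by rewrite lt_neqAle tc andbT; apply/eqP => E; rewrite E in hb; lra.
exists t; first exact: lt_trans at'.
split; first by lra.
by exists a, c.
Qed.

(** The parameter s is a function sg of the radius. Differentiating F (sg r) gives
    the same kind of function with F' / u for F, so smoothness follows by
    induction. The extrema are chosen one after the other, each at least one unit
    of time beyond the previous one and with the other sign. *)
Lemma branch_graph : v 0 != 0 -> exists f : R -> R, [/\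
  forall s, 0 <= s -> f (x s) = z s,
  forall s : R, 0 < s -> is_derive (x s) 1 f (v s / u s),
  {within `[x 0, +oo[, continuous f},
  smooth_on `]x 0, +oo[ f & oscillates_around_one (x 0) f].
Proof.
move=> v0; have [sg Hsg] := branch_inverse.
have sgK s : 0 <= s -> sg (x s) = s.
  move=> s0; have xs : x 0 <= x s.
    by move: s0; rewrite le_eqVlt => /predU1P[<-//|/branch_x_lt h]; apply/ltW/h.
  by have [g0 gx] := Hsg _ xs; exact: branch_x_inj.
have sg_gt0 r : x 0 < r -> 0 < sg r.
  move=> r0; have [g0 gx] := Hsg _ (ltW r0).
  by rewrite -branch_x_ltE // gx.
have Dsg s : 0 < s -> is_derive (x s) 1 sg (u s)^-1.
  move=> s0; apply: (@is_derive_inverse _ x sg) => //.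
  - by apply: filterS (open_near (@open_gt _ 0) s0) => t /= t0; exact/sgK/ltW.
  - by apply: filterS (open_near (@open_gt _ 0) s0) => t _; exact: cx.
  - by rewrite gt_eqF // branch_u_gt0.
pose P : set R := [set s | 0 < s].
have oP : open P by exact: open_gt.
pose Q : set R := [set` `]x 0, +oo[].
have QE r : Q r = (x 0 < r) :> Prop by rewrite /Q /= in_itv /= andbT.
have oQ : open Q by exact: interval_open.
have smP : profile P x z u v by apply: profile_subset H.
have u_neq0 s : P s -> u s != 0 by move=> /branch_u_gt0 h; rewrite gt_eqF.
have Dcomp (F dF : R -> R) (r : R) : (forall s : R, P s -> is_derive s 1 F (dF s)) -> Q r ->
    is_derive r 1 (fun r => F (sg r)) (dF (sg r) / u (sg r)).
  rewrite QE => DF r0; have g0 := sg_gt0 r r0; have [_ gx] := Hsg r (ltW r0).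
  by apply: d_comp (DF _ g0) _; have := Dsg _ g0; rewrite gx.
have smooth n : forall F : R -> R, (forall k, class_C k P F) -> class_C n Q (fun r => F (sg r)).
  elim: n => [|n IH] F cF.
    by move=> r Qr; apply: is_derive_continuous (Dcomp F (derive1 F) r (class_C_derive (cF 1%N)) Qr).
  apply: (class_CS oQ (fun r => Dcomp F (derive1 F) r (class_C_derive (cF 1%N)))).
  apply: (IH (fun s => derive1 F s / u s)) => k.
  apply: class_C_mul => //; first exact: (cF k.+1).2.
  by apply: class_C_inv => //; case: (profile_smooth oP smP k).
exists (fun r => z (sg r)); split.
- by move=> s s0; rewrite sgK.
- move=> s s0; have Qs : Q (x s) by rewrite QE branch_x_lt.
  by have := Dcomp z v (x s) (fun s _ => Dz s) Qs; rewrite sgK // ltW.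
- apply/continuous_within_itvcyP; split.
    by move=> r rQ; apply: is_derive_continuous (Dcomp z v r (fun s _ => Dz s) _).
  rewrite sgK //.
  apply/cvgrPdist_lt => e e0.
  have /cvgrPdist_lt/(_ e e0)/nbhs_ballP[d /= d0 hd] := @cz 0.
  have xd : 0 < x d - x 0 by rewrite subr_gt0 branch_x_lt.
  apply/nbhs_ballP; exists (x d - x 0) => // r; rewrite /ball /= => rd r0.
  apply: hd; have [g0 gx] := Hsg r (ltW r0).
  rewrite /ball /= sub0r normrN ger0_norm // -branch_x_ltE ?(ltW d0) // gx.
  by move: rd; rewrite distrC gtr0_norm ?subr_gt0 // ltrD2r.
- apply/smooth_onP => n; apply: smooth => k.
  by case: (profile_smooth oP smP k).
- pose sn n : R := if odd n then -1 else 1.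
  have sn1 n : sn n ^+ 2 = 1 by rewrite /sn; case: (odd n); rewrite ?sqrrN expr1n.
  have /choice[G HG] : forall nS : nat * R, exists t, 0 <= nS.2 ->
      nS.2 < t /\ 0 < sn nS.1 * (z t - 1) /\ exists a b, [/\ nS.2 < a, a < t, t < b &
      forall r, a <= r <= b -> sn nS.1 * z r <= sn nS.1 * z t].
    move=> [n S] /=; have [S0|_] := leP 0 S; last by exists 0.
    by have [t St h] := local_extremum (sn1 n) v0 S0; exists t.
  pose T := fix T (n : nat) : R := if n is m.+1 then G (m.+1, T m + 1) else G (0%N, 0).
  have Tn n : n%:R <= T n /\ 0 < T n.
    elim: n => [|n [IH1 IH2]] /=; first by have [h _] := HG (0%N, 0) (lexx _); split => //; exact: ltW.
    have [h _] := HG (n.+1, T n + 1) (addr_ge0 (ltW IH2) ler01).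
    by move: h => /= h; split; [rewrite -natr1; lra|lra].
  have TS n : T n < T n.+1.
    have [h _] := HG (n.+1, T n + 1) (addr_ge0 (ltW (Tn n).2) ler01).
    by apply: lt_trans h; rewrite /= ltrDl.
  have ext n : 0 < sn n * (z (T n) - 1) /\ exists a b, [/\ 0 < a, a < T n, T n < b &
      forall r, a <= r <= b -> sn n * z r <= sn n * z (T n)].
    case: n => [|n].
      by have [_ [h1 [a [b [h2 h3 h4 h5]]]]] := HG (0%N, 0) (lexx _); split => //; exists a, b.
    have [_ [h1 [a [b [h2 h3 h4 h5]]]]] := HG (n.+1, T n + 1) (addr_ge0 (ltW (Tn n).2) ler01).
    split => //; exists a, b; split => //; apply: lt_trans h2 => /=.
    by have := (Tn n).2; lra.
  have loc n : \forall y \near x (T n), sn n * z (sg y) <= sn n * z (T n).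
    have [_ [a [b [a0 aT Tb hab]]]] := ext n.
    have T0 := (Tn n).2.
    have xab : [set` `]x a, x b[] (x (T n)).
      by rewrite /= in_itv /= !branch_x_lt // ltW.
    have oab : open [set` `]x a, x b[] by exact: interval_open.
    apply: filterS (open_near oab xab) => y /=.
    rewrite in_itv /= => /andP[ay yb]; apply: hab.
    have x0y : x 0 <= y by apply/ltW; apply: lt_trans ay; exact: branch_x_lt.
    have [g0 gx] := Hsg y x0y.
    have b0 : 0 <= b by apply/ltW; exact: lt_trans Tb.
    by apply/andP; split; apply/ltW; rewrite -branch_x_ltE ?(ltW a0) // gx.
  exists (fun n => x (T n)); split.
  + by move=> n; split; apply: branch_x_lt => //; [exact: (Tn n).2|exact/ltW/(Tn n).2].
  + apply/cvgryPge => A; have [s0 s00 hs] := branch_x_unbounded A.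
    near=> n; apply: hs; apply: le_trans (Tn n).1.
    by near: n; exact: nbhs_infty_ger.
  + move=> n; rewrite sgK ?(ltW (Tn _).2) //; have [h _] := ext n.*2.
    have l := loc n.*2; rewrite /sn odd_double in h l; split; first by lra.
    by apply: filterS l => y; rewrite !mul1r.
  + move=> n; rewrite sgK ?(ltW (Tn _).2) //; have [h _] := ext n.*2.+1.
    have l := loc n.*2.+1; rewrite /sn oddS odd_double /= in h l; split; first by lra.
    by apply: filterS l => y; rewrite !mulN1r lerN2.
Unshelve. all: by end_near. Qed.

End Branch.

(** * Open maps and polar coordinates on the annulus *)

Section Topology.

Definition open_map (A T : topologicalType) (E : A -> T) :=
  forall U, open U -> open (E @` U).

(** Since F collapses the fibers of E it induces a map, which is continuous because
    E is open. Maps between surfaces with the same parametrization, and to the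
    annulus, arise in this way. *)
Lemma factor_through (A T B : topologicalType) (E : A -> T) (F : A -> B) :
  open_map E -> (forall q, exists a, E a = q) -> continuous F ->
  (forall a b, E a = E b -> F a = F b) ->
  exists2 h : T -> B, continuous h & forall a, h (E a) = F a.
Proof.
move=> oE sE cF EF; have /choice[g Eg] := sE.
have hE a : F (g (E a)) = F a by apply: EF; rewrite Eg.
exists (fun q => F (g q)) => //; apply/continuousP => O oO.
have -> : (fun q => F (g q)) @^-1` O = E @` (F @^-1` O).
  apply/seteqP; split=> [q /= Oq|_ [a /= Oa <-]]; last by rewrite /= hE.
  by exists (g q).
by apply: oE; move/continuousP: cF; exact.
Qed.

(** The preimage of a neighborhood of a under a section through a is a
    neighborhood of E a, and it lies in the image. *)
Lemma open_map_sections (A T : topologicalType) (E : A -> T) :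
  (forall a, exists sg : T -> A, [/\ sg (E a) = a, {for E a, continuous sg} &
     \forall q \near E a, E (sg q) = q]) -> open_map E.
Proof.
move=> H U oU; rewrite openE => _ [a Ua <-]; rewrite /interior.
have [sg [sga csg sK]] := H a.
have Us : \forall q \near E a, U (sg q).
  by apply: csg; rewrite sga; exact: open_nbhs_nbhs.
by apply: filterS2 Us sK => q Uq <-; exists (sg q).
Qed.

Section Plane.
Variable R : realType.
Implicit Types (a q : R * R).

Lemma polar_exists (a b r : R) : 0 <= r -> a ^+ 2 + b ^+ 2 = r ^+ 2 ->
  exists t, a = r * cos t /\ b = r * sin t.
Proof.
move=> r0 E; have [r00|rn] := eqVneq r 0.
  have a0 : a = 0 by rewrite r00 in E; nra.
  have b0 : b = 0 by rewrite r00 in E; nra.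
  by exists 0; rewrite r00 a0 b0 !mul0r.
have rp : 0 < r by rewrite lt_neqAle eq_sym rn.
have E1 : (a / r) ^+ 2 + (b / r) ^+ 2 = 1 by rewrite !exprMn -mulrDl E -exprMn divff // expr1n.
have a1 : -1 <= a / r <= 1 by apply/andP; split; nra.
have ca : cos (acos (a / r)) = a / r by rewrite acosK // in_itv.
have sa : sin (acos (a / r)) = `|b / r|.
  rewrite sin_acos // -sqrtr_sqr; congr Num.sqrt; lra.
have [b0|b0] := leP 0 (b / r).
  exists (acos (a / r)); rewrite ca sa (ger0_norm b0).
  by split; field.
exists (- acos (a / r)); rewrite cosN sinN ca sa (ltr0_norm b0) opprK.
by split; field.
Qed.

Lemma pair_continuous (T : topologicalType) (f g : T -> R) :
  continuous f -> continuous g -> continuous (fun p => (f p, g p)).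
Proof.
move=> cf cg p A [[B C] /= [nB nC] sub].
have : nbhs p (fun q : T => B (f q) /\ C (g q)).
  by apply: filterI; [exact: (cf p _ nB)|exact: (cg p _ nC)].
by apply: filterS => q ?; exact: (sub (f q, g q)).
Qed.

Lemma pair_continuous_at (T : topologicalType) (f g : T -> R) (p : T) :
  {for p, continuous f} -> {for p, continuous g} -> {for p, continuous (fun p => (f p, g p))}.
Proof.
move=> cf cg A [[B C] /= [nB nC] sub].
have : nbhs p (fun q : T => B (f q) /\ C (g q)).
  by apply: filterI; [exact: (cf _ nB)|exact: (cg _ nC)].
by apply: filterS => q ?; exact: (sub (f q, g q)).
Qed.

Lemma fst_continuous : continuous (fun a : R * R => a.1).
Proof. by move=> a; exact: cvg_fst. Qed.

Lemma snd_continuous : continuous (fun a : R * R => a.2).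
Proof. by move=> a; exact: cvg_snd. Qed.

(** A homeomorphism from the line onto ]1, 2[. *)
Definition radius (s : R) : R := 3 / 2 + atan s / pi.
Definition radius_inv (r : R) : R := tan (pi * (r - 3 / 2)).
Definition polar a : R * R := (radius a.1 * cos a.2, radius a.1 * sin a.2).
Definition modulus q : R := Num.sqrt (q.1 ^+ 2 + q.2 ^+ 2).

Lemma pi_neq0 : @pi R != 0.
Proof. by rewrite gt_eqF // pi_gt0. Qed.

Let pi0 : 0 < @pi R.
Proof. exact: pi_gt0. Qed.

Lemma radius_bounds s : 1 < radius s < 2.
Proof.
have h1 := atan_gtNpi2 s; have h2 := atan_ltpi2 s.
have e1 : - (1 / 2) < atan s / pi by rewrite ltr_pdivlMr //; lra.
have e2 : atan s / pi < 1 / 2 by rewrite ltr_pdivrMr //; lra.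
by rewrite /radius; apply/andP; split; lra.
Qed.

Lemma radiusK s : radius_inv (radius s) = s.
Proof.
rewrite /radius_inv /radius; have -> : pi * (3 / 2 + atan s / pi - 3 / 2) = atan s.
  by move: (@pi R) pi_neq0 (atan s) => p p0 a; field.
exact: atanK.
Qed.

Lemma radius_inv_bounds r : 1 < r < 2 ->
  @pi R * (r - 3 / 2) \in `](- (pi / 2)), (pi / 2)[.
Proof.
move=> /andP[r1 r2]; rewrite in_itv /=; move: (@pi R) pi0 => p p0.
by apply/andP; split; nra.
Qed.

Lemma radius_invK r : 1 < r < 2 -> radius (radius_inv r) = r.
Proof.
move=> rb; rewrite /radius /radius_inv tanK ?radius_inv_bounds //.
by move: (@pi R) pi_neq0 => p p0; field.
Qed.

Lemma radius_continuous : continuous radius.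
Proof.
move=> s; apply: cvgD; first exact: cvg_cst.
by apply: cvgM; [exact: continuous_atan|exact: cvg_cst].
Qed.

Lemma radius_inv_continuous r : 1 < r < 2 -> {for r, continuous radius_inv}.
Proof.
move=> rb; apply: (@continuous_comp _ _ _ (fun r : R => @pi R * (r - 3 / 2)) (@tan R)).
  by apply: cvgM; [exact: cvg_cst|apply: cvgB; [exact: cvg_id|exact: cvg_cst]].
apply: continuous_tan; rewrite gt_eqF // cos_gt0_pihalf //.
by have := radius_inv_bounds rb; rewrite in_itv.
Qed.

Lemma modulus_polar a : modulus (polar a) = radius a.1.
Proof.
rewrite /modulus /polar /= !exprMn -mulrDr cos2Dsin2 mulr1 sqrtr_sqr ger0_norm //.
by have /andP[h _] := radius_bounds a.1; rewrite ltW // (lt_trans _ h).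
Qed.

Lemma annulusP q : annulus q <-> 1 < modulus q < 2.
Proof.
rewrite /annulus /modulus /=; set n := q.1 ^+ 2 + q.2 ^+ 2.
have n0 : 0 <= n by rewrite addr_ge0 ?sqr_ge0.
have sn : Num.sqrt n ^+ 2 = n by rewrite sqr_sqrtr.
have s0 := sqrtr_ge0 n; split=> [[h1 h2]|/andP[h1 h2]].
  by apply/andP; split; nra.
by split; nra.
Qed.

Lemma polar_annulus a : annulus (polar a).
Proof. by apply/annulusP; rewrite modulus_polar radius_bounds. Qed.

Lemma polar_surj q : annulus q -> exists a, polar a = q.
Proof.
move=> /annulusP qb; have m0 : 0 <= modulus q by exact: sqrtr_ge0.
have [|t [h1 h2]] := @polar_exists q.1 q.2 (modulus q) m0.
  by rewrite /modulus sqr_sqrtr // addr_ge0 ?sqr_ge0.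
exists (radius_inv (modulus q), t); rewrite /polar /= radius_invK // -h1 -h2.
by case: q {qb m0 h1 h2}.
Qed.

Lemma polar_eq a b : polar a = polar b <->
  [/\ a.1 = b.1, cos a.2 = cos b.2 & sin a.2 = sin b.2].
Proof.
split=> [E|[h1 h2 h3]]; last by rewrite /polar h1 h2 h3.
have r : radius a.1 = radius b.1 by rewrite -!modulus_polar E.
have r0 : radius b.1 != 0.
  by have /andP[h _] := radius_bounds b.1; rewrite gt_eqF // (lt_trans _ h).
move: E; rewrite /polar r => -[/(mulfI r0) -> /(mulfI r0) ->].
by split => //; rewrite -(radiusK a.1) r radiusK.
Qed.

Lemma polar_continuous : continuous polar.
Proof.
have c1 : continuous (fun a : R * R => radius a.1).
  by move=> a; apply: continuous_comp (@fst_continuous a) (@radius_continuous _).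
apply: pair_continuous => a; apply: cvgM.
- exact: c1.
- by apply: continuous_comp (@snd_continuous a) (@continuous_cos _ _).
- exact: c1.
- by apply: continuous_comp (@snd_continuous a) (@continuous_sin _ _).
Qed.

Lemma modulus_continuous : continuous modulus.
Proof.
move=> q; apply: (@continuous_comp _ _ _ (fun q : R * R => q.1 ^+ 2 + q.2 ^+ 2) Num.sqrt); last exact: sqrt_continuous.
by apply: cvgD; apply: (@continuous_comp _ _ _ _ (fun t : R => t ^+ 2));
  by [exact: fst_continuous|exact: snd_continuous|exact: exprn_continuous].
Qed.

(** Near a point of angle t0, the angle is t0 plus the arc sine of the sine B of
    the point rotated by - t0, as long as its cosine A is positive. *)
Lemma polar_open : open_map polar.
Proof.
apply: open_map_sections => -[s0 t0].
pose A (q : R * R) := (q.1 * cos t0 + q.2 * sin t0) / modulus q.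
pose B (q : R * R) := (q.2 * cos t0 - q.1 * sin t0) / modulus q.
have r0 := radius_bounds s0.
have m0 : modulus (polar (s0, t0)) = radius s0 by rewrite modulus_polar.
have rn0 : radius s0 != 0 by case/andP: r0 => h _; rewrite gt_eqF // (lt_trans _ h).
have A1 : A (polar (s0, t0)) = 1.
  rewrite /A m0 /polar /=.
  have -> : radius s0 * cos t0 * cos t0 + radius s0 * sin t0 * sin t0 =
    radius s0 * (cos t0 ^+ 2 + sin t0 ^+ 2) by ring.
  by rewrite cos2Dsin2 mulr1 divff.
have B0 : B (polar (s0, t0)) = 0.
  rewrite /B /polar /=; have -> : radius s0 * sin t0 * cos t0 - radius s0 * cos t0 * sin t0 = 0 by ring.
  by rewrite mul0r.
have mn0 : modulus (polar (s0, t0)) != 0 by rewrite m0.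
have cA : {for polar (s0, t0), continuous A}.
  apply: cvgM; last by apply: cvgV => //; exact: modulus_continuous.
  by apply: cvgD; apply: cvgM; [exact: fst_continuous|exact: cvg_cst|exact: snd_continuous|exact: cvg_cst].
have cB : {for polar (s0, t0), continuous B}.
  apply: cvgM; last by apply: cvgV => //; exact: modulus_continuous.
  by apply: cvgB; apply: cvgM; [exact: snd_continuous|exact: cvg_cst|exact: fst_continuous|exact: cvg_cst].
exists (fun q => (radius_inv (modulus q), t0 + asin (B q))); split.
- rewrite m0 radiusK B0; have -> : asin 0 = 0 :> R; last by rewrite addr0.
  by rewrite -[X in asin X](sin0 R) sinK // in_itv /= oppr_le0 divr_ge0 ?(ltW pi0).
- apply: pair_continuous_at.
    apply: continuous_comp; first exact: modulus_continuous.
    by rewrite m0; exact: radius_inv_continuous.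
  apply: cvgD; first exact: cvg_cst.
  apply: continuous_comp; first exact: cB.
  by rewrite B0; apply: continuous_asin; rewrite ltrN10 ltr01.
- have nA : \forall q \near polar (s0, t0), 0 < A q.
    by apply: (cvgr_gt (A (polar (s0, t0))) cA); rewrite A1.
  have n1 : \forall q \near polar (s0, t0), 1 < modulus q.
    by apply: (cvgr_gt (modulus (polar (s0, t0))) (@modulus_continuous _)); rewrite m0; case/andP: r0.
  have n2 : \forall q \near polar (s0, t0), modulus q < 2.
    by apply: (cvgr_lt (modulus (polar (s0, t0))) (@modulus_continuous _)); rewrite m0; case/andP: r0.
  near=> q.
  have Aq : 0 < A q by near: q.
  have q1 : 1 < modulus q by near: q.
  have q2 : modulus q < 2 by near: q.
  have mq : modulus q != 0 by rewrite gt_eqF // (lt_trans _ q1).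
  have AB : A q ^+ 2 + B q ^+ 2 = 1.
    have : modulus q ^+ 2 = q.1 ^+ 2 + q.2 ^+ 2 by rewrite sqr_sqrtr // addr_ge0 ?sqr_ge0.
    move=> mE; rewrite /A /B !exprMn -mulrDl.
    have -> : (q.1 * cos t0 + q.2 * sin t0) ^+ 2 + (q.2 * cos t0 - q.1 * sin t0) ^+ 2 =
      (q.1 ^+ 2 + q.2 ^+ 2) * (cos t0 ^+ 2 + sin t0 ^+ 2) by ring.
    by rewrite cos2Dsin2 mulr1 -mE -exprMn divff // expr1n.
  have B1 : -1 <= B q <= 1 by apply/andP; split; nra.
  have sB : sin (asin (B q)) = B q by rewrite asinK // in_itv.
  have cBq : cos (asin (B q)) = A q.
    by rewrite cos_asin // -AB addrK sqrtr_sqr gtr0_norm.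
  rewrite /polar /= radius_invK ?q1 // cosD sinD sB cBq /A /B.
  have ct := cos2Dsin2 t0.
  rewrite [RHS]surjective_pairing; congr (_, _).
    transitivity (q.1 * (cos t0 ^+ 2 + sin t0 ^+ 2)); last by rewrite ct mulr1.
    by field.
  transitivity (q.2 * (cos t0 ^+ 2 + sin t0 ^+ 2)); last by rewrite ct mulr1.
  by field.
Unshelve. all: by end_near. Qed.

Definition annulus_type : topologicalType := set_type (@annulus R).

Definition polar_annulus_type a : annulus_type := SigSub (mem_set (polar_annulus a)).

Lemma polar_annulus_continuous : continuous polar_annulus_type.
Proof.
apply/continuousP => U [V oV <-{U}].
rewrite -comp_preimage; have -> : set_val \o polar_annulus_type = polar by [].
by move/continuousP: polar_continuous; exact.
Qed.

Lemma polar_annulus_open : open_map polar_annulus_type.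
Proof.
move=> U oU; exists (polar @` U); first exact: polar_open.
apply/seteqP; split=> [p /= [a Ua E]|_ [a Ua <-]]; last by exists a.
by exists a => //; apply: val_inj.
Qed.

Lemma polar_annulus_surj (p : annulus_type) : exists a, polar_annulus_type a = p.
Proof.
have [a E] := polar_surj (set_valP p); exists a; exact: val_inj.
Qed.

Lemma polar_annulus_eq a b : polar_annulus_type a = polar_annulus_type b <->
  polar a = polar b.
Proof. by split=> [/(congr1 val)|E] //; exact: val_inj. Qed.

Lemma annulus_hausdorff : hausdorff_space annulus_type.
Proof.
move=> p q pq; apply: val_inj; apply: (@norm_hausdorff _ (R * R)%type) => A B nA nB.
have c : continuous (set_val : annulus_type -> R * R) by exact: initial_continuous.
by have [r [? ?]] := pq _ _ (c p _ nA) (c q _ nB); exists (set_val r).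
Qed.

Lemma row_continuous (T : topologicalType) n (f : T -> 'rV[R]_n) :
  (forall k, continuous (fun p => f p 0 k)) -> continuous f.
Proof.
move=> cf p A [B nB sub].
have : \forall q \near p, forall k, B 0 k (f q 0 k).
  by apply: filter_forall => k; exact: (cf k p _ (nB 0 k)).
apply: filterS => q h; apply: sub => i j; rewrite ord1; exact: h.
Qed.

End Plane.

End Topology.

(** * Surfaces generated by a profile *)

Section Surfaces.
Variable R : realType.
Implicit Types (x z u v : R -> R) (I J : set R) (S : surface R).

Lemma near2_intro (s0 : R) (A : set R) (Q : R -> R -> Prop) : nbhs s0 A ->
  (forall s s', A s -> A s' -> Q s s') -> \forall s \near s0 & s' \near s0, Q s s'.
Proof. by move=> nA AQ; exists (A, A) => // -[s s'] [/= As As']; exact: AQ. Qed.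

Lemma near2_diag (s0 : R) (Q : R -> R -> Prop) :
  (\forall s \near s0 & s' \near s0, Q s s') -> Q s0 s0.
Proof.
by move=> [[A B] /= [nA nB] sub]; apply: (sub (s0, s0)); split; exact: nbhs_singleton.
Qed.

Lemma near2_comp (s0 : R) (f : R -> R) (Q : R -> R -> Prop) : {for s0, continuous f} ->
  (\forall s \near f s0 & s' \near f s0, Q s s') ->
  \forall s \near s0 & s' \near s0, Q (f s) (f s').
Proof.
move=> cf [[A B] /= [nA nB] sub]; exists (f @^-1` A, f @^-1` B) => /=.
  by split; apply: cf.
by move=> [s s'] [/= As Bs']; exact: (sub (f s, f s')).
Qed.

Lemma rot_axis_dist x z s t : axis_dist (rot x z s t) = `|x s|.
Proof.
by rewrite /axis_dist !pointE !exprMn -mulrDr cos2Dsin2 mulr1 sqrtr_sqr.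
Qed.

Lemma rot_height x z s t : height (rot x z s t) = z s.
Proof. by rewrite /height pointE. Qed.

Definition W_solution (x0 z0 : R) x z u v :=
  [/\ profile setT x z u v, x 0 = x0, z 0 = z0, u 0 = 0 & v 0 = 1].

Lemma profile_reverse x z u v : profile setT x z u v ->
  profile setT (fun r => x (- r)) (fun r => z (- r)) (fun r => - u (- r)) (fun r => - v (- r)).
Proof.
move=> H; have k1 : (-1 : R) ^+ 2 = 1 by rewrite sqrrN expr1n.
have := @profile_affine _ (-1) 0 _ _ _ _ _ k1 H.
have E (f : R -> R) : (fun r => f (-1 * r + 0)) = (fun r => f (- r)).
  by apply/funext => r; rewrite mulN1r addr0.
have E' (f : R -> R) : (fun r => -1 * f (-1 * r + 0)) = (fun r => - f (- r)).
  by apply/funext => r; rewrite !mulN1r addr0.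
by rewrite !E !E'.
Qed.

(** The profile keeps x >= x0, so a curve with the same initial data cannot reach
    the axis before departing from it. *)
Lemma curve_agrees_fwd I x' z' x z u v s1 : horo_shrinker_curve I x' z' -> I 0 ->
  profile setT x z u v -> u 0 = 0 ->
  [/\ x' 0 = x 0, z' 0 = z 0, derive1 x' 0 = u 0 & derive1 z' 0 = v 0] ->
  0 <= s1 -> I s1 -> x' s1 = x s1 /\ z' s1 = z s1.
Proof.
move=> HI I0 H u0 [e1 e2 e3 e4] s10 Is1.
have [[oI iI _] _ us zs _] := HI.
have [Dx' Dz'] := curve_derive HI.
have sub r : 0 <= r <= s1 -> I r by exact: iI.
have xp := branch_x0 H 0.
have prof T : (forall r, 0 <= r <= T -> I r) ->
    (forall r, 0 <= r <= T -> 0 < x' r) -> 0 <= T -> x' T = x T /\ z' T = z T.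
  move=> IT pT T0.
  have P : profile [set r | 0 <= r <= T] x' z' (derive1 x') (derive1 z').
    move=> r rT; have Ir := IT r rT; split; [exact: pT|exact: zs|exact: us|].
    by apply: horo_curve_ode HI Ir _; rewrite gt_eqF // pT.
  have P' : profile [set r | 0 <= r <= T] x z u v by apply: profile_subset H.
  by have [] := profile_unique_fwd T0 (And4 e1 e2 e3 e4) P P'.
pose cl (r : R) := Num.max 0 (Num.min r s1).
have clI r : 0 <= cl r <= s1.
  by rewrite /cl le_max lexx ge_max s10 ge_min lexx orbT.
have cl_id r : 0 <= r <= s1 -> cl r = r.
  by move=> /andP[r0 rs]; rewrite /cl min_l // max_r.
have ccl : continuous cl.
  move=> r; apply: (@continuous_max _ _ (fun=> 0) (fun r => Num.min r s1)); first exact: cvg_cst.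
  by apply: (@continuous_min _ _ (fun r => r) (fun=> s1)); [exact: cvg_id|exact: cvg_cst].
have pos : forall r, 0 <= r -> x 0 / 2 < x' (cl r).
  apply: (@continuity_method _ [set r | x 0 / 2 < x' (cl r)]).
    apply: (@open_comp _ _ (fun r => x' (cl r)) [set y | x 0 / 2 < y]); last exact: open_gt.
    move=> r _; apply: continuous_comp; first exact: ccl.
    by have := is_derive_continuous (Dx' _ (sub _ (clI r))).
  move=> T T0 hT /=; apply: (@lt_le_trans _ _ (x 0)); first by lra.
  move: T0; rewrite le_eqVlt => /predU1P[<-|T0].
    by rewrite cl_id ?lexx // e1.
  apply: (@limit_ge _ (fun r => x' (cl r)) T _ T0).
    apply: continuous_comp; first exact: ccl.
    by have := is_derive_continuous (Dx' _ (sub _ (clI T))).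
  move=> r /andP[r0 rT]; have /andP[c0 cs] := clI r.
  have cr : cl r <= r by rewrite /cl ge_max r0 ge_min lexx.
  have [|t /andP[t0 tc]||-> _] := prof (cl r) => //.
  - by move=> t /andP[t0 tc]; apply: sub; rewrite t0 (le_trans tc).
  - have := hT t; rewrite /= t0 (le_lt_trans (le_trans tc cr) rT) => /(_ isT).
    by rewrite cl_id ?t0 ?(le_trans tc) //; lra.
  exact: (x_ge (@setT_interval R) Logic.I H u0).
apply: prof => // r rs; have /andP[r0 _] := rs.
by have := pos r r0; rewrite cl_id //; lra.
Qed.

Lemma curve_agrees I x' z' x z u v : horo_shrinker_curve I x' z' -> I 0 ->
  profile setT x z u v -> u 0 = 0 ->
  [/\ x' 0 = x 0, z' 0 = z 0, derive1 x' 0 = u 0 & derive1 z' 0 = v 0] ->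
  forall s, I s -> x' s = x s /\ z' s = z s.
Proof.
move=> HI I0 H u0 e s Is; have [s0|/ltW s0] := leP 0 s.
  exact: curve_agrees_fwd HI I0 H u0 e s0 Is.
have k1 : (-1 : R) ^+ 2 = 1 by rewrite sqrrN expr1n.
have [Dx' Dz'] := curve_derive HI.
have HI' := horo_curve_affine 0 k1 HI; have H' := profile_reverse H.
have z0 : -1 * 0 + 0 = 0 :> R by rewrite mulr0 addr0.
have E : -1 * (- s) + 0 = s by rewrite mulN1r opprK addr0.
have := @curve_agrees_fwd _ _ _ _ _ _ _ (- s) HI' _ H'.
rewrite /= z0 E oppr0 opprK u0 oppr0 oppr_ge0; apply => //.
have [e1 e2 e3 e4] := e; split => //; apply: derive1_val.
- have D := Dx' 0 I0; rewrite -z0 in D.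
  by apply: d_eq (is_derive_affine D) _; rewrite z0 e3 u0 mulr0.
- have D := Dz' 0 I0; rewrite -z0 in D.
  by apply: d_eq (is_derive_affine D) _; rewrite z0 e4 mulN1r.
Qed.

Lemma maximal_W x z u v : profile setT x z u v -> maximal_curve setT x z.
Proof.
move=> H; split; last by [].
by apply: curve_of_profile H; [exact: openT|exact: setT_interval|exists 0].
Qed.

(** Rotating by tau about the axis is included for the sake of curves with x < 0,
    which tau = pi and x' = - x bring to the other side. *)
Lemma generated_through_affine S I x z P (k c tau : R) (x' : R -> R) : k ^+ 2 = 1 ->
  (forall s t, rot x' (fun s => z (k * s + c)) s t = rot x z (k * s + c) (t + tau)) ->
  generated_through (S := S) I x z P ->
  generated_through (S := S) [set s | I (k * s + c)] x' (fun s => z (k * s + c))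
    (fun a => P (k * a.1 + c, a.2 + tau)).
Proof.
move=> k1 rE [cP oP sP pP lP].
pose A (a : R * R) := (k * a.1 + c, a.2 + tau).
pose B (a : R * R) := (k * a.1 - k * c, a.2 - tau).
have AB a : A (B a) = a.
  by case: a => s t; rewrite /A /B /= mulrBr !mulrA -expr2 k1 !mul1r !subrK.
have BA a : B (A a) = a.
  by case: a => s t; rewrite /A /B /= mulrDr !mulrA -expr2 k1 !mul1r !addrK.
have cA : continuous A.
  apply: pair_continuous => a; apply: cvgD; try exact: cvg_cst.
    by apply: cvgM; [exact: cvg_cst|exact: fst_continuous].
  exact: snd_continuous.
have cB : continuous B.
  apply: pair_continuous => a; apply: cvgB; try exact: cvg_cst.
    by apply: cvgM; [exact: cvg_cst|exact: fst_continuous].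
  exact: snd_continuous.
split.
- move=> a /= Ia; apply: (@continuous_comp _ _ _ A P); first exact: cA.
  by apply: cP.
- move=> U oU UI; have -> : (fun a => P (A a)) @` U = P @` (B @^-1` U).
    apply/seteqP; split=> [_ [a Ua <-]|_ [a /= Ua <-]].
      by exists (A a); rewrite /= ?BA.
    by exists (B a); rewrite ?AB.
  apply: oP; first by move/continuousP: cB; exact.
  by move=> a /= Ba; have := UI _ Ba; rewrite /= -[k * (B a).1 + c]/((A (B a)).1) AB.
- move=> p; have [a Ia E] := sP p; exists (B a).
    by rewrite /= -[k * (B a).1 + c]/((A (B a)).1) AB.
  by rewrite -/(A (B a)) AB.
- by move=> s t /= Is; rewrite pP // rE.
- move=> s0 /= Is0; have := lP _ Is0.
  move=> /(@near2_comp s0 (fun s => k * s + c)) h.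
  have {}h := h (is_derive_continuous (_ : is_derive s0 1 (fun s => k * s + c) k)).
  apply: filterS (h _) => [[s s'] /= hs t t'|]; first by rewrite !rE => /hs.
  by deriv; ring.
Qed.

(** Reparametrize by s |-> k s + s0, where k = z' s0 is 1 or -1. On its domain the
    curve then agrees with the profile, and by maximality the domain is the whole
    line. *)
Lemma is_W_normal (x0 z0 : R) x z u v S : W_solution x0 z0 x z u v ->
  is_W x0 z0 S -> exists P, generated_through (S := S) setT x z P.
Proof.
move=> [H e1 e2 e3 e4] [I [x' [z' [M [P [_ _ GP _]] [s0 [Is0 f1 f2 f3]]]]]].
pose k := derive1 z' s0.
have [HI _] := M; have [_ _ us _ _] := HI.
have k1 : k ^+ 2 = 1 by have := us _ Is0; rewrite f3 expr0n add0r.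
have [[HJ MJ]] := (maximal_affine s0 k1 M, tt).
set J := [set s | I (k * s + s0)] in HJ MJ.
have z00 : k * 0 + s0 = s0 by rewrite mulr0 add0r.
have J0 : J 0 by rewrite /J /= z00.
have [Dx' Dz'] := curve_derive HI.
have ag : forall s, J s -> x' (k * s + s0) = x s /\ z' (k * s + s0) = z s.
  apply: (curve_agrees HJ J0 H e3); rewrite z00 f1 f2 e1 e2 e3 e4; split => //; apply: derive1_val.
  - have D := Dx' s0 Is0; rewrite -z00 in D.
    by apply: d_eq (is_derive_affine D) _; rewrite z00 f3 mulr0.
  - have D := Dz' s0 Is0; rewrite -z00 in D.
    by apply: d_eq (is_derive_affine D) _; rewrite z00 -/k -expr2.
have JT : J = setT.
  apply/seteqP; split => // s _; apply: (MJ setT x z) => //.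
    by case: (maximal_W H).
  by move=> r Jr; have [-> ->] := ag r Jr.
have E1 : (fun s => x' (k * s + s0)) = x.
  by apply/funext => s; have [] := ag s; rewrite ?JT.
have E2 : (fun s => z' (k * s + s0)) = z.
  by apply/funext => s; have [] := ag s; rewrite ?JT.
exists (fun a => P (k * a.1 + s0, a.2 + 0)).
have := @generated_through_affine S I x' z' P k s0 0 (fun s => x' (k * s + s0)) k1 _ GP.
by rewrite -/J JT E1 E2; apply => s t; rewrite addr0 /rot -(congr1 (@^~ s) E1) -(congr1 (@^~ s) E2).
Qed.

Section WSurface.
Variables (x0 z0 : R) (x z u v : R -> R).
Hypothesis x00 : 0 < x0.
Hypothesis W : W_solution x0 z0 x z u v.

Let H : profile setT x z u v. Proof. by case: W. Qed.
Let H' := profile_reverse H.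
Let e1 : x 0 = x0. Proof. by case: W. Qed.
Let e2 : z 0 = z0. Proof. by case: W. Qed.
Let u0 : u 0 = 0. Proof. by case: W. Qed.
Let v1 : v 0 = 1. Proof. by case: W. Qed.
Let v0 : v 0 != 0. Proof. by rewrite v1 oner_neq0. Qed.
Let u0' : - u (- 0) = 0. Proof. by rewrite oppr0 u0 oppr0. Qed.
Let v0' : - v (- 0) != 0. Proof. by rewrite oppr0 v1 oppr_eq0 oner_neq0. Qed.

Lemma W_x_gt0 s : 0 < x s. Proof. exact: branch_x0 H s. Qed.
Lemma W_z_gt0 s : 0 < z s. Proof. exact: branch_z0 H s. Qed.

Lemma W_x_lt s : s != 0 -> x0 < x s.
Proof.
rewrite -e1 neq_lt => /orP[s0|s0]; last exact: branch_x_lt H u0 _ _ (lexx 0) s0.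
have := @branch_x_lt _ _ _ _ _ H' u0' 0 (- s) (lexx 0).
by rewrite oppr_gt0 => /(_ s0); rewrite oppr0 opprK.
Qed.

Lemma W_x_ge s : x0 <= x s.
Proof. by have [->|/W_x_lt/ltW//] := eqVneq s 0; rewrite e1. Qed.

Lemma W_x_inj s s' : 0 <= s * s' -> x s = x s' -> s = s'.
Proof.
move=> ss' E.
have [s0|s0] := leP 0 s; have [s'0|s'0] := leP 0 s'.
- exact: branch_x_inj H u0 _ _ s0 s'0 E.
- have : s = 0 by nra.
  move=> s00; have := @W_x_lt s'; rewrite lt_eqF // => /(_ isT).
  by rewrite -E s00 e1 ltxx.
- have : s' = 0 by nra.
  move=> s00; have := @W_x_lt s; rewrite lt_eqF // => /(_ isT).
  by rewrite E s00 e1 ltxx.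
- apply: oppr_inj; apply: (@branch_x_inj _ _ _ _ _ H' u0').
  + by rewrite oppr_ge0 ltW.
  + by rewrite oppr_ge0 ltW.
  + by rewrite !opprK.
Qed.

Lemma rot_eq s s' t t' : rot x z s t = rot x z s' t' ->
  [/\ x s = x s', z s = z s', cos t = cos t' & sin t = sin t'].
Proof.
move=> E; have Ex : x s = x s'.
  have := congr1 (@axis_dist R) E; rewrite !rot_axis_dist !gtr0_norm //; exact: W_x_gt0.
have xn : x s' != 0 by rewrite gt_eqF // W_x_gt0.
have Ez : z s = z s' by have := congr1 (@height R) E; rewrite !rot_height.
have := congr1 (fun q : 'rV[R]_3 => q 0 ix) E; have := congr1 (fun q : 'rV[R]_3 => q 0 iy) E.
by rewrite /rot !pointE Ex => /(mulfI xn) -> /(mulfI xn) ->.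
Qed.

Section Fibers.
Variables (S : surface R) (P : R * R -> S).
Hypothesis G : generated_through setT x z P.

Let cP : continuous P. Proof. by case: G => h _ _ _ _ a; exact: h. Qed.
Let oP : open_map P. Proof. by case: G => _ h _ _ _ U oU; exact: h. Qed.
Let sP q : exists a, P a = q.
Proof. by case: G => _ _ h _ _; have [a _ <-] := h q; exists a. Qed.
Let pP s t : pos (P (s, t)) = rot x z s t.
Proof. by case: G => _ _ _ h _; exact: h. Qed.

Let P_axis_dist a : axis_dist (pos (P a)) = x a.1.
Proof. by case: a => s t; rewrite pP rot_axis_dist gtr0_norm // W_x_gt0. Qed.
Let P_height a : height (pos (P a)) = z a.1.
Proof. by case: a => s t; rewrite pP rot_height. Qed.

(** The two ends may cross in the half-space. If P identified points over such a
    crossing, then by openness the two graphs would agree near that radius, the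
    two arcs would share a tangent line, and by uniqueness the profile would be
    symmetric about the parameter midway, where its velocity would vanish. *)
Lemma ends_disjoint s s' t t' : s' < 0 -> 0 < s -> P (s, t) <> P (s', t').
Proof.
move=> s'0 s0 E.
have [Ex Ez _ _] : [/\ x s = x s', z s = z s', cos t = cos t' & sin t = sin t'].
  by apply: rot_eq; rewrite -!pP E.
have [fm [fmE Dfm _ _ _]] := branch_graph H' u0' v0'.
pose V := P @` [set a : R * R | a.1 < 0].
have oV : open V.
  by apply: oP; apply: (@open_comp _ _ (fun a : R * R => a.1) [set y : R | y < 0]);
    [move=> a _; exact: fst_continuous|exact: open_lt].
have Vp : V (P (s, t)) by exists (s', t').
have cl : {for s, continuous (fun h : R => P (h, t))}.
  apply: (@continuous_comp _ _ _ (fun h : R => (h, t)) P); last exact: cP.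
  by apply: pair_continuous => h; [exact: cvg_id|exact: cvg_cst].
have near_eq : \forall h \near s, fm (x h) = z h.
  have nV : \forall h \near s, V (P (h, t)) by apply: cl; exact: open_nbhs_nbhs.
  apply: filterS nV => h [[a b] /= a0 Pab].
  have -> : x h = x (- - a).
    by rewrite opprK -(P_axis_dist (h, t)) -Pab P_axis_dist.
  have -> : z h = z (- - a) by rewrite opprK -(P_height (h, t)) -Pab P_height.
  by apply: fmE; rewrite oppr_ge0 ltW.
have D := Dfm (- s'); rewrite oppr_gt0 in D; have {}D := D s'0.
rewrite !opprK -Ex in D.
have [Dx Dz _ _] := branch_ode H s.
have Ev : v s = v s' / u s' * u s.
  rewrite -(derive1_val Dz); apply: derive1_val; apply: near_eq_is_derive near_eq _.
  by apply: d_eq (d_comp D Dx) _; rewrite invrN mulrNN.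
have us : 0 < u s by exact: branch_u_gt0 H u0 _ s0.
have us' : u s' < 0.
  have := @branch_u_gt0 _ _ _ _ _ H' u0' (- s'); rewrite oppr_gt0 opprK => /(_ s'0).
  by rewrite oppr_gt0.
have un : u s' != 0 by rewrite lt_eqF.
pose l := u s / u s'.
have l0 : l < 0 by rewrite pmulr_rlt0 // invr_lt0.
have lu : u s = l * u s' by rewrite /l divfK.
have lv : v s = l * v s' by rewrite Ev /l; field.
have l2 : l ^+ 2 = 1.
  have E1 := branch_unit H s; have E2 := branch_unit H s'.
  transitivity ((l * u s') ^+ 2 + (l * v s') ^+ 2); last by rewrite -lu -lv.
  by transitivity (l ^+ 2 * (u s' ^+ 2 + v s' ^+ 2)); [rewrite E2 mulr1|ring].
have l1 : l = -1.
  by have [El|//] := sqr1_cases l2; move: l0; rewrite El ltr10.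
have k1 : (-1 : R) ^+ 2 = 1 by rewrite sqrrN expr1n.
have HR := @profile_affine _ (-1) (s + s') _ _ _ _ _ k1 H.
have Es : -1 * s + (s + s') = s' by ring.
have [|h1 h2 h3 h4] := @profile_unique _ setT _ _ _ _ _ _ _ _ s ((s + s') / 2) (@setT_interval R) Logic.I Logic.I _ H HR.
  by rewrite /= Es Ex Ez lu lv l1.
have Em : -1 * ((s + s') / 2) + (s + s') = (s + s') / 2 by field.
rewrite Em in h3 h4; have := branch_unit H ((s + s') / 2).
have -> : u ((s + s') / 2) = 0 by lra.
have -> : v ((s + s') / 2) = 0 by lra.
by rewrite expr0n addr0 => /eqP; rewrite eq_sym oner_eq0.
Qed.

Lemma fiberP a b : P a = P b <-> [/\ a.1 = b.1, cos a.2 = cos b.2 & sin a.2 = sin b.2].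
Proof.
case: a b => s t [s' t'] /=; split=> [E|[<- ct st]].
  have [Ex Ez ct st] : [/\ x s = x s', z s = z s', cos t = cos t' & sin t = sin t'].
    by apply: rot_eq; rewrite -!pP E.
  split => //; apply: W_x_inj => //; rewrite leNgt; apply/negP => ss'.
  have [s0|s0] := leP 0 s.
    have s'0 : s' < 0 by nra.
    have s0' : 0 < s by nra.
    exact: (ends_disjoint s'0 s0' E).
  have s'0 : 0 < s' by nra.
  exact: (ends_disjoint s0 s'0 (esym E)).
have [_ _ _ _ lP] := G.
by apply: (near2_diag (lP s Logic.I)); rewrite /rot ct st.
Qed.

(** P and polar are continuous open maps onto S and onto the annulus, and they
    have the same fibers. *)
Lemma W_annulus : homeo_annulus R S.
Proof.
have Ppolar a b : P a = P b <-> polar a = polar b by rewrite polar_eq fiberP.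
have [f cf fP] := factor_through oP sP (@polar_continuous R) (fun a b => (Ppolar a b).1).
have /choice[c Hc] : forall q : R * R, exists a, annulus q -> polar a = q.
  move=> q; have [/polar_surj[a ?]|n] := pselect (annulus q); first by exists a.
  by exists (0, 0).
have gE a : P (c (polar a)) = P a by apply/Ppolar; apply: Hc; exact: polar_annulus.
exists f, (fun q => P (c q)); split.
- exact: cf.
- apply: continuous_in_subspaceT => q; rewrite inE => /polar_surj[a <-] A /=.
  rewrite gE => nA; have : nbhs a (P @^-1` A) by exact: cP.
  rewrite nbhsE => -[B [oB Ba] BA].
  have nB : nbhs (polar a) (@polar R @` B).
    by apply: open_nbhs_nbhs; split; [exact: polar_open|exists a].
  by apply: filterS nB => _ [b Bb <-] /=; rewrite gE; exact: BA.
- by move=> p; have [a <-] := sP p; rewrite fP; exact: polar_annulus.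
- by move=> p; have [a <-] := sP p; rewrite fP gE.
- by move=> q Aq; rewrite fP Hc.
Qed.

Lemma W_closest : [/\ inf (range (fun p : S => axis_dist (pos p))) = x0,
  exists p : S, axis_dist (pos p) = x0 &
  forall p : S, axis_dist (pos p) = x0 -> height (pos p) = z0].
Proof.
have P0 : axis_dist (pos (P (0, 0))) = x0 by rewrite P_axis_dist.
split; last 2 first.
- by exists (P (0, 0)).
- move=> p; have [a <-] := sP p; rewrite P_axis_dist P_height -e2 => xa.
  have [->//|/W_x_lt] := eqVneq a.1 0; by rewrite xa ltxx.
set E := (X in inf X).
have lb : lbound E x0 by move=> _ [p _ <-]; have [a <-] := sP p; rewrite P_axis_dist W_x_ge.
have Ex : E x0 by exists (P (0, 0)).
apply/eqP; rewrite eq_le ge_inf //; last by exists x0.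
by rewrite lb_le_inf //; exists x0.
Qed.

Lemma W_outside (p : S) : 0 < height (pos p) /\
  x0 ^+ 2 <= pos p 0 ix ^+ 2 + pos p 0 iy ^+ 2.
Proof.
have [[s t] <-] := sP p; rewrite P_height; split; first exact: W_z_gt0.
rewrite pP /rot !pointE !exprMn -mulrDr cos2Dsin2 mulr1.
by rewrite lerXn2r ?nnegrE ?W_x_ge // ltW // W_x_gt0.
Qed.

(** The sign e selects the end. It is connected because the image under P of the
    segment from (0, 0) to a joins P (0, 0) to P a. *)
Lemma W_graph_component (e : R) f : e ^+ 2 = 1 ->
  (forall s, 0 <= s -> f (x (e * s)) = z (e * s)) ->
  (forall r, x0 <= r -> exists2 s, 0 <= s & x (e * s) = r) ->
  {within `[x0, +oo[, continuous f} -> smooth_on `]x0, +oo[ f ->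
  graph_component x0 f (P @` [set a | 0 <= e * a.1]).
Proof.
move=> ee fE sur cf sf; have eK s : e * (e * s) = s by rewrite mulrA -expr2 ee mul1r.
split => //.
- have -> : P @` [set a | 0 <= e * a.1] = \bigcup_(a in [set a : R * R | 0 <= e * a.1])
      ((fun l : R => P (l * a.1, l * a.2)) @` [set` `[0, 1]]).
    apply/seteqP; split=> [_ [a Aa <-]|_ [a /= Aa [l + <-]]].
      exists a => //; exists 1; first by rewrite /= in_itv /= ler01 lexx.
      by rewrite !mul1r; case: (a).
    rewrite /= in_itv /= => /andP[l0 _]; exists (l * a.1, l * a.2) => //=.
    by rewrite mulrCA mulr_ge0.
  apply: bigcup_connected.
    exists (P (0, 0)) => a _; exists 0; first by rewrite /= in_itv /= lexx ler01.
    by rewrite !mul0r.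
  move=> a _; apply: connected_continuous_connected.
    exact/connected_intervalP/interval_is_interval.
  apply: continuous_subspaceT => l.
  apply: (@continuous_comp _ _ _ (fun l : R => (l * a.1, l * a.2)) P); last exact: cP.
  by apply: pair_continuous => r; apply: cvgM; [exact: cvg_id|exact: cvg_cst|exact: cvg_id|exact: cvg_cst].
- move=> p q; rewrite !inE => -[[s t] /= As <-] [[s' t'] /= As' <-].
  rewrite !pP => /rot_eq[Ex _ ct st]; apply/fiberP; split => //=.
  apply: W_x_inj Ex; have -> : s * s' = (e * s) * (e * s'); last exact: mulr_ge0.
  by transitivity (e ^+ 2 * (s * s')); [rewrite ee mul1r|ring].
- apply/seteqP; split=> [_ [_ [a Aa <-] <-]|q [/= r0 hq]].
    rewrite /= P_axis_dist P_height W_x_ge; split => //.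
    by rewrite -(eK a.1) fE.
  have [s s0 xs] := sur _ r0.
  have r_ge0 : 0 <= axis_dist q by exact: sqrtr_ge0.
  have [|t [h1 h2]] := @polar_exists _ (q 0 ix) (q 0 iy) (axis_dist q) r_ge0.
    by rewrite sqr_sqrtr // addr_ge0 ?sqr_ge0.
  exists (P (e * s, t)); first by exists (e * s, t) => //=; rewrite eK.
  rewrite pP; apply: row3P; rewrite pointE.
  - by rewrite h1 xs.
  - by rewrite h2 xs.
  - by rewrite -[LHS]fE // xs -hq.
Qed.

Lemma W_bigraph : exists zp zm : R -> R, [/\ bigraph S x0 z0 zp zm,
  oscillates_around_one x0 zp & oscillates_around_one x0 zm].
Proof.
have [zp [zpE _ c1 s1 o1]] := branch_graph H u0 v0.
have [zm [zmE _ c2 s2 o2]] := branch_graph H' u0' v0'.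
rewrite oppr0 e1 in c1 s1 o1 c2 s2 o2.
have [sg1 Hsg1] := branch_inverse H u0.
have [sg2 Hsg2] := branch_inverse H' u0'.
rewrite oppr0 e1 in Hsg1 Hsg2.
exists zp, zm; split => //; split.
- by rewrite -e1 zpE.
- by rewrite -e1 -(oppr0 R) zmE // oppr0.
exists (P @` [set a | 0 <= 1 * a.1]), (P @` [set a | 0 <= -1 * a.1]); split.
- apply: W_graph_component => //; first by rewrite expr1n.
    by move=> s s0'; rewrite mul1r zpE.
  by move=> r /Hsg1[g0 gx]; exists (sg1 r); rewrite // mul1r.
- apply: W_graph_component => //; first by rewrite sqrrN expr1n.
    by move=> s s0'; rewrite mulN1r zmE.
  by move=> r /Hsg2[g0 gx]; exists (sg2 r); rewrite // mulN1r.
- apply/seteqP; split => // p _; have [a <-] := sP p.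
  have [a0|/ltW a0] := leP 0 a.1; first by left; exists a; rewrite //= mul1r.
  by right; exists a; rewrite //= mulN1r oppr_ge0.
- apply/seteqP; split=> [p [[a /= + <-] [b /= + E]]|p /= []].
    rewrite mul1r mulN1r oppr_ge0 => a0 b0.
    have [ab _ _] := (fiberP b a).1 E.
    have a00 : a.1 = 0 by apply/eqP; rewrite eq_le a0 -ab b0.
    by rewrite P_axis_dist P_height a00 e1 e2.
  have [a <-] := sP p; rewrite P_axis_dist => xa _.
  have a00 : a.1 = 0.
    by apply/eqP; apply: contraT => /W_x_lt; rewrite xa ltxx.
  by split; exists a; rewrite //= a00 mulr0.
Qed.

End Fibers.

Lemma W_same_surface (S S' : surface R) (P : R * R -> S) (P' : R * R -> S') :
  generated_through setT x z P -> generated_through setT x z P' -> same_surface S S'.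
Proof.
move=> G G'; have [cP oP sP pP _] := G; have [cP' oP' sP' pP' _] := G'.
have sP1 q : exists a, P a = q by have [a _ <-] := sP q; exists a.
have sP2 q : exists a, P' a = q by have [a _ <-] := sP' q; exists a.
have E a b : P a = P b <-> P' a = P' b by rewrite (fiberP G) (fiberP G').
have [h ch hP] := factor_through (fun U oU => oP U oU (fun _ _ => Logic.I)) sP1
  (fun a => cP' a Logic.I) (fun a b => (E a b).1).
have [k ck kP] := factor_through (fun U oU => oP' U oU (fun _ _ => Logic.I)) sP2
  (fun a => cP a Logic.I) (fun a b => (E a b).2).
exists h, k; split => //.
- by move=> p; have [a <-] := sP1 p; rewrite hP kP.
- by move=> p; have [a <-] := sP2 p; rewrite kP hP.
- by move=> p; have [[s t] <-] := sP1 p; rewrite hP pP // pP'.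
Qed.

End WSurface.

End Surfaces.

(** * Existence *)

Section Existence.
Variable R : realType.
Implicit Types (x z u v : R -> R) (I J : set R) (S : surface R).

(** On each side of s = 0 the radius x is injective; near s = 0 the height z is,
    because its derivative is 1 there. *)
Lemma W_locally_injective (x0 z0 : R) x z u v (s0 : R) : W_solution x0 z0 x z u v ->
  exists2 A, nbhs s0 A &
    forall s s', A s -> A s' -> x s = x s' -> z s = z s' -> s = s'.
Proof.
move=> W; have [H e1 e2 u0 v0] := W.
have D s : ode x z u v s by have [_ _ _ ?] := H s Logic.I.
have [s0n|s0p|->] := ltgtP s0 0.
- exists [set s | s < 0].
    by apply: open_nbhs_nbhs; split; [exact: open_lt|].
  by move=> s s' /= sn sn' Ex _; apply: (W_x_inj W) Ex; nra.
- exists [set s | 0 < s].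
    by apply: open_nbhs_nbhs; split; [exact: open_gt|].
  by move=> s s' /= sn sn' Ex _; apply: (W_x_inj W) Ex; nra.
have [_ _ _ Dv] := D 0.
have : \forall s \near (0 : R), 0 < v s.
  have nv : nbhs (v 0) [set y | 0 < y].
    by apply: open_nbhs_nbhs; split; [exact: open_gt|rewrite /= v0].
  exact: is_derive_continuous Dv _ nv.
move=> /nbhs_ballP[e /= e0 he]; exists (ball 0 e); first exact: nbhsx_ballx.
have lt_z s s' : ball (0 : R) e s -> ball (0 : R) e s' -> s < s' -> z s < z s'.
  rewrite /ball /= !sub0r !normrN !ltr_norml => /andP[a1 a2] /andP[b1 b2] ss'.
  apply: (@deriv_gt0_lt _ z v _ _ ss') => r /andP[r1 r2].
  - by have [_ Dz _ _] := D r; exact: is_derive_continuous Dz.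
  - by have [_ Dz _ _] := D r.
  - apply: he; rewrite /ball /= sub0r normrN ltr_norml.
    by apply/andP; split; lra.
move=> s s' Bs Bs' _ Ez; have [/(lt_z _ _ Bs Bs')|/(lt_z _ _ Bs' Bs)|//] := ltgtP s s'.
  by rewrite Ez ltxx.
by rewrite Ez ltxx.
Qed.

(** The surface is the annulus itself: position and normal are functions of
    (s, t) that descend along polar. *)
Lemma W_exists (x0 z0 : R) : 0 < x0 -> 0 < z0 -> exists S : surface R, is_W x0 z0 S.
Proof.
move=> x00 z00; have [x [z [u [v [H e1 e2 e3 e4]]]]] := W_profile_exists x00 z00.
have W : W_solution x0 z0 x z u v by split.
have D s : ode x z u v s by have [_ _ _ ?] := H s Logic.I.
have M := maximal_W H; have [HI _] := M; have [_ [sx sz] us zs _] := HI.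
have cx : continuous x by move=> s; have [d _ _ _] := D s; exact: is_derive_continuous d.
have cz : continuous z by move=> s; have [_ d _ _] := D s; exact: is_derive_continuous d.
have cu : continuous u by move=> s; have [_ _ d _] := D s; exact: is_derive_continuous d.
have cv : continuous v by move=> s; have [_ _ _ d] := D s; exact: is_derive_continuous d.
have ux : derive1 x = u by apply/funext => s; have [d _ _ _] := D s; exact: derive1_val.
have vz : derive1 z = v by apply/funext => s; have [_ d _ _] := D s; exact: derive1_val.
have c1 (f : R -> R) : continuous f -> continuous (fun a : R * R => f a.1).
  by move=> cf a; apply: continuous_comp; [exact: fst_continuous|exact: cf].
have c2 (f : R -> R) : continuous f -> continuous (fun a : R * R => f a.2).
  by move=> cf a; apply: continuous_comp; [exact: snd_continuous|exact: cf].
have cc := c2 _ (@continuous_cos R); have cs := c2 _ (@continuous_sin R).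
have cP (f g h : R * R -> R) : continuous f -> continuous g -> continuous h ->
    continuous (fun a => point (f a) (g a) (h a)).
  move=> cf cg ch; apply: row_continuous => -[[|[|[|//]]] hk].
  - by have -> : Ordinal hk = ix; [exact: val_inj|under eq_fun do rewrite pointE].
  - by have -> : Ordinal hk = iy; [exact: val_inj|under eq_fun do rewrite pointE].
  - by have -> : Ordinal hk = iz; [exact: val_inj|under eq_fun do rewrite pointE].
have desc (F : R * R -> 'rV[R]_3) : continuous F ->
    (forall s t t', cos t = cos t' -> sin t = sin t' -> F (s, t) = F (s, t')) ->
    exists2 h : annulus_type R -> 'rV[R]_3, continuous h &
      forall a, h (polar_annulus_type a) = F a.
  move=> cF FE; apply: (factor_through (@polar_annulus_open R) (@polar_annulus_surj R) cF).
  by move=> [s t] [s' t'] /polar_annulus_eq /polar_eq[/= <- ct st]; exact: FE.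
have [|s t t' ct st|p cp pE] := desc (fun a => rot x z a.1 a.2).
- by apply: cP; [move=> a; apply: cvgM; [exact: (c1 x)|exact: cc]
    |move=> a; apply: cvgM; [exact: (c1 x)|exact: cs]|exact: c1].
- by rewrite /rot /= ct st.
have [|s t t' ct st|n cn nE] := desc (fun a => rot_normal x z a.1 a.2).
- rewrite /rot_normal ux vz; have czv : continuous (fun s => z s * v s).
    by move=> s; apply: cvgM; [exact: cz|exact: cv].
  apply: cP.
  + by move=> a; apply: cvgN; apply: cvgM; [exact: (c1 _ czv)|exact: cc].
  + by move=> a; apply: cvgN; apply: cvgM; [exact: (c1 _ czv)|exact: cs].
  + by apply: (c1 (fun s => z s * u s)) => s; apply: cvgM; [exact: cz|exact: cu].
- by rewrite /rot_normal /= ct st.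
exists (Surface p n), setT, x, z; split => //; last first.
  by exists 0; rewrite ux; split.
exists (@polar_annulus_type R); split => //.
- exact: annulus_hausdorff.
- split.
  + by move=> a _; exact: polar_annulus_continuous.
  + by move=> U oU _; exact: polar_annulus_open.
  + by move=> q; have [a <-] := polar_annulus_surj q; exists a.
  + by move=> s t _ /=; rewrite pE.
  + move=> s0 _; have [A nA inj] := W_locally_injective s0 W.
    apply: near2_intro nA _ => s s' As As' t t' /(rot_eq W)[Ex Ez ct st].
    by apply/polar_annulus_eq/polar_eq; split => //=; exact: inj.
- move=> s t _ _ /=; rewrite nE.
  exact: (rot_normal_unit (I := setT) Logic.I sx (us _ Logic.I) (zs _ Logic.I)).
Qed.

End Existence.

(** * Classification *)

Section Classification.
Variable R : realType.
Implicit Types (x z u v : R -> R) (I J : set R) (S : surface R).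

Lemma interval_sign I (f : R -> R) : is_interval I ->
  (forall s, I s -> {for s, continuous f}) -> (forall s, I s -> f s != 0) ->
  (forall s, I s -> 0 < f s) \/ (forall s, I s -> f s < 0).
Proof.
move=> iI cf fn.
have key a b : I a -> I b -> a <= b -> 0 < f a * f b.
  move=> Ia Ib ab; rewrite ltNge; apply/negP => le0.
  have ca := fn _ Ia; have cb := fn _ Ib.
  have [||c] := @IVT _ f a b 0 ab.
  - by apply: within_continuous => r rab; apply/cf/(iI a b).
  - by rewrite ge_min le_max; have [] := ltP (f a) 0; have [] := ltP (f b) 0 => //= h1 h2; nra.
  rewrite in_itv /= => cab; apply/eqP/fn; exact: (iI a b).
have {}key a b : I a -> I b -> 0 < f a * f b.
  move=> Ia Ib; have [/key|/ltW/key] := leP a b; first exact.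
  by rewrite mulrC; exact.
have [[s0 [Is0 p0]]|n] := pselect (exists s, I s /\ 0 < f s).
  by left=> s Is; have := key _ _ Is0 Is; rewrite pmulr_rgt0.
right=> s Is; rewrite lt_neqAle fn // leNgt; apply/negP => p.
by apply: n; exists s.
Qed.

(** The curve accumulates at no point (a, 0) of the ideal line. This condition
    depends on the image of the curve only, hence passes to the reversed curve. *)
Definition off_ideal_line I x z := forall a : R, exists2 e : R, 0 < e &
  forall s, I s -> e <= z s \/ e <= `|x s - a|.

Lemma surface_off_ideal_line S I x z P : generated_through (S := S) I x z P ->
  (forall s, I s -> 0 < z s) -> no_finite_ideal_point S -> off_ideal_line I x z.
Proof.
move=> [_ _ _ pP _] zs nI a; apply: contrapT => no.
have : height (point a 0 0) != 0; last by rewrite /height pointE eqxx.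
apply: nI => B nB.
pose g (b : R * R) := point b.1 0 b.2.
have cg : continuous g.
  apply: row_continuous => -[[|[|[|//]]] hk].
  - have -> : Ordinal hk = ix by exact: val_inj.
    by under eq_fun do rewrite pointE; exact: fst_continuous.
  - have -> : Ordinal hk = iy by exact: val_inj.
    by under eq_fun do rewrite pointE; exact: cst_continuous.
  - have -> : Ordinal hk = iz by exact: val_inj.
    by under eq_fun do rewrite pointE; exact: snd_continuous.
have /nbhs_ballP[e /= e0 he] : nbhs (a, 0) (g @^-1` B) by exact: cg.
have [s [Is z1 x1]] : exists s, [/\ I s, z s < e & `|x s - a| < e].
  apply: contrapT => ns; apply: no; exists e => // s Is.
  have [z1|z1] := leP e (z s); first by left.
  by right; rewrite leNgt; apply/negP => x1; apply: ns; exists s.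
exists (pos (P (s, 0))); split; first by exists (P (s, 0)).
rewrite pP //; have -> : rot x z s 0 = g (x s, z s).
  by rewrite /rot cos0 sin0 mulr1 mulr0.
apply: he; split; rewrite /ball /=; first by rewrite distrC.
by rewrite sub0r normrN gtr0_norm // zs.
Qed.

(** Backwards in time x decreases to its infimum, so near the end of the curve z
    is bounded below. *)
Lemma no_increasing_curve I x z : maximal_curve I x z -> off_ideal_line I x z ->
  (forall s, I s -> 0 < x s) -> (forall s, I s -> 0 < derive1 x s) -> False.
Proof.
move=> M off xp up; have [HI _] := M; have [[_ iI [s0 Is0]] _ _ _ _] := HI.
have [Dx _] := curve_derive HI.
have hi : has_inf (x @` I).
  by split; [exists (x s0), s0|exists 0 => _ [s Is <-]; rewrite ltW // xp].
have [e e0 He] := off (inf (x @` I)).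
have [_ [s1 Is1 <-] s1e] := inf_adherent e0 hi.
apply: (no_monotone_maximal M xp up e0 Is1) => s Is ss1.
have ge : inf (x @` I) <= x s by apply: ge_inf; [case: hi|exists s].
have le : x s <= x s1.
  by apply: (@deriv_ge0_le _ x (derive1 x) _ _ ss1) => r rs;
    [apply: Dx|apply/ltW/up]; exact: (iI s s1).
have [//|] := He s Is; rewrite ger0_norm ?subr_ge0 //; lra.
Qed.

(** Otherwise x' has a constant sign, which can be made positive by reversing the
    curve. *)
Lemma vertical_tangent I x z : maximal_curve I x z -> off_ideal_line I x z ->
  (forall s, I s -> 0 < x s) -> exists2 s0, I s0 & derive1 x s0 = 0.
Proof.
move=> M off xp; apply: contrapT => no.
have [HI _] := M; have [[oI iI [s1 Is1]] _ _ _ _] := HI.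
have [Dx _] := curve_derive HI.
have un s : I s -> derive1 x s != 0.
  by move=> Is; apply/negP => /eqP E; apply: no; exists s.
have cu s : I s -> {for s, continuous (derive1 x)}.
  by move=> Is; have [[_ h] _] := curve_class_C HI 1%N; exact: h.
have [up|un'] := interval_sign iI cu un; first exact: no_increasing_curve M off xp up.
have k1 : (-1 : R) ^+ 2 = 1 by rewrite sqrrN expr1n.
apply: (no_increasing_curve (maximal_affine 0 k1 M)).
- by move=> a; have [e e0 He] := off a; exists e => // s /He.
- by move=> s /= Is; exact: xp.
- move=> s /= Is; rewrite (derive1_val (is_derive_affine (Dx _ Is))) mulN1r oppr_gt0.
  exact: un'.
Qed.

(** Rotating by pi about the axis turns the curve (x, z) into (-x, z). *)
Lemma generated_flip S I x z : horo_shrinker_curve I x z -> generated_by S I x z ->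
  generated_by S I (fun s => - x s) z.
Proof.
move=> HI [P [hS cn G un]].
have [_ [sx sz] us zs _] := HI; have [_ [sx' _] _ _ _] := horo_curve_flip HI.
have [Dx Dz] := curve_derive HI.
have rE s t : rot (fun s => - x s) z s t = rot x z s (t + pi).
  by rewrite /rot cosDpi sinDpi !mulrN !mulNr.
have E (r : R) : 1 * r + 0 = r by rewrite mul1r addr0.
have k1 : (1 : R) ^+ 2 = 1 by rewrite expr1n.
exists (fun a => P (a.1, a.2 + pi)); split => //.
  have := @generated_through_affine _ S I x z P 1 0 pi (fun s => - x s) k1.
  have -> : (fun s => z (1 * s + 0)) = z by apply/funext => s; rewrite E.
  have -> : [set s | I (1 * s + 0)] = I by apply/seteqP; split=> s /=; rewrite E.
  have -> : (fun a : R * R => P (1 * a.1 + 0, a.2 + pi)) = (fun a => P (a.1, a.2 + pi)).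
    by apply/funext => a; rewrite E.
  by apply => // s t; rewrite E rE.
move=> s t Is; rewrite oppr_eq0 => xs; have [n1 nT] := un s (t + pi) Is xs.
split=> [|i]; rewrite rE //; rewrite -(nT i); congr hdot.
have [->|->] : i = 0 \/ i = 1.
  by case: i => -[|[|//]] h; [left|right]; exact: val_inj.
- rewrite !(rot_tangent0 (I := I)) // (derive1_val (d_opp (Dx s Is))) cosDpi sinDpi.
  by rewrite !mulrN !mulNr.
- by rewrite !rot_tangent1 cosDpi sinDpi !mulrN !mulNr.
Qed.

Theorem rotational_is_W S : rotational_horo_shrinker S -> avoids_axis S ->
  no_finite_ideal_point S -> exists x0 z0 : R, [/\ 0 < x0, 0 < z0 & is_W x0 z0 S].
Proof.
move=> [I [x [z [M G]]]] av nI.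
have main x1 : maximal_curve I x1 z -> generated_by S I x1 z ->
    (forall s, I s -> 0 < x1 s) -> exists x0 z0 : R, [/\ 0 < x0, 0 < z0 & is_W x0 z0 S].
  move=> M1 G1 xp; have [[_ _ _ zs _] _] := M1.
  have [P [_ _ GP _]] := G1.
  have [s0 Is0 us0] := vertical_tangent M1 (surface_off_ideal_line GP zs nI) xp.
  exists (x1 s0), (z s0); split; [exact: xp|exact: zs|].
  by exists I, x1, z; split => //; exists s0.
have [HI _] := M; have [[_ iI _] _ _ _ _] := HI; have [Dx _] := curve_derive HI.
have [P [_ _ [_ _ _ pP _] _]] := G.
have xn s : I s -> x s != 0.
  by move=> Is; have := av (P (s, 0)); rewrite pP // rot_axis_dist normr_gt0.
have [|xp|xn'] := @interval_sign I x iI _ xn.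
- by move=> s Is; exact: is_derive_continuous (Dx s Is).
- exact: main M G xp.
- apply: main (maximal_flip M) (generated_flip HI G) _ => s Is.
  by rewrite oppr_gt0 xn'.
Qed.

End Classification.

Theorem theorem4p4 (R : realType) :
  [/\ forall x0 z0 : R, 0 < x0 -> 0 < z0 ->
        (exists S : surface R, is_W x0 z0 S) /\
        (forall S S' : surface R,
           is_W x0 z0 S -> is_W x0 z0 S' -> same_surface S S'),
      forall S : surface R,
        rotational_horo_shrinker S -> avoids_axis S ->
        no_finite_ideal_point S ->
        exists x0 z0 : R, [/\ 0 < x0, 0 < z0 & is_W x0 z0 S] &
      forall (x0 z0 : R) (S : surface R), 0 < x0 -> 0 < z0 -> is_W x0 z0 S ->
        [/\ [/\ inf (range (fun p : S => axis_dist (pos p))) = x0,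
                exists p : S, axis_dist (pos p) = x0 &
                forall p : S, axis_dist (pos p) = x0 -> height (pos p) = z0],
            forall p : S,
              0 < height (pos p) /\
              x0 ^+ 2 <= pos p 0 ix ^+ 2 + pos p 0 iy ^+ 2,
            homeo_annulus R S &
            exists zp zm : R -> R,
              [/\ bigraph S x0 z0 zp zm,
                  oscillates_around_one x0 zp &
                  oscillates_around_one x0 zm]]].
Proof.
have sol x0 z0 : 0 < x0 -> 0 < z0 -> exists x z u v, @W_solution R x0 z0 x z u v.
  by move=> x00 z00; exact: W_profile_exists.
split.
- move=> x0 z0 x00 z00; split; first exact: W_exists.
  have [x [z [u [v W]]]] := sol _ _ x00 z00.
  move=> S S' /(is_W_normal W)[P G] /(is_W_normal W)[P' G'].
  exact (W_same_surface W G G').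
- exact: rotational_is_W.
- move=> x0 z0 S x00 z00 WS; have [x [z [u [v W]]]] := sol _ _ x00 z00.
  have [P G] := is_W_normal W WS; split.
  + exact (W_closest W G).
  + exact (W_outside x00 W G).
  + exact (W_annulus W G).
  + exact (W_bigraph W G).
Qed.
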